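(* Let $X$ be a real Banach space and let $C\subset X$ be a non-empty closed convex subset. The following conditions are equivalent: (1) $C$ is approximatively polyhedral; (2) the characteristic cone $V_C$ of $C$ is polyhedral in $X$ and $d_H(C,V_C)<\infty$; (3) the component $\mathcal H_C$ contains a polyhedral closed convex set; (4) the component $\mathcal H_C$ contains no positively hiding closed convex set; (5) the metric space $(\mathcal H_C,d_H)$ is separable; (6) the metric space $(\mathcal H_C,d_H)$ has density $\mathrm{dens}(\mathcal H_C)<\mathfrak c$. If moreover $X$ is finite-dimensional, then the conditions (1)–(6) are equivalent to each of: (7) $C$ is not positively hiding; (8) $C$ is not infinitely hiding.
   Context: All Banach spaces are over $\mathbb R$. For $a\in X$ and $B\subset X$, $\mathrm{dist}(a,B)=\inf_{b\in B}\|a-b\|$. The Hausdorff distance of non-empty sets $A,B\subset X$ is $d_H(A,B)=\max\{\sup_{a\in A}\mathrm{dist}(a,B),\sup_{b\in B}\mathrm{dist}(b,A)\}\in[0,\infty]$. $\mathrm{Conv}_H(X)$ is the set of all non-empty closed convex subsets of $X$, and for $C\in \mathrm{Conv}_H(X)$ its component is $\mathcal H_C=\{A\in\mathrm{Conv}_H(X): d_H(A,C)<\infty\}$, a metric space with metric $d_H$. A closed half-space is a set $f^{-1}([a,+\infty))$ with $f:X\to\mathbb R$ a non-zero continuous linear functional and $a\in\mathbb R$. A convex set is polyhedral (in $X$) if it is the intersection of a finite (possibly empty) family of closed half-spaces of $X$; the intersection of the empty family is $X$. $C$ is approximatively polyhedral if for every $\varepsilon>0$ there is a (non-empty) polyhedral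 set $P\subset X$ with $d_H(C,P)<\varepsilon$. The characteristic cone of a convex set $C\subset X$ is $V_C=\{v\in X: c+tv\in C\text{ for all }c\in C,\ t\ge 0\}$. A set $C$ hides a set $A\subset X$ if for any two distinct points $a,b\in A$ the segment $[a,b]=\{ta+(1-t)b:t\in[0,1]\}$ meets $C$. A convex set $C$ is positively hiding if $C$ hides some infinite set $A\subset X\setminus C$ with $\inf_{a\in A}\mathrm{dist}(a,C)>0$; it is infinitely hiding if $C$ hides some infinite set $A\subset X\setminus C$ with $\sup_{a\in A}\mathrm{dist}(a,C)=\infty$. The density $\mathrm{dens}(Y)$ of a topological space $Y$ is the smallest cardinality of a dense subset of $Y$; $Y$ is separable if its density is at most countable; $\mathfrak c$ is the cardinality of the continuum. *)

(* Defs.v *)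
From HB Require Import structures.
From mathcomp Require Import all_boot all_order all_algebra.
From mathcomp Require Import all_classical all_reals all_analysis.

Set Implicit Arguments.
Unset Strict Implicit.
Unset Printing Implicit Defensive.

Import Order.TTheory GRing.Theory Num.Theory.
Import numFieldNormedType.Exports.

Local Open Scope classical_set_scope.
Local Open Scope ring_scope.
Local Open Scope ereal_scope.
Local Open Scope card_scope.

Section HausdorffDistance.
Context {R : realType} {X : normedModType R}.
Implicit Types (a b : X) (A B C : set X).

Definition set_dist a B : \bar R := ereal_inf [set `|a - b|%:E | b in B].

(* Meant for non-empty arguments: the supremum of the empty set is -oo. *)
Definition hausdorff_dist A B : \bar R :=
  maxe (ereal_sup [set set_dist a B | a in A])
       (ereal_sup [set set_dist b A | b in B]).

Definition conv_H : set (set X) :=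
  [set A | [/\ A !=set0, closed A & convex_set (A : set (convex_lmodType X))]].

Definition component C : set (set X) :=
  [set A | conv_H A /\ hausdorff_dist A C < +oo].

Lemma set_dist_ge0 a B : 0 <= set_dist a B.
Proof. by apply: le_ereal_inf_tmp => _ [b _ <-]; rewrite lee_fin. Qed.

Lemma set_dist_le a b B : B b -> set_dist a B <= `|a - b|%:E.
Proof. by move=> Bb; apply: ereal_inf_lbound; exists b. Qed.

Lemma set_dist_triangle a b B :
  set_dist a B <= `|a - b|%:E + set_dist b B.
Proof.
rewrite -leeBlDl//; apply: le_ereal_inf_tmp => _ [c Bc <-].
rewrite leeBlDl// (le_trans (set_dist_le _ Bc))// -EFinD lee_fin.
by rewrite (le_trans _ (ler_normD _ _))// addrA subrK.
Qed.

Lemma hausdorff_dist_sym A B : hausdorff_dist A B = hausdorff_dist B A.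
Proof. by rewrite /hausdorff_dist maxC. Qed.

Lemma set_dist_le_hausdorff a A B :
  A a -> set_dist a B <= hausdorff_dist A B.
Proof.
move=> Aa; rewrite /hausdorff_dist le_max; apply/orP; left.
by apply: ereal_sup_ubound; exists a.
Qed.

Lemma hausdorff_dist_ge0 A B : A !=set0 -> 0 <= hausdorff_dist A B.
Proof.
by move=> [a Aa]; exact: le_trans (set_dist_ge0 a B) (set_dist_le_hausdorff _ Aa).
Qed.

Lemma set_dist_hausdorff_triangle a A B C : A a -> B !=set0 ->
  set_dist a C <= hausdorff_dist A B + hausdorff_dist B C.
Proof.
move=> Aa [b0 Bb0]; have [oo|AB] := eqVneq (hausdorff_dist A B) +oo.
  rewrite oo addye ?leey// -ltNye (lt_le_trans _ (hausdorff_dist_ge0 _ _))//.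
  by exists b0.
have d0 : set_dist a B \is a fin_num.
  rewrite ge0_fin_numE ?set_dist_ge0//.
  by rewrite (le_lt_trans (set_dist_le_hausdorff _ Aa))// ltey.
apply/lee_addgt0Pr => e e0.
have [_ [b Bb <-] abe] := lb_ereal_inf_adherent e0 d0.
apply: (le_trans (set_dist_triangle a b C)).
rewrite addeAC; apply: leeD; last exact: set_dist_le_hausdorff.
by apply: (le_trans (ltW abe)); apply: leeD => //; exact: set_dist_le_hausdorff.
Qed.

Lemma hausdorff_dist_triangle A B C : B !=set0 ->
  hausdorff_dist A C <= hausdorff_dist A B + hausdorff_dist B C.
Proof.
move=> B0; rewrite {1}/hausdorff_dist ge_max; apply/andP; split.
  by apply: ge_ereal_sup => _ [a Aa <-]; exact: set_dist_hausdorff_triangle.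
apply: ge_ereal_sup => _ [c Cc <-].
rewrite addeC (hausdorff_dist_sym A) (hausdorff_dist_sym B).
exact: set_dist_hausdorff_triangle.
Qed.

Lemma hausdorff_dist_refl A : A !=set0 -> hausdorff_dist A A = 0.
Proof.
move=> A0; apply/eqP; rewrite eq_le hausdorff_dist_ge0// andbT.
rewrite /hausdorff_dist maxxx; apply: ge_ereal_sup => _ [a Aa <-].
by rewrite (le_trans (set_dist_le _ Aa))// subrr normr0.
Qed.

Lemma hausdorff_dist0_sub A B : closed B -> hausdorff_dist A B = 0 -> A `<=` B.
Proof.
move=> cB AB0 a Aa; apply: cB => U /nbhs_ballP[e /= e0 eU].
have d0 : set_dist a B = 0.
  by apply/eqP; rewrite eq_le set_dist_ge0 andbT -AB0 set_dist_le_hausdorff.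
have [|_ [b Bb <-]] := @lb_ereal_inf_adherent _ [set `|a - b|%:E | b in B] _ e0.
  by rewrite -/(set_dist a B) d0.
rewrite -/(set_dist a B) d0 add0e lte_fin => abe.
by exists b; split => //; apply: eU; rewrite -ball_normE.
Qed.

End HausdorffDistance.

Section ComponentMetric.
Context {R : realType} {X : normedModType R}.
Variable C : set X.

Definition component_space : Type := set_type (component C).

HB.instance Definition _ :=
  Choice.copy component_space (set_type (component C)).

Implicit Types A B D : component_space.

Definition component_dist A B : R := fine (hausdorff_dist (val A) (val B)).

Lemma component_conv A : conv_H (val A).
Proof. by have /set_mem[] := valP A. Qed.

Lemma component_neq0 A : val A !=set0.
Proof. by have [] := component_conv A. Qed.

Lemma component_center_neq0 A : C !=set0.
Proof.
have /set_mem[[[a Aa] _ _] AC] := valP A.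
have : set_dist a C < +oo := le_lt_trans (set_dist_le_hausdorff C Aa) AC.
by move=> /ereal_inf_lt[_ [c Cc _] _]; exists c.
Qed.

Lemma component_fin A B : hausdorff_dist (val A) (val B) \is a fin_num.
Proof.
rewrite ge0_fin_numE; last exact/hausdorff_dist_ge0/component_neq0.
have := hausdorff_dist_triangle (val A) (val B) (component_center_neq0 A).
move=> /le_lt_trans; apply; have /set_mem[_ AC] := valP A.
by have /set_mem[_] := valP B; rewrite hausdorff_dist_sym => BC; exact: lte_add_pinfty.
Qed.

Let component_distxx A : component_dist A A = 0%R.
Proof. by rewrite /component_dist (hausdorff_dist_refl (component_neq0 A)). Qed.

Let component_dist_eq0 A B : component_dist A B = 0%R -> A = B.
Proof.
move=> AB; have AB0 : hausdorff_dist (val A) (val B) = 0.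
  by rewrite -(fineK (component_fin A B)) -/(component_dist A B) AB.
have [_ cA _] := component_conv A; have [_ cB _] := component_conv B.
apply/val_inj/seteqP; split; apply: hausdorff_dist0_sub => //.
by rewrite hausdorff_dist_sym.
Qed.

Let component_dist_sym A B : component_dist A B = component_dist B A.
Proof. by rewrite /component_dist hausdorff_dist_sym. Qed.

Let component_dist_triangle B A D :
  (component_dist A D <= component_dist A B + component_dist B D)%R.
Proof.
rewrite -lee_fin EFinD !fineK ?component_fin//.
exact/hausdorff_dist_triangle/component_neq0.
Qed.

HB.instance Definition _ := isMetric.Build R component_space
  component_distxx component_dist_eq0 component_dist_sym
  component_dist_triangle.

End ComponentMetric.

Section Polyhedral.
Context {R : realType} {X : normedModType R}.
Implicit Types (A C H P : set X).

Definition closed_half_space H := exists (f : {linear X -> R^o}) (a : R),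
  [/\ continuous f, exists x, f x != 0%R & H = f @^-1` [set` `[a, +oo[%R]].

Definition polyhedral P := exists F : set (set X),
  [/\ finite_set F, F `<=` closed_half_space & P = \bigcap_(H in F) H].

Definition approx_polyhedral C := forall e : R, (0 < e)%R ->
  exists P, [/\ P !=set0, polyhedral P & hausdorff_dist C P < e%:E].

Definition char_cone C : set X :=
  [set v | forall c (t : R), C c -> (0 <= t)%R -> C (c + t *: v)%R].

Definition segment (a b : X) : set X :=
  [set (t *: a + (1 - t) *: b)%R | t in `[0%R, 1%R]%classic].

Definition hides C A := forall a b, A a -> A b -> a <> b ->
  segment a b `&` C !=set0.

Definition positively_hiding C := exists A, [/\ infinite_set A,
  A `<=` ~` C, hides C A & 0 < ereal_inf [set set_dist a C | a in A]].

Definition infinitely_hiding C := exists A, [/\ infinite_set A,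
  A `<=` ~` C, hides C A & ereal_sup [set set_dist a C | a in A] = +oo].

End Polyhedral.

Section Density.
Context {Y : topologicalType}.

(* The cardinality of such a D is the density of Y; cardinals are only
   available through the comparison of sets. *)
Definition min_dense (D : set Y) :=
  dense D /\ forall E : set Y, dense E -> D #<= E.

End Density.

Definition card_lt T U (A : set T) (B : set U) :=
  (A #<= B) /\ ~ (B #<= A).

Definition separable_space (Y : topologicalType) :=
  exists2 D : set Y, min_dense D & countable D.

Definition density_lt (Y : topologicalType) T (K : set T) :=
  exists2 D : set Y, min_dense D & card_lt D K.

Definition finite_dim (R : realType) (X : lmodType R) :=
  exists (n : nat) (e : 'I_n -> X), forall x : X,
    exists c : 'I_n -> R, x = (\sum_(i < n) c i *: e i)%R.

(* Main.v *)
From HB Require Import structures.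
Require Import Defs.
From mathcomp Require Import finmap all_boot all_order all_algebra.
From mathcomp Require Import all_classical all_reals all_analysis.
From mathcomp Require Import ring lra.
Import Order.TTheory GRing.Theory Num.Theory.
Import numFieldNormedType.Exports.

Set Implicit Arguments.
Unset Strict Implicit.
Unset Printing Implicit Defensive.

Local Open Scope classical_set_scope.
Local Open Scope ring_scope.

(** Write [V] for the recession cone of [C] and [B] for the cone of barrier
    functionals of [C], the continuous functionals bounded above on [C]. Then
    [V] is the polar of [B]. Everything turns on whether finitely many elements
    of [B] suffice to describe [V]; such a finite family is called a
    recession system of [C].

    A recession system is shared by all members of the component of [C], because
    sets at finite Hausdorff distance have the same recession cone and the same
    barrier functionals. Hoffman's error bound [hoffman], which follows from a
    conformal decomposition of vectors with respect to finitely many functionals,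
    says that violating the inequalities of [V] by little means being close to
    [V]. Combined with Dickson's lemma for the values of the functionals
    ([finite_cofinal]), it shows that [C] is close to [D + V] for a finite subset
    [D] of [C]. Hence [C] is approximatively polyhedral and at finite distance
    from [V], the component is separable, since rational approximations of the
    values on [D] determine [C] up to a small error, and no member of the
    component hides an infinite set at positive distance. Conversely a
    polyhedral set in the component provides a recession system.

    A positively hiding member [A] of the component makes the component large:
    after moving the hidden points to bounded distance of [A], the union of the
    cones over [A] with apexes in a given set of these points is convex, and
    different sets of apexes give hulls at distance bounded below
    ([density_not_hiding]); a continuum of subsets of the rationals then refutes
    density below the continuum.

    It remains to find a positively hiding set in the component when there is no
    recession system. Replace [C] by its closed unit neighbourhood, which has
    interior points.

    If no finite family of continuous functionals has its common kernel inside
    the lineality space of [V], one constructs bounded functionals [a n] and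
    points [w n] of the set such that [a n] supports the set at [w n] while
    [a n] is at most one half at the other [w m] ([localized_system]). Pushing
    each [w n] slightly out, and adding the midpoints of the pushed points,
    produces a positively hiding set in the component ([localized_hiding]).

    Otherwise [B] is finite-dimensional. If for every [p] in [V] the polar of
    the face of [B] orthogonal to [p] is [V + R p], then by induction on the
    dimension every proper face of [B] is generated by finitely many of its
    elements as far as polars are concerned, and compactness of the sphere
    extends this to [B] ([generating_of_faces_exact]); this is a recession
    system. If the condition fails at [p] and [q], the trace of [C] on a plane
    spanned by [p] and [q] looks like a parabola with axis [p]: it hides points
    that go to infinity ([planar_hiding]). In finite dimension only this second
    situation occurs, and there the points are hidden behind [C] itself, because
    one can work in the affine hull of [C]. *)

(** * Linear identities in modules *)

Section ModuleExpressions.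
Context {R : realType} {X : lmodType R}.

Inductive mexp : Type :=
| MVar of nat | MZero | MAdd of mexp & mexp | MOpp of mexp | MScale of R & mexp.

Fixpoint mval (env : seq X) e : X :=
  match e with
  | MVar i => nth 0 env i
  | MZero => 0
  | MAdd a b => mval env a + mval env b
  | MOpp a => - mval env a
  | MScale k a => k *: mval env a
  end.

Fixpoint mcoef e (i : nat) : R :=
  match e with
  | MVar j => if eqn i j then 1 else 0
  | MZero => 0
  | MAdd a b => mcoef a i + mcoef b i
  | MOpp a => - mcoef a i
  | MScale k a => k * mcoef a i
  end.

(** A bounded quantifier that computes to a conjunction, so that an equality
    of module expressions becomes a list of equalities in the scalar field. *)
Fixpoint forall_below n (P : nat -> Prop) : Prop :=
  if n is m.+1 then P m /\ forall_below m P else True.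

Lemma mvalE env e : mval env e = \sum_(i < size env) mcoef e i *: nth 0 env i.
Proof.
elim: e => [j||a IHa b IHb|a IHa|k a IHa] /=.
- have [js|js] := ltnP j (size env).
    rewrite (bigD1 (Ordinal js))//= eqnE eqxx scale1r big1 ?addr0// => i.
    by rewrite -val_eqE/= => /negbTE ij; rewrite ?eqnE ij scale0r.
  rewrite nth_default// big1// => i _; have -> : eqn i j = false.
    by rewrite eqnE; apply/eqP => ij; have := ltn_ord i; rewrite ij ltnNge js.
  by rewrite scale0r.
- by rewrite big1// => i _; rewrite scale0r.
- by rewrite IHa IHb -big_split; apply: eq_bigr => i _; rewrite scalerDl.
- by rewrite IHa -sumrN; apply: eq_bigr => i _; rewrite scaleNr.
- by rewrite IHa scaler_sumr; apply: eq_bigr => i _; rewrite scalerA.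
Qed.

Lemma mexp_eq env a b : forall_below (size env) (fun i => mcoef a i = mcoef b i) ->
  mval env a = mval env b.
Proof.
move=> h; rewrite !mvalE; apply: eq_bigr => i _; congr (_ *: _).
have : (i < size env)%N by [].
move: (nat_of_ord i) => {}i; elim: (size env) h => [//|n IH] /= [hn hb].
by rewrite ltnS leq_eqVlt => /predU1P[->//|/IH]; exact.
Qed.

End ModuleExpressions.

Ltac mod_find x env :=
  lazymatch env with
  | x :: _ => constr:(0%N)
  | _ :: ?env' => let n := mod_find x env' in constr:(S n)
  end.

Ltac mod_mem x env :=
  lazymatch env with
  | x :: _ => constr:(true)
  | _ :: ?env' => mod_mem x env'
  | _ => constr:(false)
  end.

Ltac mod_atoms e env :=
  lazymatch e with
  | @GRing.add _ ?a ?b => let env' := mod_atoms a env in mod_atoms b env'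
  | @GRing.opp _ ?a => mod_atoms a env
  | @GRing.scale _ _ _ ?a => mod_atoms a env
  | @GRing.zero _ => env
  | _ => let m := mod_mem e env in
    lazymatch m with true => env | false => constr:(e :: env) end
  end.

Ltac mod_reify e env :=
  lazymatch e with
  | @GRing.add _ ?a ?b => let a' := mod_reify a env in
      let b' := mod_reify b env in open_constr:(MAdd a' b')
  | @GRing.opp _ ?a => let a' := mod_reify a env in open_constr:(MOpp a')
  | @GRing.scale _ _ ?k ?a => let a' := mod_reify a env in open_constr:(MScale k a')
  | @GRing.zero _ => open_constr:(MZero)
  | _ => let n := mod_find e env in open_constr:(MVar n)
  end.

(** Reduces an equation between linear combinations of vectors to the
    equations between the coefficients of each vector. *)
Ltac module_coef :=
  lazymatch goal with
  | |- @eq ?T ?a ?b =>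
    let env0 := mod_atoms a (@nil T) in
    let env := mod_atoms b env0 in
    let ea := mod_reify a env in
    let eb := mod_reify b env in
    apply: (@mexp_eq _ _ env ea eb); cbn [forall_below size mcoef eqn];
    repeat (split; [idtac|]); try exact I
  end.

Ltac module := module_coef; ring.
Ltac module_field := module_coef; field.


Section LinearFunctionals.
Context {R : realType} {X : lmodType R}.
Implicit Types (f p : X -> R) (x y z : X).

Definition lin f := forall (k : R) x y, f (k *: x + y) = k * f x + f y.

Lemma lin0 f : lin f -> f 0 = 0.
Proof.
by move=> /(_ 1 0 0); rewrite scaler0 addr0 mul1r => e; lra.
Qed.

Lemma linZ f k x : lin f -> f (k *: x) = k * f x.
Proof. by move=> lf; have := lf k x 0; rewrite !addr0 (lin0 lf) addr0. Qed.

Lemma linD f x y : lin f -> f (x + y) = f x + f y.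
Proof. by move=> lf; have := lf 1 x y; rewrite scale1r mul1r. Qed.

Lemma linN f x : lin f -> f (- x) = - f x.
Proof. by move=> lf; rewrite -scaleN1r linZ// mulN1r. Qed.

Lemma linB f x y : lin f -> f (x - y) = f x - f y.
Proof. by move=> lf; rewrite linD// linN. Qed.

Lemma lin_sum f (I : finType) (F : I -> X) :
  lin f -> f (\sum_i F i) = \sum_i f (F i).
Proof.
move=> lf; apply: (big_ind2 (fun a b => f a = b)) => //; first exact: lin0.
by move=> a b c d <- <-; rewrite linD.
Qed.

Lemma lin_comb f (I : finType) (k : I -> R) (F : I -> X) :
  lin f -> f (\sum_i k i *: F i) = \sum_i k i * f (F i).
Proof. by move=> lf; rewrite lin_sum//; apply: eq_bigr => i _; rewrite linZ. Qed.

Lemma comb_lin (I : finType) (k : I -> R) (F : I -> X -> R) :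
  (forall i, lin (F i)) -> lin (fun x => \sum_i k i * F i x).
Proof.
move=> lF c x y; rewrite mulr_sumr -big_split/=; apply: eq_bigr => i _.
by rewrite lF; ring.
Qed.

Definition sublinear p :=
  (forall x y, p (x + y) <= p x + p y) /\
  (forall t x, 0 < t -> p (t *: x) <= t * p x).

Lemma sublinear0 p : sublinear p -> p 0 = 0.
Proof.
move=> [_ pZ].
have h1 : p 0 <= 2 * p 0 by rewrite -{1}(scaler0 X (2 : R)); exact: pZ.
have h2 : p 0 <= 2^-1 * p 0.
  by rewrite -{1}(scaler0 X (2^-1 : R)); apply: pZ; rewrite invr_gt0.
lra.
Qed.

Lemma sublinearZ p t x : sublinear p -> 0 <= t -> p (t *: x) = t * p x.
Proof.
move=> sp; rewrite le_eqVlt => /predU1P[<-|t0].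
  by rewrite scale0r mul0r (sublinear0 sp).
have [_ pZ] := sp; apply/eqP; rewrite eq_le pZ//=.
have h : p x <= t^-1 * p (t *: x).
  have e : x = t^-1 *: (t *: x) by rewrite scalerA mulVf ?gt_eqF// scale1r.
  by rewrite {1}e; apply: pZ; rewrite invr_gt0.
have := ler_wpM2l (ltW t0) h.
by rewrite mulrA divff ?gt_eqF// mul1r.
Qed.

Lemma sublinearN p x : sublinear p -> - p (- x) <= p x.
Proof.
move=> sp; have := sp.1 x (- x); rewrite subrr (sublinear0 sp); lra.
Qed.

Lemma le_infD (A B : set R) (z : R) : A !=set0 -> B !=set0 ->
  (forall a b, A a -> B b -> z <= a + b) -> z <= inf A + inf B.
Proof.
move=> A0 B0 h; rewrite -lerBlDr; apply: lb_le_inf => // a Aa.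
rewrite lerBlDr addrC -lerBlDr; apply: lb_le_inf => // b Bb.
by rewrite lerBlDr addrC; exact: h.
Qed.

(** The largest sublinear functional below [p] whose value at [- y] is at most
    [- p y]; if [p] is minimal it must agree with [p], which forces additivity. *)
Definition slope p y x := inf [set p (x + t *: y) - t * p y | t in [set t : R | 0 <= t]].

Lemma slope_lb p y x : sublinear p ->
  lbound [set p (x + t *: y) - t * p y | t in [set t : R | 0 <= t]] (- p (- x)).
Proof.
move=> sp _ [t /= t0 <-]; have := sp.1 (x + t *: y) (- x).
by rewrite addrAC subrr add0r (sublinearZ _ sp)//; lra.
Qed.

Lemma slope_le p y x t : sublinear p -> 0 <= t ->
  slope p y x <= p (x + t *: y) - t * p y.
Proof.
move=> sp t0; apply: ge_inf; last by exists t.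
by exists (- p (- x)); exact: slope_lb.
Qed.

Lemma slope_ge p y x (z : R) :
  (forall t, 0 <= t -> z <= p (x + t *: y) - t * p y) -> z <= slope p y x.
Proof.
move=> h; apply: lb_le_inf; first by exists (p (x + 0 *: y) - 0 * p y), 0 => /=.
by move=> _ [t /= t0 <-]; exact: h.
Qed.

Lemma slope_le_self p y x : sublinear p -> slope p y x <= p x.
Proof.
by move=> sp; have := slope_le y x sp (lexx 0); rewrite scale0r addr0 mul0r subr0.
Qed.

Lemma slope_sublinear p y : sublinear p -> sublinear (slope p y).
Proof.
move=> sp; split=> [x z|s x s0].
  apply: le_infD.
  - by exists (p (x + 0 *: y) - 0 * p y), 0 => /=.
  - by exists (p (z + 0 *: y) - 0 * p y), 0 => /=.
  move=> _ _ [t /= t0 <-] [u /= u0 <-].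
  apply: (le_trans (slope_le _ _ sp (addr_ge0 t0 u0))).
  have -> : x + z + (t + u) *: y = (x + t *: y) + (z + u *: y).
    by rewrite scalerDl addrACA.
  have := sp.1 (x + t *: y) (z + u *: y); lra.
rewrite mulrC -ler_pdivrMr//; apply: slope_ge => t t0.
rewrite ler_pdivrMr// mulrC.
apply: (le_trans (slope_le _ _ sp (mulr_ge0 (ltW s0) t0))).
by rewrite -scalerA -scalerDr (sublinearZ _ sp (ltW s0)) mulrBr mulrA.
Qed.

(** A chain of sublinear functionals has a pointwise infimum, so there are
    minimal ones. *)
Lemma minimal_sublinear p : sublinear p -> exists f, [/\ sublinear f,
  (forall x, f x <= p x) & forall g, sublinear g ->
    (forall x, g x <= f x) -> g = f].
Proof.
move=> sp; pose T := {q : X -> R | sublinear q /\ forall x, q x <= p x}.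
pose Rl (s t : T) := `[< forall x, sval t x <= sval s x >].
have pT : sublinear p /\ forall x, p x <= p x by [].
have [| | |A tot|m mP] := @Zorn T Rl.
- by move=> t; apply/asboolP.
- move=> r s t /asboolP rs /asboolP st; apply/asboolP => x.
  exact: le_trans (st x) (rs x).
- move=> s t /asboolP st /asboolP ts.
  case: s t st ts => [s sP] [t tP] /= st ts.
  apply: eq_exist; apply/funext => x; apply/eqP.
  by rewrite eq_le st ts.
- have [[a0 Aa0]|A0] := pselect (A !=set0); last first.
    by exists (exist _ p pT) => s As; exfalso; apply: A0; exists s.
  pose E x := [set sval a x | a in A].
  have E0 x : E x !=set0 by exists (sval a0 x), a0.
  have lbE x : lbound (E x) (- p (- x)).
    move=> _ [a Aa <-]; case: a {Aa} => a [sa ap] /=.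
    by have := sublinearN x sa; have := ap (- x); lra.
  have leE a x : A a -> inf (E x) <= sval a x.
    by move=> Aa; apply: ge_inf; [exists (- p (- x))|exists a].
  have sq : sublinear (fun x => inf (E x)).
    split=> [x y|t x t0].
      apply: le_infD => // _ _ [a Aa <-] [b Ab <-].
      have [c [Ac ca cb]] : exists c, [/\ A c, forall x, sval c x <= sval a x &
          forall x, sval c x <= sval b x].
        have [/asboolP ab|/asboolP ba] := tot a b Aa Ab.
          by exists b.
        by exists a.
      apply: (le_trans (leE _ _ Ac)).
      by apply: (le_trans ((svalP c).1.1 x y)); rewrite lerD.
    rewrite mulrC -ler_pdivrMr//; apply: lb_le_inf => // _ [a Aa <-].
    rewrite ler_pdivrMr// mulrC.
    by apply: (le_trans (leE _ _ Aa)); exact: (svalP a).1.2.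
  have qp x : inf (E x) <= p x.
    by apply: (le_trans (leE _ x Aa0)); exact: (svalP a0).2.
  exists (exist _ (fun x => inf (E x)) (conj sq qp)) => s As.
  by apply/asboolP => x /=; exact: leE.
exists (sval m); split; [exact: (svalP m).1|exact: (svalP m).2|].
move=> g sg gm.
have gT : sublinear g /\ forall x, g x <= p x.
  by split=> // x; apply: (le_trans (gm x)); exact: (svalP m).2.
have := mP (exist _ g gT); rewrite /Rl => /(_ _)/(congr1 sval) /=; apply.
exact/asboolP.
Qed.

(** Minimality makes [f] equal to each of its [slope f y]; the bound of the
    slope at parameter 1 then reads [f x <= f (x + y) - f y]. *)
Lemma minimal_sublinear_lin f : sublinear f ->
  (forall g, sublinear g -> (forall x, g x <= f x) -> g = f) -> lin f.
Proof.
move=> sf fmin.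
have fD x y : f (x + y) = f x + f y.
  apply/eqP; rewrite eq_le sf.1/=.
  have <- := fmin _ (slope_sublinear y sf) (fun x => slope_le_self y x sf).
  rewrite -lerBrDr.
  have e : f = slope f y.
    by rewrite (fmin _ (slope_sublinear y sf) (fun x => slope_le_self y x sf)).
  rewrite -e.
  by have := slope_le y x sf ler01; rewrite -e scale1r mul1r.
have fN x : f (- x) = - f x.
  by have := fD x (- x); rewrite subrr (sublinear0 sf); lra.
move=> k x y; rewrite fD; congr (_ + _).
have [k0|k0] := leP 0 k; first exact: sublinearZ.
have -> : k *: x = - ((- k) *: x) by rewrite scaleNr opprK.
by rewrite fN (sublinearZ _ sf) ?oppr_ge0 ?ltW// mulNr opprK.
Qed.

(** The functional is minimal below [slope p x0] rather than below [p]: this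
    bounds its value at [- x0], hence fixes its value at [x0]. *)
Lemma hahn_banach p x0 : sublinear p ->
  exists f, [/\ lin f, forall x, f x <= p x & f x0 = p x0].
Proof.
move=> sp; have [f [sf fp fmin]] := minimal_sublinear (slope_sublinear x0 sp).
have lf := minimal_sublinear_lin sf fmin.
have fle x : f x <= p x by exact: le_trans (fp x) (slope_le_self _ _ sp).
exists f; split=> //; apply/eqP; rewrite eq_le fle/=.
have := fp (- x0); rewrite (linN _ lf).
have := slope_le x0 (- x0) sp ler01.
rewrite scale1r addNr (sublinear0 sp) mul1r; lra.
Qed.

Definition cvx (K : set X) := forall x y t, K x -> K y -> 0 <= t -> t <= 1 ->
  K (t *: x + (1 - t) *: y).

(** The Minkowski gauge of an absorbing convex set is sublinear, which turns
    Hahn-Banach into the separation of a point from the set. *)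
Lemma support (K : set X) x : cvx K -> (forall z, exists2 t, 0 < t & K (t *: z)) ->
  (forall t, 1 < t -> ~ K (t *: x)) ->
  exists f, [/\ lin f, forall k, K k -> f k <= 1 & 1 <= f x].
Proof.
move=> cK absK xK.
pose E z := [set t : R | 0 < t /\ K (t^-1 *: z)].
have E0 z : E z !=set0.
  have [t t0 Kt] := absK z; exists t^-1; rewrite /E/= invrK.
  by rewrite invr_gt0.
have lbE z : lbound (E z) 0 by move=> t [t0 _]; exact: ltW.
have leE t z : 0 < t -> K (t^-1 *: z) -> inf (E z) <= t.
  by move=> t0 Kt; apply: ge_inf; [exists 0|].
have sg : sublinear (fun z => inf (E z)).
  split=> [z w|t z t0].
    apply: le_infD => // a b [a0 Ka] [b0 Kb].
    have ab0 : 0 < a + b by rewrite addr_gt0.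
    apply: leE => //.
    have -> : (a + b)^-1 *: (z + w) = (a / (a + b)) *: (a^-1 *: z) +
        (1 - a / (a + b)) *: (b^-1 *: w).
      rewrite scalerDr !scalerA; congr (_ *: _ + _ *: _); field; lra.
    apply: cK => //; first by rewrite divr_ge0// ltW.
    by rewrite ler_pdivrMr//; lra.
  rewrite mulrC -ler_pdivrMr//; apply: lb_le_inf => // a [a0 Ka].
  rewrite ler_pdivrMr//; apply: leE; first exact: mulr_gt0.
  by rewrite scalerA invfM -mulrA mulVf ?gt_eqF// mulr1.
have [f [lf fE fx]] := hahn_banach x sg.
exists f; split=> // [k Kk|].
  by apply: (le_trans (fE k)); apply: leE => //; rewrite invr1 scale1r.
rewrite fx; apply: lb_le_inf => // t [t0 Kt]; rewrite leNgt; apply/negP => t1.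
by apply: (xK t^-1) => //; rewrite invf_gt1.
Qed.

End LinearFunctionals.

Section ContinuousFunctionals.
Context {R : realType} {X : normedModType R}.
Implicit Types (f : X -> R) (C K : set X).

(** Continuity of a functional, in the form of a bound on the unit ball. *)
Definition clin f := lin f /\ exists2 M, 0 <= M & forall x, `|f x| <= M * `|x|.

Lemma clinB f g k : clin f -> clin g -> clin (fun x => f x - k * g x).
Proof.
move=> [lf [M M0 fM]] [lg [N N0 gN]]; split.
  by move=> c x y; rewrite lf lg; ring.
exists (M + `|k| * N); first by rewrite addr_ge0// mulr_ge0.
move=> x; rewrite (le_trans (ler_normB _ _))// mulrDl lerD// normrM -mulrA.
by rewrite ler_wpM2l.
Qed.

Lemma clinZ f k : clin f -> clin (fun x => k * f x).
Proof.
move=> [lf [M M0 fM]]; split; first by move=> c x y; rewrite lf; ring.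
exists (`|k| * M); first by rewrite mulr_ge0.
by move=> x; rewrite normrM -mulrA ler_wpM2l.
Qed.

Lemma clin_comb (I : finType) (k : I -> R) (F : I -> X -> R) :
  (forall i, clin (F i)) -> clin (fun x => \sum_i k i * F i x).
Proof.
move=> cF; split; first by apply: comb_lin => i; exact: (cF i).1.
have /choice[M MP] : forall i, exists M, 0 <= M /\ forall x, `|F i x| <= M * `|x|.
  by move=> i; have [_ [M M0 h]] := cF i; exists M.
exists (\sum_i `|k i| * M i).
  by apply: sumr_ge0 => i _; rewrite mulr_ge0// (MP i).1.
move=> x; rewrite (le_trans (ler_norm_sum _ _ _))// mulr_suml ler_sum// => i _.
by rewrite normrM -mulrA ler_wpM2l// (MP i).2.
Qed.

(** Boundedness on one side of a ball suffices, by symmetry of the ball. *)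
Lemma lin_ball_clin f r : lin f -> 0 < r -> (forall z, `|z| <= r -> f z <= 1) ->
  forall x, `|f x| <= r^-1 * `|x|.
Proof.
move=> lf r0 fr; suff h x : f x <= r^-1 * `|x|.
  move=> x; rewrite ler_norml h andbT lerNl -(linN _ lf).
  by rewrite (le_trans (h _))// normrN.
have [->|x0] := eqVneq x 0; first by rewrite (lin0 lf) normr0 mulr0.
have nx : 0 < `|x| by rewrite normr_gt0.
have := fr ((r / `|x|) *: x).
have -> : `|(r / `|x|) *: x| = r.
  by rewrite normrZ gtr0_norm ?divr_gt0// divfK// gt_eqF.
move=> /(_ (lexx _)).
rewrite (linZ _ _ lf) => h.
rewrite mulrC ler_pdivlMr//; have := ler_wpM2l (ltW nx) h.
by rewrite mulr1 mulrA mulrCA divff ?gt_eqF// mulr1 mulrC.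
Qed.

Lemma support_ball K r x : cvx K -> 0 < r -> (forall z, `|z| <= r -> K z) ->
  (forall t, 1 < t -> ~ K (t *: x)) ->
  exists f, [/\ lin f, forall z, `|f z| <= r^-1 * `|z|,
    forall k, K k -> f k <= 1 & 1 <= f x].
Proof.
move=> cK r0 rK xK; have [|f [lf fK fx]] := support cK _ xK.
  move=> z; exists (r / (`|z| + 1)); first by rewrite divr_gt0// ltr_wpDl.
  have n0 : 0 < `|z| + 1 by rewrite ltr_wpDl.
  apply: rK; rewrite normrZ gtr0_norm ?divr_gt0// -mulrA ler_piMr ?(ltW r0)//.
  by rewrite mulrC ler_pdivrMr// mul1r lerDl.
exists f; split=> //; apply: lin_ball_clin => // z zr; exact/fK/rK.
Qed.

Lemma closed_far C x : closed C -> ~ C x ->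
  exists2 e : R, 0 < e & forall c, C c -> e <= `|x - c|.
Proof.
move=> cC Cx; have : open (~` C) by rewrite openC.
rewrite openE => /(_ x Cx)/nbhs_ballP[e /= e0 eC]; exists e => // c Cc.
by rewrite leNgt; apply/negP => xc; apply: (eC c) => //; rewrite -ball_normE.
Qed.

(** Thickening [C - c0] by half the distance from [x] gives a set with interior
    points that still misses [x - c0]; the thickening is what makes the
    separation strict. *)
Lemma separation C x : C !=set0 -> closed C -> cvx C -> ~ C x ->
  exists f b, [/\ clin f, forall c, C c -> f c <= b & b < f x].
Proof.
move=> [c0 Cc0] clC cC Cx; have [e e0 eC] := closed_far clC Cx.
pose K := [set z | exists c u, [/\ C c, `|u| <= e / 2 & z = c - c0 + u]].
have e20 : 0 < e / 2 by rewrite divr_gt0.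
have [| |||f [lf fb fK fx]] := @support_ball K (e / 2) (x - c0).
- move=> _ _ t [c [u [Cc hu ->]]] [d [v [Cd hv ->]]] t0 t1.
  exists (t *: c + (1 - t) *: d), (t *: u + (1 - t) *: v); split.
  + exact: cC.
  + rewrite (le_trans (ler_normD _ _))// !normrZ !ger0_norm ?subr_ge0//.
    have := ler_wpM2l t0 hu; have t1' : 0 <= 1 - t by lra.
    have := ler_wpM2l t1' hv; lra.
  + by module.
- by [].
- by move=> z ze; exists c0, z; rewrite subrr add0r.
- move=> t t1 [c [u [Cc hu E]]].
  have t0 : 0 < t by lra.
  have tn : t != 0 by rewrite gt_eqF.
  have Cs : C (t^-1 *: c + (1 - t^-1) *: c0).
    by apply: cC => //; [rewrite invr_ge0 ltW|rewrite invf_le1// ltW].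
  have := eC _ Cs; have -> : x - (t^-1 *: c + (1 - t^-1) *: c0) = t^-1 *: u.
    have -> : u = t *: (x - c0) - (c - c0) by rewrite E; module.
    by module_field.
  rewrite normrZ ger0_norm ?invr_ge0 ?(ltW t0)// => h.
  have : t^-1 * `|u| <= `|u| by rewrite ler_piMl// invf_le1// ltW.
  lra.
have x0 : 0 < `|x - c0|.
  by rewrite normr_gt0; apply/eqP => h; move: fx; rewrite h (lin0 lf); lra.
pose d := e / 2 / `|x - c0|.
have d0 : 0 < d by rewrite divr_gt0.
exists f, (f c0 + 1 - d); split.
- by split=> //; exists (e / 2)^-1 => //; rewrite invr_ge0 ltW.
- move=> c Cc; have : f (c - c0 + d *: (x - c0)) <= 1.
    apply: fK; exists c, (d *: (x - c0)); split=> //.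
    by rewrite normrZ gtr0_norm// divfK// gt_eqF.
  rewrite (linD _ _ lf) (linZ _ _ lf) (linB _ _ lf).
  have := ler_wpM2l (ltW d0) fx; lra.
- by move: fx; rewrite (linB _ _ lf); lra.
Qed.

End ContinuousFunctionals.

(** * Polyhedral cones *)

Section ConformalDecomposition.
Context {R : realType} {X : lmodType R} (I : finType) (f : I -> X -> R).
Hypothesis lf : forall i, lin (f i).
Implicit Types x y z : X.

Let supp x : {set I} := [set i | f i x != 0]%SET.

(** On no coordinate does [y] have a sign opposite to that of [x], nor does it
    leave the support of [x]. *)
Definition conformal y x :=
  forall i, (f i x = 0 -> f i y = 0) /\ 0 <= f i y * f i x.

Lemma conformal_trans y x z : conformal y x -> conformal x z -> conformal y z.
Proof.
move=> yx xz i; have [yx0 yxp] := yx i; have [xz0 xzp] := xz i; split.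
  by move=> /xz0/yx0.
have [x0|x0] := eqVneq (f i x) 0; first by rewrite yx0// mul0r.
have h : 0 < f i x ^+ 2 by rewrite exprn_even_gt0.
rewrite -(pmulr_rge0 _ h).
have -> : f i x ^+ 2 * (f i y * f i z) = (f i y * f i x) * (f i x * f i z) by ring.
exact: mulr_ge0.
Qed.

Let J : finType := ({set I} * bool)%type.

Let minimal x := forall z, (supp z \proper supp x) -> supp z = finset.set0.

Definition conformal_sum (e : J -> X) (lam : J -> R) x :=
  [/\ forall j, 0 <= lam j,
      forall j, 0 < lam j -> conformal (e j) x /\ exists i, f i (e j) != 0 &
      forall i, f i x = \sum_j lam j * f i (e j)].

Lemma conformal_sumD e l1 l2 x1 x2 x a b : 0 <= a -> 0 <= b ->
  conformal x1 x -> conformal x2 x -> (forall i, f i x = a * f i x1 + b * f i x2) ->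
  conformal_sum e l1 x1 -> conformal_sum e l2 x2 ->
  conformal_sum e (fun j => a * l1 j + b * l2 j) x.
Proof.
move=> a0 b0 c1 c2 xE [p1 q1 s1] [p2 q2 s2]; split.
- by move=> j; rewrite addr_ge0// mulr_ge0.
- move=> j lj.
  have [l10|l10] := ltP 0 (l1 j).
    by have [h h'] := q1 _ l10; split=> //; exact: conformal_trans c1.
  have [l20|l20] := ltP 0 (l2 j).
    by have [h h'] := q2 _ l20; split=> //; exact: conformal_trans c2.
  have e1 : l1 j = 0 by apply/eqP; rewrite eq_le l10 p1.
  have e2 : l2 j = 0 by apply/eqP; rewrite eq_le l20 p2.
  by move: lj; rewrite e1 e2 !mulr0 addr0 ltxx.
- move=> i; rewrite xE s1 s2 !mulr_sumr -big_split/=.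
  by apply: eq_bigr => j _; ring.
Qed.

(** Moving from [x] against [y] until the first coordinate vanishes stays
    conformal to [x]. *)
Lemma conformal_shrink x y i0 : supp y \subset supp x -> 0 < f i0 y * f i0 x ->
  exists l, [/\ 0 < l, conformal (x - l *: y) x & supp (x - l *: y) \proper supp x].
Proof.
move=> yx i0P; pose P i := 0 < f i y * f i x.
have [i iP imin] : exists2 i, P i & forall j, P j -> f i x / f i y <= f j x / f j y.
  case: (@arg_minP _ _ _ i0 P (fun i => f i x / f i y) i0P) => i Pi h.
  by exists i.
have yi : f i y != 0 by apply/eqP => h; move: iP; rewrite /P h mul0r ltxx.
have xi : f i x != 0 by apply/eqP => h; move: iP; rewrite /P h mulr0 ltxx.
have divE k : f k y != 0 -> f k x / f k y = (f k y * f k x) / f k y ^+ 2.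
  by move=> h; field.
have l0 : 0 < f i x / f i y.
  by rewrite divE// divr_gt0// exprn_even_gt0.
have fE k : f k (x - (f i x / f i y) *: y) = f k x - (f i x / f i y) * f k y.
  by rewrite linB// linZ.
have yx0 k : f k x = 0 -> f k y = 0.
  move=> h; have /implyP := fintype.subsetP yx k; rewrite !inE h eqxx implybF negbK.
  by move/eqP.
exists (f i x / f i y); split=> //.
- move=> k; rewrite fE; split.
    by move=> h; rewrite h (yx0 _ h) mulr0 subrr.
  have [Pk|Pk] := boolP (P k).
    have yk : f k y != 0 by apply/eqP => h; move: Pk; rewrite /P h mul0r ltxx.
    have := imin _ Pk; move: l0; set l := f i x / f i y => l0 h.
    have {h} : (f k x / f k y - l) * (f k y * f k x) >= 0.
      by rewrite mulr_ge0 ?subr_ge0// ltW.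
    have -> : (f k x / f k y - l) * (f k y * f k x) = (f k x - l * f k y) * f k x.
      by field.
    by [].
  have : f k y * f k x <= 0 by rewrite leNgt.
  rewrite mulrBl -mulrA => /(mulr_ge0_le0 (ltW l0)).
  have := sqr_ge0 (f k x); rewrite expr2; lra.
- rewrite properE; apply/andP; split.
    apply/fintype.subsetP => k; rewrite !inE fE; apply: contraNN => /eqP h.
    by rewrite h (yx0 _ h) mulr0 subrr.
  apply/subsetPn; exists i; first by rewrite inE.
  by rewrite inE fE divfK// subrr eqxx.
Qed.

Lemma weight_split (a b l l' : R) : 0 < l + l' ->
  a = l' / (l + l') * (a - l * b) + l / (l + l') * (a - l' * - b).
Proof. by move=> h; field; rewrite gt_eqF. Qed.

(** Every vector is, modulo the common kernel of the [f i], a nonnegative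
    combination of vectors taken from a fixed finite list, none of which
    cancels against another one in any coordinate. The list consists of one
    vector of each minimal support, and its opposite. *)
Lemma conformal_decomposition : exists e : J -> X, forall x,
  exists lam, conformal_sum e lam x.
Proof.
have /choice[m mP] : forall S : {set I}, exists y,
    (exists z, supp z = S /\ minimal z) -> supp y = S /\ minimal y.
  move=> S; have [[z zP]|nz] := pselect (exists z, supp z = S /\ minimal z).
    by exists z.
  by exists 0.
pose e (j : J) : X := if j.2 then m j.1 else - m j.1.
exists e => x; have [k] := ubnP #|supp x|; elim: k x => // k IH x xk.
have [x0|x0] := eqVneq (supp x) finset.set0.
  exists (fun=> 0); split=> //; first by move=> j; rewrite ltxx.
  move=> i; rewrite big1 => [|j _]; last by rewrite mul0r.
  by have /setP/(_ i) := x0; rewrite !inE => /negbFE/eqP.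
have [i0 i0x] : exists i, f i x != 0.
  by have /set0Pn[i] := x0; rewrite inE; exists i.
have [xmin|xmin] := pselect (minimal x).
  have [ms mm] : supp (m (supp x)) = supp x /\ minimal (m (supp x)).
    by apply: mP; exists x.
  set y := m (supp x) in ms mm.
  have i0y : f i0 y != 0 by have /setP/(_ i0) := ms; rewrite !inE i0x.
  pose c := f i0 x / f i0 y.
  have c0 : c != 0 by rewrite mulf_neq0// invr_neq0.
  have fc i : f i x = c * f i y.
    have : supp (x - c *: y) = finset.set0.
      apply: xmin; rewrite properE; apply/andP; split.
        apply/fintype.subsetP => k'; rewrite !inE linB// linZ//; apply: contraNN => /eqP h.
        have /setP/(_ k') := ms; rewrite !inE h eqxx => /negbFE/eqP ->.
        by rewrite mulr0 subrr.
      apply/subsetPn; exists i0; first by rewrite inE.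
      by rewrite inE linB// linZ// /c divfK// subrr eqxx.
    move=> /setP/(_ i); rewrite !inE linB// linZ// => /negbFE; rewrite subr_eq0.
    by move/eqP.
  pose j0 : J := (supp x, 0 < c).
  have je : forall i, f i x = `|c| * f i (e j0).
    move=> i; rewrite fc /e/=; case: (ltP 0 c) => hc.
      by rewrite gtr0_norm.
    by rewrite ler0_norm// linN// mulrNN.
  exists (fun j => if j == j0 then `|c| else 0); split.
  - by move=> j; case: ifP.
  - move=> j; case: eqP => [->|]; last by rewrite ltxx.
    move=> nc; split.
      move=> i; rewrite je; split.
        by move=> /eqP; rewrite mulf_eq0 normr_eq0 (negbTE c0)/= => /eqP.
      by rewrite mulrCA mulr_ge0// -expr2 sqr_ge0.
    by exists i0; move: i0x; rewrite je; apply: contraNN => /eqP ->; rewrite mulr0.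
  - move=> i; rewrite (bigD1 j0)//= eqxx big1 ?addr0 ?je// => j /negbTE ->.
    by rewrite mul0r.
have [y [yx y0]] : exists y, supp y \proper supp x /\ supp y <> finset.set0.
  apply: contrapT => h; apply: xmin => z zx; apply: contrapT => z0.
  by apply: h; exists z.
have {y yx y0} [y [i [yx yi]]] : exists y i,
    supp y \proper supp x /\ 0 < f i y * f i x.
  move: y0 => /eqP/set0Pn[i]; rewrite inE => yi.
  have xi : f i x != 0.
    by have /properP[/fintype.subsetP/(_ i)] := yx; rewrite !inE => /(_ yi).
  have [h|h] := ltP 0 (f i y * f i x); first by exists y, i.
  exists (- y), i; split.
    have -> // : supp (- y) = supp y.
    by apply/setP => j; rewrite !inE linN// oppr_eq0.
  by rewrite linN// mulNr oppr_gt0 lt_neqAle h mulf_neq0.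
have [l [l0 cx px]] := conformal_shrink (proper_sub yx) yi.
have small z : supp z \proper supp x -> exists lam, conformal_sum e lam z.
  by move=> zx; apply: IH; exact: leq_trans (proper_card zx) xk.
have [l1 h1] := small _ px.
have [[i' yi']|npos] := pselect (exists i', f i' y * f i' x < 0).
  have yNx : supp (- y) \subset supp x.
    have -> : supp (- y) = supp y.
      by apply/setP => j; rewrite !inE linN// oppr_eq0.
    exact: proper_sub.
  have yNi : 0 < f i' (- y) * f i' x by rewrite linN// mulNr oppr_gt0.
  have [l' [l'0 cx' px']] := conformal_shrink yNx yNi.
  have [l2 h2] := small _ px'.
  have ll : 0 < l + l' by rewrite addr_gt0.
  exists (fun j => (l' / (l + l')) * l1 j + (l / (l + l')) * l2 j).
  apply: (conformal_sumD _ _ cx cx' _ h1 h2).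
  - by rewrite divr_ge0// ltW.
  - by rewrite divr_ge0// ltW.
  - by move=> k'; rewrite !(linB _ _ (lf k')) !(linZ _ _ (lf k')) (linN _ (lf k')); apply: weight_split.
have cy : conformal y x.
  move=> k'; split.
    move=> h; have /fintype.subsetP/(_ k') := proper_sub yx; rewrite !inE h eqxx.
    by case: eqVneq => // _ /(_ isT).
  by rewrite leNgt; apply/negP => h; apply: npos; exists k'.
have [l2 h2] := small _ yx.
exists (fun j => 1 * l1 j + l * l2 j).
apply: (conformal_sumD _ _ cx cy _ h1 h2) => //; first exact: ltW.
by move=> k'; rewrite (linB _ _ (lf k')) (linZ _ _ (lf k')); ring.
Qed.

(** No cancellation occurs in a conformal sum, so each term is bounded by the
    total. *)
Lemma conformal_bound e lam x i j : conformal_sum e lam x ->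
  lam j * `|f i (e j)| <= `|f i x|.
Proof.
move=> [l0 lc xE].
have [lj|lj] := ltP 0 (lam j); last first.
  have -> : lam j = 0 by apply/eqP; rewrite eq_le lj l0.
  by rewrite mul0r.
have [x0|x0] := eqVneq (f i x) 0.
  by have [/(_ i)[-> // _] _] := lc _ lj; rewrite x0 normr0 mulr0.
have pos k : 0 <= lam k * (f i (e k) * f i x).
  have [lk|lk] := ltP 0 (lam k); last first.
    have -> : lam k = 0 by apply/eqP; rewrite eq_le lk l0.
    by rewrite mul0r.
  by rewrite mulr_ge0//; have [/(_ i)[]] := lc _ lk.
have nx : 0 < `|f i x| by rewrite normr_gt0.
rewrite -(ler_pM2r nx) -mulrA -!normrM ger0_norm; last first.
  have [/(_ i)[_ h] _] := lc _ lj; exact: h.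
rewrite ger0_norm -?expr2 ?sqr_ge0//.
have -> : f i x ^+ 2 = \sum_k lam k * (f i (e k) * f i x).
  by rewrite expr2 {1}xE mulr_suml; apply: eq_bigr => k _; rewrite mulrA.
by rewrite (bigD1 j)//= lerDl sumr_ge0.
Qed.

End ConformalDecomposition.

Section Hoffman.
Context {R : realType} {X : normedModType R} (I : finType) (f : I -> X -> R).
Hypothesis cf : forall i, clin (f i).

(** Hoffman's error bound: in a conformal decomposition of [x], the terms that
    lie outside of the cone have coefficients controlled by the violation. *)
Lemma hoffman : exists2 K, 0 <= K & forall t x, 0 <= t ->
  (forall i, f i x <= t) -> exists v, (forall i, f i v <= 0) /\ `|x - v| <= K * t.
Proof.
have lf i : lin (f i) := (cf i).1.
have [e eP] := conformal_decomposition lf.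
have /choice[c cP] : forall j, exists c : R, 0 <= c /\ forall l t, 0 <= l ->
    (exists i, 0 < f i (e j) /\ l * f i (e j) <= t) -> l <= c * t.
  move=> j.
  exists (\sum_i `|(f i (e j))^-1|); split; first exact: sumr_ge0.
  move=> l t l0 [i [fi lt]].
  have t0 : 0 <= t by rewrite (le_trans _ lt)// mulr_ge0// ltW.
  have h : l <= `|(f i (e j))^-1| * t.
    by rewrite gtr0_norm ?invr_gt0// mulrC ler_pdivlMr.
  apply: (le_trans h); rewrite ler_wpM2r// (bigD1 i)//= lerDl.
  exact: sumr_ge0.
exists (\sum_j c j * `|e j|).
  by apply: sumr_ge0 => j _; rewrite mulr_ge0// (cP j).1.
move=> t x t0 xt; have [lam lamP] := eP x; have [l0 lc xE] := lamP.
pose bad j := `[< exists i, 0 < f i (e j) >].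
exists (x - \sum_(j | bad j) lam j *: e j); split.
  move=> i; rewrite linB//.
  have -> : f i (\sum_(j | bad j) lam j *: e j) = \sum_(j | bad j) lam j * f i (e j).
    rewrite big_mkcond/= lin_sum// [RHS]big_mkcond/=.
    by apply: eq_bigr => j _; case: ifP => _; rewrite ?linZ// lin0.
  rewrite xE (bigID bad)/= addrAC subrr add0r.
  apply: sumr_le0 => j /asboolP nb; rewrite mulr_ge0_le0// leNgt.
  by apply/negP => h; apply: nb; exists i.
rewrite opprB addrC subrK (le_trans (ler_norm_sum _ _ _))// mulr_suml.
rewrite big_mkcond/=; apply: ler_sum => j _; case: ifPn => [/asboolP[i fi]|_].
  rewrite normrZ ger0_norm// mulrAC ler_wpM2r//; apply: (cP j).2 => //; exists i.
  split=> //.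
  have [lj|lj] := ltP 0 (lam j); last first.
    have -> : lam j = 0 by apply/eqP; rewrite eq_le lj l0.
    by rewrite mul0r.
  have [/(_ i)[_ +] _] := lc _ lj; rewrite pmulr_rge0// => fx.
  have := conformal_bound i j lamP; rewrite gtr0_norm// ger0_norm//.
  by move=> /le_trans; apply.
by rewrite mulr_ge0// mulr_ge0// (cP j).1.
Qed.

End Hoffman.

Section DualSystems.
Context {R : realType} {X : lmodType R}.
Implicit Types (z : X).

Definition dual_system m (a : 'I_m -> X -> R) (x : 'I_m -> X) :=
  forall i j, a i (x j) = (i == j)%:R.

Variables (Phi : set (X -> R)) (G : set X).
Hypothesis Phi_lin : forall a, Phi a -> lin a.
Hypothesis Phi_comb : forall b m (c : 'I_m -> R) (a : 'I_m -> X -> R),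
  Phi b -> (forall i, Phi (a i)) -> Phi (fun w => b w - \sum_i c i * a i w).
Hypothesis Phi_scale : forall b k, Phi b -> Phi (fun w => k * b w).

Let system m (a : 'I_m -> X -> R) (x : 'I_m -> X) :=
  [/\ forall i, Phi (a i), forall i, G (x i) & dual_system a x].

(** One step of Gaussian elimination. *)
Lemma dual_system_extend m (a : 'I_m -> X -> R) (x : 'I_m -> X) b z :
  system a x -> Phi b -> G z -> b (z - \sum_i a i z *: x i) != 0 ->
  exists a' x', @system m.+1 a' x'.
Proof.
move=> [aPhi xG ax] bPhi zG bz; set r := z - _ in bz.
pose b' w := (b r)^-1 * (b w - \sum_j b (x j) * a j w).
have b'Phi : Phi b' by apply: Phi_scale; exact: Phi_comb.
have b'x j : b' (x j) = 0.
  rewrite /b' (bigD1 j)//= ax eqxx mulr1 big1 ?addr0 ?subrr ?mulr0// => i ij.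
  by rewrite ax (negbTE ij) mulr0.
have b'z : b' z = 1.
  have lb := Phi_lin bPhi.
  have -> : b' z = (b r)^-1 * b r.
    congr (_ * _); rewrite /r (linB _ _ lb) (lin_comb _ _ lb); congr (_ - _).
    by apply: eq_bigr => j _; rewrite mulrC.
  by rewrite mulVf.
pose a' (i : 'I_m.+1) : X -> R :=
  if unlift ord0 i is Some j then (fun w => a j w - \sum_(k < 1) a j z * b' w) else b'.
pose x' (i : 'I_m.+1) : X := if unlift ord0 i is Some j then x j else z.
exists a', x'; split.
- move=> i; rewrite /a'; case: unliftP => [j _|_] //.
  exact: (@Phi_comb (a j) 1 (fun=> a j z) (fun=> b')).
- by move=> i; rewrite /x'; case: unliftP.
- move=> i j; rewrite /a' /x'.
  case: (unliftP ord0 i) => [i' ->|->]; case: (unliftP ord0 j) => [j' ->|->].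
  + rewrite big_ord1 b'x mulr0 subr0 ax.
    have -> // : (lift ord0 i' == lift ord0 j') = (i' == j').
    by apply/eqP/eqP => [/lift_inj|->].
  + by rewrite big_ord1 b'z mulr1 subrr eq_sym (negbTE (neq_lift _ _)).
  + by rewrite b'x (negbTE (neq_lift _ _)).
  + by rewrite b'z eqxx.
Qed.

(** For a dual system of maximal size no functional of [Phi] can detect the
    part of a vector of [G] lying outside of the span of the system. *)
Lemma maximal_dual_system N :
  (forall m (a : 'I_m -> X -> R) x, system a x -> (m <= N)%N) ->
  exists m (a : 'I_m -> X -> R) (x : 'I_m -> X), system a x /\
    forall z b, G z -> Phi b -> b (z - \sum_i a i z *: x i) = 0.
Proof.
move=> bound; pose P m := `[< exists (a : 'I_m -> X -> R) x, system a x >].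
have exP : exists m, P m.
  exists 0%N; apply/asboolP; exists (fun i _ => 0), (fun=> 0).
  by split=> [[]|[]|[]].
have bP m : P m -> (m <= N)%N by move=> /asboolP[a [x]]; exact: bound.
have [m /asboolP[a [x ax]] mmax] := ex_maxnP exP bP.
exists m, a, x; split=> // z b Gz Pb; apply/eqP/negPn/negP => bz.
have [a' [x' sys']] := dual_system_extend ax Pb Gz bz.
by have := mmax m.+1; rewrite ltnn => /(_ _)/negP; apply => //; apply/asboolP; exists a', x'.
Qed.

End DualSystems.

Section Span.
Context {R : realType} {X : lmodType R}.

Lemma dual_system_rank m n (a : 'I_m -> X -> R) x (A : 'I_m -> 'I_n -> R)
  (B : 'I_n -> 'I_m -> R) : dual_system a x ->
  (forall i j, a i (x j) = \sum_k A i k * B k j) -> (m <= n)%N.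
Proof.
move=> ax aE; apply: (@mulmx1_min _ _ _ (\matrix_(i, k) A i k) (\matrix_(k, j) B k j)).
apply/matrixP => i j; rewrite !mxE -ax aE; apply: eq_bigr => k _.
by rewrite !mxE.
Qed.

Lemma span_dual_system n (f : 'I_n -> X -> R) : (forall i, lin (f i)) ->
  exists m (a : 'I_m -> X -> R) (x : 'I_m -> X),
    [/\ forall j, exists y : 'I_n -> R, forall w, a j w = \sum_i y i * f i w,
      dual_system a x & forall i z, f i (z - \sum_j a j z *: x j) = 0].
Proof.
move=> lf; pose Phi := [set a : X -> R | exists y, forall w, a w = \sum_i y i * f i w].
have [||||m [a [x [[aP _ ax] res]]]] := @maximal_dual_system R X Phi setT _ _ _ n.
- move=> a [y aE] k u v; rewrite !aE mulr_sumr -big_split; apply: eq_bigr => i _ /=.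
  by rewrite lf; ring.
- move=> b m c a [y bE] /choice[Y YE].
  exists (fun i => y i - \sum_j c j * Y j i) => w; rewrite bE.
  under [in RHS]eq_bigr do rewrite mulrBl mulr_suml.
  rewrite [RHS]sumrB exchange_big/=; congr (_ - _); apply: eq_bigr => j _.
  by rewrite YE mulr_sumr; apply: eq_bigr => i _; rewrite mulrA.
- move=> b k [y bE]; exists (fun i => k * y i) => w; rewrite bE mulr_sumr.
  by apply: eq_bigr => i _; rewrite mulrA.
- move=> m a x [/choice[A AE] _ ax].
  by apply: (dual_system_rank ax (B := fun k j => f k (x j))) => i j; exact: AE.
exists m, a, x; split=> // i z; apply: res => //.
exists (fun j => (i == j)%:R) => w; rewrite (bigD1 i)//= eqxx mul1r big1 ?addr0//.
by move=> j ji; rewrite eq_sym (negbTE ji) mul0r.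
Qed.

(** A functional that vanishes on the common kernel of finitely many others is
    a combination of them. *)
Lemma lin_span n (f : 'I_n -> X -> R) g : (forall i, lin (f i)) -> lin g ->
  (forall z, (forall i, f i z = 0) -> g z = 0) ->
  exists y : 'I_n -> R, forall z, g z = \sum_i y i * f i z.
Proof.
move=> lf lg gf; have [m [a [x [/choice[Y YE] ax res]]]] := span_dual_system lf.
exists (fun i => \sum_j g (x j) * Y j i) => z.
have := gf _ (fun i => res i z); rewrite (linB _ _ lg) (lin_comb _ _ lg) => /eqP.
rewrite subr_eq0 => /eqP ->; under [RHS]eq_bigr do rewrite mulr_suml.
rewrite exchange_big/=; apply: eq_bigr => j _; rewrite YE mulr_suml.
by apply: eq_bigr => i _; ring.
Qed.

End Span.

(** * Sequences *)

(** Dependent choice for pairwise requirements. The terms chosen so far are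
    passed as a function of which only the values at smaller indices matter. *)
Lemma greedy (T : Type) (x0 : T) (P : T -> Prop) (Q : T -> T -> Prop) :
  (forall n (u : nat -> T), (forall m, (m < n)%N -> P (u m)) ->
     exists x, P x /\ forall m, (m < n)%N -> Q (u m) x) ->
  exists u : nat -> T, (forall n, P (u n)) /\
    forall m n, (m < n)%N -> Q (u m) (u n).
Proof.
move=> h.
have /choice[F FP] : forall nu : nat * (nat -> T), exists x,
    (forall m, (m < nu.1)%N -> P (nu.2 m)) ->
    P x /\ forall m, (m < nu.1)%N -> Q (nu.2 m) x.
  move=> [n u] /=; have [/h[x xP]|nP] := pselect (forall m, (m < n)%N -> P (u m)).
    by exists x.
  by exists x0.
pose fix pre n : nat -> T := if n is n'.+1 then
  (fun m => if m == n' then F (n', pre n') else pre n' m) else (fun=> x0).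
pose u n := F (n, pre n).
have preE n m : (m < n)%N -> pre n m = u m.
  elim: n => // n IH; rewrite ltnS leq_eqVlt /= => /predU1P[->|mn].
    by rewrite eqxx.
  by rewrite ltn_eqF// IH.
have Pu n : P (u n).
  have [k] := ubnP n; elim: k n => // k IH n; rewrite ltnS => nk.
  apply: (FP (n, pre n) _).1 => m /= mn; rewrite preE//; apply: IH.
  exact: leq_trans nk.
exists u; split=> // m n mn.
have [|_ /(_ m mn)] := FP (n, pre n); last by rewrite /= preE.
by move=> k /= kn; rewrite preE.
Qed.

Section AlmostDecreasing.
Context {R : realType}.
Implicit Types (v : nat -> R) (d : R).

(** A term within [d] of the supremum of the tail at [N] dominates, up to [d],
    all later terms. *)
Lemma tail_max v d M : (forall k, v k <= M) -> 0 < d ->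
  forall N, exists k, (N <= k)%N /\ forall l, (k <= l)%N -> v l <= v k + d.
Proof.
move=> vM d0 N; pose E := [set v k | k in [set k | (N <= k)%N]].
have supE : has_sup E.
  by split; [exists (v N), N => /=|exists M => _ [k _ <-]].
have [_ [k /= Nk <-] h] := sup_adherent d0 supE.
exists k; split=> // l kl; have : v l <= sup E.
  by apply: ub_le_sup; [case: supE|exists l => //=; exact: leq_trans kl].
by lra.
Qed.

Lemma almost_decreasing v d M : (forall k, v k <= M) -> 0 < d ->
  exists g : nat -> nat, (forall m n, (m < n)%N -> (g m < g n)%N) /\
    forall m n, (m < n)%N -> v (g n) <= v (g m) + d.
Proof.
move=> vM d0.
have [|g [gP gQ]] := @greedy nat 0%N (fun k => forall l, (k <= l)%N -> v l <= v k + d)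
    (fun m n => (m < n)%N).
  move=> n u _.
  have [k [nk kP]] := tail_max vM d0 (\max_(i < n) u i).+1.
  exists k; split=> // m mn; apply: leq_trans nk; rewrite ltnS.
  exact: (leq_bigmax (Ordinal mn)).
by exists g; split=> // m n mn; apply: gP; exact/ltnW/gQ.
Qed.

(** Dickson's lemma for real coordinates bounded above and an error [d]: extract
    an almost decreasing subsequence for one coordinate after the other. *)
Lemma dickson n (phi : nat -> 'I_n -> R) d : (forall i, exists M, forall k, phi k i <= M) ->
  0 < d -> exists m k, (m < k)%N /\ forall i, phi k i <= phi m i + d.
Proof.
move=> phiM d0.
have h (s : seq 'I_n) : exists g : nat -> nat,
    (forall m n, (m < n)%N -> (g m < g n)%N) /\
    forall m k i, i \in s -> (m < k)%N -> phi (g k) i <= phi (g m) i + d.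
  elim: s => [|i s [g [ginc gs]]]; first by exists id.
  have [M iM] := phiM i.
  have [g' [g'inc g'P]] := @almost_decreasing (fun k => phi (g k) i) d M
    (fun k => iM (g k)) d0.
  exists (g \o g'); split; first by move=> a b ab; exact/ginc/g'inc.
  move=> a b j; rewrite inE => /predU1P[->|js] ab; first exact: g'P.
  by apply: gs => //; exact: g'inc.
have [g [ginc gP]] := h (enum 'I_n).
by exists (g 0%N), (g 1%N); split=> [|i]; [exact: ginc|apply: gP; rewrite ?mem_enum].
Qed.

(** Otherwise one could keep choosing elements dominated by none of the previous
    ones, against [dickson]. *)
Lemma finite_cofinal T (A : set T) n (phi : T -> 'I_n -> R) d :
  (forall i, exists M, forall a, A a -> phi a i <= M) -> 0 < d ->
  exists N (u : 'I_N -> T), (forall k, A (u k)) /\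
    forall a, A a -> exists k, forall i, phi a i <= phi (u k) i + d.
Proof.
move=> phiM d0; have [[a0 Aa0]|A0] := pselect (A !=set0); last first.
  have u0 : 'I_0 -> T by case.
  by exists 0%N, u0; split=> [[]|a Aa] //; case: A0; exists a.
apply: contrapT => nfin.
have [|u [uA uP]] := @greedy T a0 A (fun x y => ~ forall i, phi y i <= phi x i + d).
  move=> N u uA; apply: contrapT => h; apply: nfin.
  exists N, (fun k : 'I_N => u k); split; first by move=> k; exact: uA.
  move=> a Aa; apply: contrapT => h'; apply: h; exists a; split=> // m mN mP.
  by apply: h'; exists (Ordinal mN).
have [|m [k [mk mP]]] := @dickson n (fun k => phi (u k)) d _ d0.
  by move=> i; have [M h] := phiM i; exists M => k; exact: h.
exact: uP mk mP.
Qed.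

End AlmostDecreasing.

(** * Distances *)

Section Distances.
Context {R : realType} {X : normedModType R}.
Implicit Types (A B C : set X).

Definition nearby (r : R) A B := forall a, A a -> exists2 b, B b & `|a - b| <= r.

Lemma hausdorff_le A B (r : R) : nearby r A B -> nearby r B A ->
  (hausdorff_dist A B <= r%:E)%E.
Proof.
move=> AB BA; rewrite /hausdorff_dist ge_max; apply/andP; split.
  apply: ge_ereal_sup => _ [a Aa <-]; have [b Bb ab] := AB a Aa.
  by apply: (le_trans (set_dist_le a Bb)); rewrite lee_fin.
apply: ge_ereal_sup => _ [b Bb <-]; have [a Aa ab] := BA b Bb.
by apply: (le_trans (set_dist_le b Aa)); rewrite lee_fin.
Qed.

Lemma set_dist_lt a B (r : R) : (set_dist a B < r%:E)%E ->
  exists2 b, B b & `|a - b| < r.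
Proof. by move=> /ereal_inf_lt[_ [b Bb <-]]; rewrite lte_fin; exists b. Qed.

Lemma hausdorff_lt A B (r : R) : (hausdorff_dist A B < r%:E)%E -> nearby r A B.
Proof.
move=> h a Aa; have [|b Bb ab] := @set_dist_lt a B r; last by exists b => //; exact: ltW.
exact: le_lt_trans (set_dist_le_hausdorff B Aa) h.
Qed.

Lemma hausdorff_fin A B : (hausdorff_dist A B < +oo)%E ->
  exists K, [/\ 0 <= K, nearby K A B & nearby K B A].
Proof.
move=> h.
have [K [K0 hK]] : exists K : R, 0 <= K /\ (hausdorff_dist A B < K%:E)%E.
  move: h; case: (hausdorff_dist A B) => [r| |] // _.
    by exists (`|r| + 1); split; [rewrite addr_ge0|rewrite lte_fin ltr_pwDr// ler_norm].
  by exists 0; rewrite ltNyr.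
exists K; split=> //; first exact: hausdorff_lt.
by apply: hausdorff_lt; rewrite hausdorff_dist_sym.
Qed.

(** The two definitions differ only in the type of the coefficient. *)
Lemma convex_cvx A : convex_set (A : set (convex_lmodType X)) <-> cvx A.
Proof.
split=> [cA x y t Ax Ay t0 t1|cA].
  have := cA x y (Itv01 t0 t1); rewrite !inE => /(_ Ax Ay).
  by [].
move=> x y l; rewrite !inE => Ax Ay.
by have := cA x y l%:num Ax Ay; apply.
Qed.

End Distances.

(** * Recession cones and polyhedra *)

Section RecessionSystems.
Context {R : realType} {X : normedModType R}.
Implicit Types (A C P : set X) (f : X -> R).

Lemma char_cone_translate C c v : C c -> char_cone C v -> C (c + v).
Proof. by move=> Cc /(_ c 1 Cc ler01); rewrite scale1r. Qed.

(** Join an arbitrary point [a] of the set to points close to the ray and far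
    away: the segments converge to the ray issued from [a]. *)
Lemma bounded_ray_cone C c v (K : R) : closed C -> cvx C -> C c ->
  (forall s, 0 <= s -> exists2 z, C z & `|c + s *: v - z| <= K) -> char_cone C v.
Proof.
move=> clC cC Cc ray a t Ca t0; apply: contrapT => Cn.
have [e e0 eC] := closed_far clC Cn.
pose Q := `|a - c| + `|K| + 1.
have Q0 : 0 < Q by rewrite ltr_pwDr// addr_ge0.
pose s := t + t * Q / e + 1.
have s0 : 0 < s by rewrite ltr_pwDr// addr_ge0// divr_ge0 ?mulr_ge0 ?(ltW e0) ?(ltW Q0).
have tQ0 : 0 <= t * Q / e by rewrite divr_ge0 ?mulr_ge0 ?(ltW e0) ?(ltW Q0).
have [z Cz zK] := ray s (ltW s0).
have Cw : C ((t / s) *: z + (1 - t / s) *: a).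
  apply: cC => //; first by rewrite divr_ge0// ltW.
  by rewrite ler_pdivrMr// mul1r /s; lra.
have := eC _ Cw; have sn : s != 0 by rewrite gt_eqF.
have -> : a + t *: v - ((t / s) *: z + (1 - t / s) *: a) =
    (t / s) *: ((a - c) + (c + s *: v - z)) by module_field.
rewrite normrZ ger0_norm; last by rewrite divr_ge0// ltW.
have h1 : `|(a - c) + (c + s *: v - z)| <= Q.
  rewrite (le_trans (ler_normD _ _))// /Q; have := ler_norm K; lra.
move=> h2; have : e <= (t / s) * Q.
  by apply: (le_trans h2); rewrite ler_wpM2l// divr_ge0// ltW.
rewrite mulrAC ler_pdivlMr// /s mulrDr mulrDr mulrCA divff ?gt_eqF// !mulr1.
have := mulr_ge0 (ltW e0) t0; lra.
Qed.

Lemma char_cone_within A C (K : R) : closed C -> cvx C -> A !=set0 -> nearby K A C ->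
  nearby K C A -> char_cone A `<=` char_cone C.
Proof.
move=> clC cC [a Aa] AC CA v vA.
have [c Cc ac] := AC a Aa.
apply: (@bounded_ray_cone C c v (`|c - a| + K)) => // s s0.
have [z Cz zK] := AC _ (vA a s Aa s0).
exists z => //; have -> : c + s *: v - z = (c - a) + (a + s *: v - z) by module.
by rewrite (le_trans (ler_normD _ _))// lerD2l.
Qed.

(** Having such a family is what the existence of a polyhedral set in the
    component amounts to, and it is inherited by every set of the component. *)
Definition recession_system C n (f : 'I_n -> X -> R) :=
  [/\ forall i, clin (f i), forall i, exists M, forall c, C c -> f i c <= M &
      forall v, (forall i, f i v <= 0) -> char_cone C v].

Lemma bounded_above_cone C f : C !=set0 -> lin f -> (exists M, forall c, C c -> f c <= M) ->
  forall v, char_cone C v -> f v <= 0.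
Proof.
move=> [c Cc] lf [M fM] v vC; rewrite leNgt; apply/negP => fv.
have t0 : 0 <= (`|M - f c| + 1) / f v by rewrite divr_ge0 ?addr_ge0// ltW.
have := fM _ (vC c _ Cc t0); rewrite (linD _ _ lf) (linZ _ _ lf) divfK ?gt_eqF//.
have := ler_norm (M - f c); lra.
Qed.

Lemma recession_system_within A C n (f : 'I_n -> X -> R) K : closed A -> cvx A ->
  C !=set0 -> nearby K A C -> nearby K C A -> recession_system C f ->
  recession_system A f.
Proof.
move=> clA cA C0 AC CA [cf fM fC]; split=> //.
  move=> i; have [M iM] := fM i; have [lf [L L0 fL]] := cf i.
  exists (M + L * `|K|) => a Aa; have [c Cc ac] := AC a Aa.
  have -> : a = c + (a - c) by module.
  rewrite (linD _ _ lf) lerD ?iM// (le_trans (ler_norm _))// (le_trans (fL _))//.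
  by rewrite ler_wpM2l// (le_trans ac)// ler_norm.
by move=> v /fC; apply: (char_cone_within clA cA C0 CA AC).
Qed.

Lemma continuous_clin (f : {linear X -> R^o}) : continuous f <-> clin f.
Proof.
have lf : lin (f : X -> R) by move=> k x y; rewrite linearP.
split=> [/(_ 0)|[_ [M M0 fM]]].
  move=> /cvgrPdist_lt/(_ 1 ltr01)/nbhs_ballP[e /= e0 fe].
  have e20 : 0 < e / 2 by rewrite divr_gt0.
  split=> //; exists (e / 2)^-1; first by rewrite invr_ge0 ltW.
  apply: lin_ball_clin => // z ze.
  have : ball 0 e z by rewrite -ball_normE /= sub0r normrN; lra.
  move=> /fe; rewrite linear0 sub0r normrN => h.
  by rewrite (le_trans (ler_norm _))// ltW.
apply: bounded_linear_continuous; exists M; split; first exact: num_real.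
move=> N MN; near=> z; apply: le_trans (fM z) _.
have z1 : `|z| <= 1 by near: z; apply: nbhs0_le.
by have := ler_wpM2l M0 z1; lra.
Unshelve. all: by end_near. Qed.

Lemma polyhedral_family P : polyhedral P -> exists n (f : 'I_n -> X -> R) (b : 'I_n -> R),
  (forall i, clin (f i)) /\ P = [set x | forall i, f i x <= b i].
Proof.
move=> [F [finF Fh ->]].
have [s sE] := (finite_seqP _).1 finF.
have /choice[g gP] : forall i : 'I_(size s), exists fb : (X -> R) * R, clin fb.1 /\
    forall x, nth set0 s i x <-> fb.1 x <= fb.2.
  move=> i; have : F (nth set0 s i) by rewrite sE /= mem_nth.
  move=> /Fh[f [a [cf _ ->]]]; exists ((fun x => 0 - 1 * f x), - a); split.
    apply: clinB; last by apply/continuous_clin.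
    by split=> [k x y|]; [rewrite mulr0 addr0|exists 0 => // x; rewrite normr0 mul0r].
  by move=> x /=; rewrite in_itv/= andbT; split; lra.
exists (size s), (fun i => (g i).1), (fun i => (g i).2); split.
  by move=> i; exact: (gP i).1.
apply/seteqP; split=> x xP.
  by move=> i; apply/(gP i).2; apply: xP; rewrite sE /= mem_nth.
move=> H; rewrite sE /= => Hs; have := xP (Ordinal (etrans (index_mem H s) Hs)).
by move=> /(gP _).2; rewrite /= nth_index.
Qed.

(** Half-spaces require nonzero functionals. The inequalities with a zero
    functional can be dropped since they hold at some point. *)
Lemma family_polyhedral (I : finType) (f : I -> X -> R) (b : I -> R) :
  (forall i, clin (f i)) -> [set x | forall i, f i x <= b i] !=set0 ->
  polyhedral [set x | forall i, f i x <= b i].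
Proof.
move=> cf [x0 x0P].
pose nz i := exists x, f i x != 0.
exists [set H | exists2 i, nz i & H = [set x | f i x <= b i]]; split.
- apply: (@sub_finite_set _ _ [set [set x | f i x <= b i] | i in [set: I]]).
    by move=> _ [i _ ->]; exists i.
  by apply: finite_image; exact: finite_finset.
- move=> _ [i [x fx] ->].
  pose h x : R^o := - f i x.
  have lf : linear h by move=> k y z; rewrite /h (cf i).1 opprD -mulrN.
  pose g : {linear X -> R^o} := HB.pack h (GRing.isLinear.Build _ _ _ _ h lf).
  exists g, (- b i); split.
  + apply/continuous_clin; have [l [M M0 hM]] := cf i; split.
      by move=> k y z; exact: lf.
    by exists M => // y; rewrite /g /= normrN.
  + by exists x; rewrite /g /= oppr_eq0.
  + by apply/seteqP; split=> y /=; rewrite in_itv/= andbT lerN2.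
- apply/seteqP; split=> x xP.
    by move=> _ [i _ ->]; exact: xP.
  move=> i; have [nzi|zi] := pselect (nz i); first by apply: (xP [set y | f i y <= b i]); exists i.
  have z y : f i y = 0 by apply/eqP; apply/negPn/negP => fy; apply: zi; exists y.
  by have := x0P i; rewrite !z.
Qed.

Lemma closed_sublevel C f b : clin f -> closed [set x | f x <= b].
Proof.
move=> [lf [M M0 fM]]; rewrite -openC openE => x /= fx; apply/nbhs_ballP.
have M1 : 0 < M + 1 by rewrite ltr_wpDl.
have e0 : 0 < (f x - b) / (M + 1).
  by rewrite divr_gt0// subr_gt0 ltNge; apply/negP.
exists ((f x - b) / (M + 1)) => // y; rewrite -ball_normE /= => xy fy.
have : f x - f y <= M * `|x - y|.
  by rewrite -(linB _ _ lf) (le_trans (ler_norm _)).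
have : M * `|x - y| <= (M + 1) * `|x - y| by rewrite ler_wpM2r// lerDl.
move: xy; rewrite ltr_pdivlMr// [_ * (M + 1)]mulrC; lra.
Qed.

Lemma polyhedral_conv P : P !=set0 -> polyhedral P -> conv_H P.
Proof.
move=> P0 /polyhedral_family[n [f [b [cf E]]]]; split=> //.
  rewrite E (_ : [set _ | _] = \bigcap_(i in [set: 'I_n]) [set x | f i x <= b i]).
    by apply: closed_bigI => i _; exact: closed_sublevel.
  by apply/seteqP; split=> x xP i; [move=> _; exact: xP|exact: (xP i I)].
apply/convex_cvx; rewrite E => x y t xP yP t0 t1 i.
rewrite (linD _ _ (cf i).1) !(linZ _ _ (cf i).1).
have t1' : 0 <= 1 - t by lra.
have := ler_wpM2l t0 (xP i); have := ler_wpM2l t1' (yP i); lra.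
Qed.

Lemma polyhedral_recession_system P : P !=set0 -> polyhedral P ->
  exists n (f : 'I_n -> X -> R), recession_system P f.
Proof.
move=> P0 /polyhedral_family[n [f [b [cf ->]]]]; exists n, f; split=> //.
  by move=> i; exists (b i) => c; exact.
move=> v fv c t cP t0 i; rewrite (linD _ _ (cf i).1) (linZ _ _ (cf i).1).
have := cP i; have := mulr_ge0_le0 t0 (fv i); lra.
Qed.

Lemma recession_system_char_cone C n (f : 'I_n -> X -> R) : C !=set0 ->
  recession_system C f -> char_cone C = [set v | forall i, f i v <= 0].
Proof.
move=> C0 [cf fM fC]; apply/seteqP; split=> // v vC i.
exact: bounded_above_cone C0 (cf i).1 (fM i) _ vC.
Qed.

(** Hoffman's bound puts [C] at finite distance from its recession cone. *)
Lemma recession_system_within_cone C n (f : 'I_n -> X -> R) : C !=set0 ->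
  recession_system C f ->
  polyhedral (char_cone C) /\ (hausdorff_dist C (char_cone C) < +oo)%E.
Proof.
move=> C0 rC; have VE := recession_system_char_cone C0 rC.
have [cf fM fC] := rC; split.
  rewrite VE; apply: (family_polyhedral (b := fun=> 0) cf).
  by exists 0 => i; rewrite (lin0 (cf i).1).
have [K K0 KP] := hoffman cf.
have /choice[M MP] := fM.
have [c Cc] := C0.
pose t := \sum_i `|M i|.
have t0 : 0 <= t by exact: sumr_ge0.
have tM i : M i <= t.
  rewrite (le_trans (ler_norm _))// /t (bigD1 i)//= lerDl; exact: sumr_ge0.
apply: (@le_lt_trans _ _ (K * t + `|c|)%:E); last by rewrite ltry.
apply: hausdorff_le.
  move=> x Cx; have [|v [vf xv]] := KP t x t0.
    by move=> i; exact: le_trans (MP i _ Cx) (tM i).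
  exists v; first by rewrite VE.
  by rewrite (le_trans xv)// lerDl.
move=> v vC; exists (c + v); first exact: char_cone_translate.
have -> : v - (c + v) = - c by module.
by rewrite normrN lerDr mulr_ge0.
Qed.

End RecessionSystems.

(** * Consequences of a recession system *)

Section SystemConsequences.
Context {R : realType} {X : normedModType R}.
Implicit Types (A C P S : set X).

Lemma infinite_sequence (T : Type) (S : set T) : infinite_set S ->
  exists u : nat -> T, (forall n, S (u n)) /\ forall m n, (m < n)%N -> u m <> u n.
Proof.
move=> Sinf; have [s0 _] := infinite_setN0 Sinf.
apply: (@greedy T s0 S (fun x y => x <> y)) => n u uS.
apply: contrapT => h; apply: Sinf.
apply: (@sub_finite_set _ _ [set u m | m in `I_n]); last exact/finite_image/finite_II.
move=> x Sx; apply: contrapT => xu; apply: h; exists x; split=> // m mn E.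
by apply: xu; exists m.
Qed.

Lemma ereal_inf_pos (E : set (\bar R)) : (0 < ereal_inf E)%E ->
  exists2 e : R, 0 < e & forall x, E x -> (e%:E <= x)%E.
Proof.
move=> h; have [e e0 he] : exists2 e : R, 0 < e & (e%:E <= ereal_inf E)%E.
  move: h; case: (ereal_inf E) => [r| |]//; last by exists 1; rewrite ?leey.
  by rewrite lte_fin => r0; exists r.
by exists e => // x Ex; apply: (le_trans he); exact: ereal_inf_lbound.
Qed.

(** By Dickson's lemma, two of the hidden points, [x] and [y], are such that
    [y - x] is close to the recession cone. A point of [A] on the segment from
    [x] to [y], moved by a multiple of a vector of the cone, then comes close to
    [y]. For Dickson's lemma the functionals must be bounded above on the hidden
    points: each functional exceeds its bound on [A] at one of them at most. *)
Lemma recession_system_not_hiding A n (f : 'I_n -> X -> R) :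
  recession_system A f -> ~ positively_hiding A.
Proof.
move=> [cf fM fA] [S [Sinf SA Shid Spos]].
have [e e0 eS] := ereal_inf_pos Spos.
have [K K0 KP] := hoffman cf.
have [u [uS uinj]] := infinite_sequence Sinf.
have uinj' m k : m <> k -> u m <> u k.
  move=> mk; have [h|h|//] := ltngtP m k; first exact: uinj.
  by move=> E; exact: (uinj _ _ h).
have /choice[M MP] := fM.
have /choice[N NP] : forall i, exists N, forall k, (N <= k)%N -> f i (u k) <= M i.
  move=> i; have [[k0 k0P]|nk] := pselect (exists k, M i < f i (u k)).
    exists k0.+1 => k kk; rewrite leNgt; apply/negP => kP.
    have ne : u k0 <> u k by apply: uinj' => E; rewrite E ltnn in kk.
    have [c [[t /=]]] := Shid _ _ (uS k0) (uS k) ne.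
    rewrite in_itv/= => /andP[t0 t1] <- /(MP i).
    rewrite (linD _ _ (cf i).1) !(linZ _ _ (cf i).1).
    have t1' : 0 <= 1 - t by lra.
    have := ler_wpM2l t0 (ltW k0P); have := ler_wpM2l t1' (ltW kP).
    have [->|tn0] := eqVneq t 0; first lra.
    have tp : 0 < t by rewrite lt_neqAle eq_sym tn0.
    by have := ltr_pM2l tp (M i) (f i (u k0)); rewrite k0P; lra.
  by exists 0%N => k _; rewrite leNgt; apply/negP => h; apply: nk; exists k.
pose N0 := \max_i N i.
pose d := e / (2 * (K + 1)).
have K1 : 0 < K + 1 by rewrite ltr_wpDl.
have d0 : 0 < d by rewrite divr_gt0// mulr_gt0.
have Kd : K * d < e.
  rewrite /d mulrA ltr_pdivrMr ?mulr_gt0//; nra.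
have [|m [k [mk mkP]]] := @dickson R n (fun k i => f i (u (N0 + k)%N)) d _ d0.
  move=> i; exists (M i) => k; apply: NP; apply: leq_trans (leq_addr _ _).
  exact: leq_bigmax.
set x := u (N0 + m)%N; set y := u (N0 + k)%N.
have xy : x <> y by apply: uinj'; apply/eqP; rewrite eqn_add2l ltn_eqF.
have [|v [vf yxv]] := KP d (y - x) (ltW d0).
  by move=> i; rewrite (linB _ _ (cf i).1); have := mkP i; rewrite -/x -/y; lra.
have [c [[t /=]]] := Shid _ _ (uS (N0 + m)%N) (uS (N0 + k)%N) xy.
rewrite -/x -/y in_itv/= => /andP[t0 t1] cE Ac.
have Acv : A (c + t *: v) by exact: fA.
have := eS _ (ex_intro2 _ _ y (uS (N0 + k)%N) erefl).
have := set_dist_le y Acv; move=> /[swap] /le_trans/[apply]; rewrite lee_fin.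
have -> : y - (c + t *: v) = t *: (y - x - v) by rewrite -cE; module.
rewrite normrZ ger0_norm// => h.
have : t * `|y - x - v| <= K * d.
  by rewrite (le_trans _ yxv)// ler_piMl.
lra.
Qed.

(** The pairs of a functional and a number bounding it on [D + char_cone C],
    where [D] is the range of [u], form a polyhedral cone; its finitely many
    generators define [P]. A point outside of [C] is separated from [C] by such a
    pair, which is a combination of the generators, so that it is outside of
    [P]. *)
Lemma recession_system_hull C n (f : 'I_n -> X -> R) N (u : 'I_N -> X) :
  C !=set0 -> closed C -> cvx C -> recession_system C f -> (forall k, C (u k)) ->
  (0 < N)%N ->
  exists P, [/\ P !=set0, polyhedral P,
    forall k v, char_cone C v -> P (u k + v) & P `<=` C].
Proof.
move=> C0 clC cC rC uC N0; have [cf fM fC] := rC.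
have lf i := (cf i).1.
have VE := recession_system_char_cone C0 rC.
have [e eP] := conformal_decomposition lf.
set J : finType := ({set 'I_n} * bool)%type in e eP *.
pose Y : lmodType R := ('rV[R]_n * R^o)%type.
pose pair_f (p : Y) x := \sum_i p.1 ord0 i * f i x.
have pair_fD p q x k : pair_f (k *: p + q) x = k * pair_f p x + pair_f q x.
  rewrite /pair_f mulr_sumr -big_split/=; apply: eq_bigr => i _.
  by rewrite !mxE; ring.
pose inV j := `[< forall i, f i (e j) <= 0 >].
(* the coordinate functionals are included so that only 0 is in the common kernel *)
pose phi (i : 'I_N + J + option 'I_n) (p : Y) : R :=
  match i with
  | inl (inl k) => pair_f p (u k) - p.2
  | inl (inr j) => if inV j then pair_f p (e j) else 0
  | inr (Some i) => p.1 ord0 i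
  | inr None => p.2
  end.
have lphi i : lin (phi i).
  case: i => [[k|j]|[i|]] l p q /=.
  - by rewrite pair_fD [X in _ - X = _](_ : _ = l * p.2 + q.2)//; ring.
  - by case: ifP => _; rewrite ?pair_fD// mulr0 addr0.
  - by rewrite !mxE.
  - by [].
pose good (p : Y) := forall i, phi (inl i) p <= 0.
have [g gP] := conformal_decomposition lphi.
pose G l : X -> R := if `[< good (g l) >] then pair_f (g l) else (fun=> 0).
pose b l : R := if `[< good (g l) >] then (g l).2 else 0.
pose P := [set x | forall l, G l x <= b l].
have cG l : clin (G l).
  rewrite /G; case: ifP => _; first exact: clin_comb.
  by split=> [k x y|]; [rewrite mulr0 addr0|exists 0 => // x; rewrite normr0 mul0r].
have goodV p v : good p -> char_cone C v -> pair_f p v <= 0.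
  move=> pg; rewrite VE => vf; have [lam [l0 lc vE]] := eP v.
  have -> : pair_f p v = \sum_j lam j * pair_f p (e j).
    rewrite /pair_f; under eq_bigr do rewrite vE mulr_sumr.
    rewrite exchange_big/=; apply: eq_bigr => j _; rewrite mulr_sumr.
    by apply: eq_bigr => i _; ring.
  apply: sumr_le0 => j _; have [lj|lj] := ltP 0 (lam j); last first.
    have -> : lam j = 0 by apply/eqP; rewrite eq_le lj l0.
    by rewrite mul0r.
  rewrite mulr_ge0_le0//; have := pg (inr j); rewrite /= ifT//.
  apply/asboolP => i; have [/(_ i)[h0 h1] _] := lc _ lj.
  have := vf i; rewrite le_eqVlt => /predU1P[/h0->//|vi].
  by move: h1; rewrite nmulr_lge0.
have PV k v : char_cone C v -> P (u k + v).
  move=> vV l; rewrite /G /b; case: asboolP => // gl.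
  have := gl (inl k) => /=; have := goodV _ _ gl vV.
  suff -> : pair_f (g l) (u k + v) = pair_f (g l) (u k) + pair_f (g l) v by lra.
  rewrite /pair_f -big_split/=; apply: eq_bigr => i _.
  by rewrite (linD _ _ (lf i)) mulrDr.
have P0 : P !=set0.
  by exists (u (Ordinal N0) + 0); apply: PV => c t Cc _; rewrite scaler0 addr0.
exists P; split=> //; first exact: family_polyhedral.
move=> x Px; apply: contrapT => Cx.
have [h [beta [[lh _] hC hx]]] := separation C0 clC cC Cx.
have hV v : char_cone C v -> h v <= 0.
  by apply: bounded_above_cone => //; exists beta.
have [|y yE] := lin_span lf lh.
  move=> z fz; apply/eqP; rewrite eq_le; apply/andP; split.
    by apply: hV; rewrite VE => i; rewrite fz.
  rewrite -oppr_le0 -(linN _ lh); apply: hV; rewrite VE => i.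
  by rewrite (linN _ (lf i)) fz oppr0.
pose p : Y := (\row_i y i, beta).
have pE z : pair_f p z = h z by rewrite yE; apply: eq_bigr => i _; rewrite mxE.
have pg : good p.
  case=> [k|j] /=; first by rewrite pE subr_le0; exact: hC.
  by case: ifPn => // /asboolP jV; rewrite pE; apply: hV; rewrite VE.
have [lam [l0 lc pS]] := gP p.
have lgood l : 0 < lam l -> good (g l).
  move=> ll i; have [/(_ (inl i))[h0 h1] _] := lc _ ll.
  have := pg i; rewrite le_eqVlt => /predU1P[/h0->//|vi].
  by move: h1; rewrite nmulr_lge0.
have hxE : h x = \sum_l lam l * pair_f (g l) x.
  have p1 i : p.1 ord0 i = \sum_l lam l * (g l).1 ord0 i := pS (inr (Some i)).
  rewrite -pE /pair_f; under eq_bigr do rewrite p1 mulr_suml.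
  rewrite exchange_big/=; apply: eq_bigr => l _; rewrite mulr_sumr.
  by apply: eq_bigr => i _; rewrite mulrA.
have : h x <= beta.
  rewrite hxE (pS (inr None) : beta = _); apply: ler_sum => l _.
  have [ll|ll] := ltP 0 (lam l); last first.
    have -> : lam l = 0 by apply/eqP; rewrite eq_le ll l0.
    by rewrite !mul0r.
  rewrite ler_wpM2l//; have := Px l; rewrite /G /b ifT ?ifT//; exact/asboolP/lgood.
lra.
Qed.

(** The constant 2 leaves room for an error [d] on each of two sets that are
    compared through common approximate values. *)
Lemma cone_error n (f : 'I_n -> X -> R) (e : R) : (forall i, clin (f i)) -> 0 < e ->
  exists2 d, 0 < d & forall x y, (forall i, f i x <= f i y + 2 * d) ->
    exists2 v, (forall i, f i v <= 0) & `|x - (y + v)| <= e.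
Proof.
move=> cf e0; have [K K0 KP] := hoffman cf.
have K1 : 0 < K + 1 by rewrite ltr_wpDl.
pose d := e / (2 * (K + 1)).
have d0 : 0 < d by rewrite divr_gt0// mulr_gt0.
have Kd : K * (2 * d) <= e.
  have -> : K * (2 * d) = (K / (K + 1)) * e by rewrite /d; field; rewrite gt_eqF.
  by rewrite ler_piMl ?(ltW e0)// ler_pdivrMr// mul1r; lra.
exists d => // x y xy.
have d2 : 0 <= 2 * d by rewrite mulr_ge0// ltW.
have [|v [vf xyv]] := KP (2 * d) (x - y) d2.
  by move=> i; rewrite (linB _ _ (cf i).1); have := xy i; lra.
by exists v => //; rewrite opprD addrA (le_trans xyv).
Qed.

Lemma recession_system_approx C n (f : 'I_n -> X -> R) : C !=set0 -> closed C -> cvx C ->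
  recession_system C f -> approx_polyhedral C.
Proof.
move=> C0 clC cC rC e e0; have e20 : 0 < e / 2 by rewrite divr_gt0.
have [cf fM fC] := rC; have [d d0 dP] := cone_error cf e20.
have [N [u [uC uN]]] := finite_cofinal fM d0.
have N0 : (0 < N)%N.
  have [c /uN[k _]] := C0; exact: leq_ltn_trans (ltn_ord k).
have [P [P0 pP PV PC]] := recession_system_hull C0 clC cC rC uC N0.
exists P; split=> //; apply: (@le_lt_trans _ _ (e / 2)%:E); last first.
  by rewrite lte_fin; lra.
apply: hausdorff_le.
  move=> a Ca; have [k kP] := uN a Ca.
  have [|v vV av] := dP a (u k); last by exists (u k + v) => //; exact/PV/fC.
  by move=> i; have := kP i; lra.
by move=> x Px; exists x; [exact: PC|rewrite subrr normr0 ltW].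
Qed.

End SystemConsequences.

(** * Separability of the component of a polyhedral set *)

Section Separable.
Context {R : realType}.

(** A finite dense set is the whole space, and an infinite one has at least
    countably many elements: a countable dense set is of least cardinality. *)
Lemma countable_dense_separable (Y : topologicalType) (D : set Y) :
  hausdorff_space Y -> countable D -> dense D -> separable_space Y.
Proof.
move=> hY cD dD; exists D => //; split=> // E dE.
have [finE|infE] := pselect (finite_set E); last first.
  by apply: (card_le_trans cD); exact/infiniteP.
have clE : closed E := (@accessible_finite_set_closed Y).1 (hausdorff_accessible hY) E finE.
apply: subset_card_le => y _; apply: contrapT => Ey.
have [|z [Ez]] := dE (~` E) _ (closed_openC clE); first by exists y.
by [].
Qed.

Context {X : normedModType R} (C : set X).
Hypothesis convC : conv_H C.
Let Y := component_space C.

Lemma component_ball (A B : Y) e : 0 < e ->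
  (hausdorff_dist (val A) (val B) < e%:E)%E <-> ball A e B.
Proof.
move=> e0; rewrite ballEmdist /= /mdist /= /component_dist.
by rewrite -[X in (X < _)%E]fineK ?component_fin// lte_fin.
Qed.

Lemma rat_approx (x d : R) : 0 < d -> exists q : rat, `|x - ratr q| <= d.
Proof.
move=> d0; have [|q] := @rat_in_itvoo R (x - d) (x + d); first by lra.
by rewrite in_itv/= => /andP[h1 h2]; exists q; rewrite ler_norml; lra.
Qed.

(** A finite cofinal subset of a member [A] of the component determines [A] up to
    a small error, through the values of the functionals at its points; two
    members with the same approximate values are close to each other. *)
Lemma recession_system_separable n (f : 'I_n -> X -> R) :
  recession_system C f -> separable_space Y.
Proof.
move=> rC; have [cf _ fC] := rC; have [C0 clC /convex_cvx cC] := convC.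
have /choice[d dP] : forall m : nat, exists d : R, 0 < d /\
    forall x y, (forall i, f i x <= f i y + 2 * d) ->
    exists2 v, (forall i, f i v <= 0) & `|x - (y + v)| <= m.+1%:R^-1.
  move=> m; have m0 : (0 : R) < m.+1%:R^-1 by rewrite invr_gt0.
  by have [d d0 dP] := cone_error cf m0; exists d.
have rA (A : Y) : recession_system (val A) f.
  have /set_mem[[_ clA /convex_cvx cA] AC] := valP A.
  have [K [_ h1 h2]] := hausdorff_fin AC.
  exact: recession_system_within h1 h2 rC.
pose close (A : Y) (s : seq (seq rat) * nat) :=
  (forall q, q \in s.1 -> exists2 a, val A a & forall i : 'I_n, ratr (nth 0 q i) <= f i a + d s.2) /\
  (forall a, val A a -> exists2 q, q \in s.1 & forall i : 'I_n, f i a <= ratr (nth 0 q i) + d s.2).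
have close_nearby A B s : close A s -> close B s -> nearby s.2.+1%:R^-1 (val A) (val B).
  move=> [_ h1] [h2 _] a Aa; have [q qs aq] := h1 a Aa; have [b Bb qb] := h2 q qs.
  have [|v vf abv] := (dP s.2).2 a b.
    by move=> i; have := aq i; have := qb i; lra.
  by exists (b + v) => //; apply: char_cone_translate => //; have [_ _] := rA B; exact.
have close_ex A m : exists s, close A (s, m).
  have [_ fM _] := rA A; have d20 : 0 < d m / 2 by rewrite divr_gt0// (dP m).1.
  have [N [u [uA uN]]] := finite_cofinal fM d20.
  have /choice[q qP] : forall ki : 'I_N * 'I_n, exists q : rat,
      `|f ki.2 (u ki.1) - ratr q| <= d m / 2 by move=> ki; exact: rat_approx.
  have nthE k (i : 'I_n) : nth 0 [seq q (k, i) | i <- enum 'I_n] i = q (k, i).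
    by rewrite (nth_map i) ?size_enum_ord// nth_ord_enum.
  exists [seq [seq q (k, i) | i <- enum 'I_n] | k <- enum 'I_N]; split.
    move=> _ /mapP[k _ ->]; exists (u k) => // i; rewrite nthE.
    by have := qP (k, i); rewrite ler_norml /=; lra.
  move=> a Aa; have [k kP] := uN a Aa.
  exists [seq q (k, i) | i <- enum 'I_n]; first by apply: map_f; rewrite mem_enum.
  move=> i; rewrite nthE /=; have := kP i; have := qP (k, i).
  by rewrite ler_norml /=; lra.
have compC : C \in component C.
  by rewrite inE; split=> //; rewrite (hausdorff_dist_refl C0) ltry.
pose C' : Y := SigSub compC.
have /choice[F FP] : forall s, exists A, (exists B, close B s) -> close A s.
  move=> s; have [[B Bs]|nB] := pselect (exists B, close B s); first by exists B.
  by exists C'.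
apply: (@countable_dense_separable Y (range F)).
- exact: metric_hausdorff.
- exact: (sub_countable (card_image_le _ _) (countableP _)).
- move=> O [A OA] oO; have /nbhs_ballP[e /= e0 eO] : nbhs A O.
    by apply: open_nbhs_nbhs; split.
  have [m me] : exists m : nat, m.+1%:R^-1 < e.
    exists (Num.truncn e^-1); rewrite invf_plt ?posrE//.
    exact: truncnS_gt.
  have [s sA] := close_ex A m.
  exists (F (s, m)); split; last by exists (s, m).
  have sF : close (F (s, m)) (s, m) by apply: FP; exists A.
  apply: eO; apply/(component_ball _ _ e0).
  apply: (@le_lt_trans _ _ m.+1%:R^-1%:E); last by rewrite lte_fin.
  by apply: hausdorff_le; [exact: (close_nearby _ _ _ sA sF)|exact: (close_nearby _ _ _ sF sA)].
Qed.

(** A countable set is Lebesgue negligible. *)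
Lemma uncountable_real : ~ countable [set: R].
Proof.
move=> cR; have c01 : countable (`[0, 1]%classic : set R).
  exact: sub_countable (card_leT _) cR.
have := countable_lebesgue_measure0 c01; rewrite lebesgue_measure_itv/= lte01.
by rewrite oppr0 adde0 => /eqP; rewrite eqe oner_eq0.
Qed.

Lemma separable_density_lt (Z : topologicalType) :
  separable_space Z -> density_lt Z [set: R].
Proof.
move=> [D mD cD]; exists D => //; split.
  apply: (card_le_trans cD); apply/infiniteP => finR.
  exact/uncountable_real/finite_set_countable.
by move=> RD; exact/uncountable_real/(sub_countable RD).
Qed.

End Separable.

(** * Hidden sets and density *)

Section HiddenSubsets.
Context {R : realType} {X : normedModType R}.
Implicit Types (A C S : set X).

Lemma cvx3 A a b c p q r : cvx A -> A a -> A b -> A c -> 0 <= p -> 0 <= q -> 0 <= r ->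
  p + q + r = 1 -> A (p *: a + q *: b + r *: c).
Proof.
move=> cA Aa Ab Ac p0 q0 r0 s1; have [r1|r1] := eqVneq r 1.
  have -> : p = 0 by lra.
  have -> : q = 0 by lra.
  by rewrite r1 !scale0r !add0r scale1r.
have r1' : 1 - r != 0 by rewrite subr_eq0 eq_sym.
have r2 : 0 < 1 - r by rewrite lt_neqAle eq_sym r1' /=; lra.
have -> : p *: a + q *: b + r *: c =
    (1 - r) *: ((p / (1 - r)) *: a + (1 - p / (1 - r)) *: b) + (1 - (1 - r)) *: c.
  have -> : q = 1 - r - p by lra.
  by module_field.
apply: (cA _ _ (1 - r)) => //; try lra.
apply: cA => //; first by rewrite divr_ge0 ?(ltW r2).
by rewrite ler_pdivrMr// mul1r; lra.
Qed.

(** Moving two hidden points towards the set keeps them hidden: in the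
    tetrahedron they span with the points they are moved to, the set contains
    a triangle separating them. *)
Lemma hides_shrink A u w a b (al be : R) : cvx A -> A a -> A b -> ~ A u -> ~ A w ->
  0 < al -> al <= 1 -> 0 < be -> be <= 1 ->
  segment u w `&` A !=set0 ->
  segment (al *: u + (1 - al) *: a) (be *: w + (1 - be) *: b) `&` A !=set0.
Proof.
move=> cA Aa Ab Au Aw al0 al1 be0 be1 [? [[g /= +] <- Ac]].
rewrite in_itv/= => /andP[g0 g1].
have gn0 : 0 < g.
  rewrite lt_neqAle g0 andbT; apply/eqP => E; apply: Aw.
  by move: Ac; rewrite -E scale0r subr0 scale1r add0r.
have gn1 : g < 1.
  rewrite lt_neqAle g1 andbT; apply/eqP => E; apply: Au.
  by move: Ac; rewrite E subrr scale0r scale1r addr0.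
pose D := g * be + (1 - g) * al.
have h1 : 0 < g * be by rewrite mulr_gt0.
have h2 : 0 < (1 - g) * al by rewrite mulr_gt0// subr_gt0.
have D0 : 0 < D by rewrite addr_gt0.
have Dn : D != 0 by rewrite gt_eqF.
have Dn' : g * be + (1 - g) * al != 0 by [].
have q0 : 0 <= g * be * (1 - al) / D.
  by rewrite divr_ge0 ?(ltW D0)// mulr_ge0 ?(ltW h1)//; lra.
have r0 : 0 <= (1 - g) * al * (1 - be) / D.
  by rewrite divr_ge0 ?(ltW D0)// mulr_ge0 ?(ltW h2)//; lra.
have p0 : 0 <= al * be / D by rewrite divr_ge0 ?(ltW D0)// mulr_ge0 ?(ltW al0) ?(ltW be0).
exists ((al * be / D) *: (g *: u + (1 - g) *: w) + (g * be * (1 - al) / D) *: a +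
  ((1 - g) * al * (1 - be) / D) *: b); split; last first.
  by apply: cvx3 => //; rewrite /D; field.
exists (g * be / D) => /=.
  rewrite in_itv/= divr_ge0 ?(ltW h1) ?(ltW D0)//= ler_pdivrMr// mul1r /D; lra.
by rewrite /D; module_field.
Qed.

(** Each hidden point is moved towards a nearly closest point of [A] until its
    distance is comparable with the lower bound on the distances; this keeps the
    points hidden by [hides_shrink]. *)
Lemma positively_hiding_bounded A : cvx A -> positively_hiding A ->
  exists (s : nat -> X) (e : R), [/\ 0 < e,
    forall n a, A a -> e <= `|s n - a|,
    forall n, exists2 a, A a & `|s n - a| <= 4 * e &
    forall m n, m <> n -> segment (s m) (s n) `&` A !=set0].
Proof.
move=> cA [S [Sinf SA Shid Spos]].
have [e e0 eS] := ereal_inf_pos Spos.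
have [u [uS uinj]] := infinite_sequence Sinf.
have eu n a : A a -> e <= `|u n - a|.
  move=> Aa; have := eS _ (ex_intro2 _ _ (u n) (uS n) erefl).
  by move=> /le_trans/(_ (set_dist_le _ Aa)); rewrite lee_fin.
have A0 : A !=set0.
  have [a [_ Aa]] := Shid _ _ (uS 0%N) (uS 1%N) (uinj _ _ (ltn0Sn 0)); by exists a.
have /choice[aD aDP] : forall n, exists aD : X * R, [/\ A aD.1, e <= aD.2,
    forall a, A a -> aD.2 <= `|u n - a| & `|u n - aD.1| < aD.2 + e / 2].
  move=> n; pose E := [set `|u n - a| | a in A].
  have iE : has_inf E.
    split; first by have [a Aa] := A0; exists `|u n - a|, a.
    by exists 0 => _ [a _ <-].
  have e20 : 0 < e / 2 by rewrite divr_gt0.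
  have [_ [a Aa <-] h] := inf_adherent e20 iE.
  exists (a, inf E); split=> //=.
    by apply: lb_le_inf; [exact: iE.1|move=> _ [b Ab <-]; exact: eu].
  by move=> b Ab; apply: ge_inf; [exact: iE.2|exists b].
pose l n := e / (aD n).2.
have l0 n : 0 < l n by have [_ h _ _] := aDP n; rewrite divr_gt0// (lt_le_trans e0).
have l1 n : l n <= 1.
  by have [_ h _ _] := aDP n; rewrite ler_pdivrMr ?mul1r// (lt_le_trans e0).
have lD n : l n * (aD n).2 = e.
  by have [_ h _ _] := aDP n; rewrite divfK// gt_eqF// (lt_le_trans e0).
pose s n := l n *: u n + (1 - l n) *: (aD n).1.
exists s, (e / 2); split.
- by rewrite divr_gt0.
- move=> n a Aa; have [_ h1 h2 h3] := aDP n.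
  have := h2 a Aa => h4.
  have h5 : `|u n - a| <= `|s n - a| + (1 - l n) * `|u n - (aD n).1|.
    have -> : u n - a = (s n - a) + (1 - l n) *: (u n - (aD n).1).
      by rewrite /s; module.
    rewrite (le_trans (ler_normD _ _))// normrZ [X in _ + X * _]ger0_norm//.
    by rewrite subr_ge0.
  have h6 : (1 - l n) * `|u n - (aD n).1| <= (1 - l n) * ((aD n).2 + e / 2).
    by rewrite ler_wpM2l ?subr_ge0// ltW.
  have := lD n; have : 0 <= l n * e by rewrite mulr_ge0 ?(ltW (l0 n)) ?(ltW e0).
  lra.
- move=> n; have [h0 h1 _ h3] := aDP n; exists (aD n).1 => //.
  have -> : s n - (aD n).1 = l n *: (u n - (aD n).1) by rewrite /s; module.
  rewrite normrZ gtr0_norm//.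
  have := ler_wpM2l (ltW (l0 n)) (ltW h3); have := lD n.
  have : l n * e <= e by rewrite ler_piMl// ltW.
  lra.
- move=> m n mn; have [Am _ _ _] := aDP m; have [An _ _ _] := aDP n.
  apply: hides_shrink => //; try exact: SA.
  apply: Shid => //; case: (ltngtP m n) => // h; first exact: uinj.
  by move=> E; exact: (uinj _ _ h).
Qed.

Lemma closure_near A z : closure A z <-> forall d : R, 0 < d -> exists2 y, A y & `|z - y| < d.
Proof.
split=> [Az d d0|h B /nbhs_ballP[d /= d0 dB]].
  have [y [Ay yz]] := Az _ (nbhsx_ballx z d d0); exists y => //.
  by move: yz; rewrite -ball_normE.
by have [y Ay yz] := h d d0; exists y; split=> //; apply: dB; rewrite -ball_normE.
Qed.

Definition thickening (r : R) A : set X :=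
  [set x | forall e : R, 0 < e -> exists2 a, A a & `|x - a| < r + e].

Lemma thickening_sub r A : 0 <= r -> A `<=` thickening r A.
Proof.
by move=> r0 x Ax e e0; exists x => //; rewrite subrr normr0 ltr_wpDl.
Qed.

Lemma thickening_near r A x : (forall d : R, 0 < d -> exists2 y, thickening r A y & `|x - y| < d) ->
  thickening r A x.
Proof.
move=> xA e e0; have e20 : 0 < e / 2 by rewrite divr_gt0.
have [y yA xy] := xA _ e20; have [c Ac yc] := yA _ e20.
exists c => //; have -> : x - c = (x - y) + (y - c) by module.
by have := ler_normD (x - y) (y - c); lra.
Qed.

Lemma thickening_cvx r A : cvx A -> cvx (thickening r A).
Proof.
move=> cA x y t xA yA t0 t1 e e0; have t1' : 0 <= 1 - t by lra.
have [x' Ax xx] := xA e e0; have [y' Ay yy] := yA e e0.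
exists (t *: x' + (1 - t) *: y'); first exact: cA.
have -> : t *: x + (1 - t) *: y - (t *: x' + (1 - t) *: y') =
  t *: (x - x') + (1 - t) *: (y - y') by module.
rewrite (le_lt_trans (ler_normD _ _))// !normrZ !ger0_norm//.
have [t00|tn0] := eqVneq t 0; first by rewrite t00; lra.
have tp : 0 < t by rewrite lt_neqAle eq_sym tn0.
have h1 : t * `|x - x'| < t * (r + e) by rewrite ltr_pM2l.
have h2 := ler_wpM2l t1' (ltW yy); lra.
Qed.

Lemma closure_cvx A : cvx A -> cvx (closure A).
Proof.
move=> /(@thickening_cvx 0) cA; suff -> : closure A = thickening 0 A by [].
by apply/seteqP; split=> x /=; rewrite closure_near => xA e /xA; rewrite add0r.
Qed.

Section Family.
Variables (A : set X) (s : nat -> X) (e : R).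
Hypotheses (cA : cvx A) (e0 : 0 < e) (se : forall n a, A a -> e <= `|s n - a|)
  (sb : forall n, exists2 a, A a & `|s n - a| <= 4 * e)
  (sh : forall m n, m <> n -> segment (s m) (s n) `&` A !=set0).
Implicit Type T : set nat.

(** Because the points are hidden behind [A], the cones over [A] with apexes
    in [T] already form a convex set. *)
Definition cones T : set X := [set z | exists2 a, A a & exists n l,
  [/\ 0 <= l, l <= 1, l = 0 \/ T n & z = l *: s n + (1 - l) *: a]].

Let sA n : ~ A (s n).
Proof. by move=> /(se n); rewrite subrr normr0 leNgt e0. Qed.

Let hidden m n : m <> n -> exists g, [/\ 0 < g, g < 1 & A (g *: s m + (1 - g) *: s n)].
Proof.
move=> /sh[? [[g /= +] <- Ac]]; rewrite in_itv/= => /andP[g0 g1]; exists g; split=> //.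
  rewrite lt_neqAle g0 andbT; apply/eqP => E; apply: (sA (n := n)).
  by move: Ac; rewrite -E scale0r subr0 scale1r add0r.
rewrite lt_neqAle g1 andbT; apply/eqP => E; apply: (sA (n := m)).
by move: Ac; rewrite E subrr scale0r scale1r addr0.
Qed.

Lemma cones_sub T : A `<=` cones T.
Proof.
by move=> a Aa; exists a => //; exists 0%N, 0; split; [| |left|rewrite scale0r subr0 scale1r add0r].
Qed.

Let cone_pt T n a b c p q r t : p = 0 \/ T n -> A a -> A b -> A c ->
  0 <= p -> 0 <= q -> 0 <= r -> 0 <= t -> p + q + r + t = 1 ->
  cones T (p *: s n + q *: a + r *: b + t *: c).
Proof.
move=> Tn Aa Ab Ac p0 q0 r0 t0 sum1; have [p1|p1] := eqVneq p 1.
  have -> : q = 0 by lra.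
  have -> : r = 0 by lra.
  have -> : t = 0 by lra.
  exists a => //; exists n, 1; split=> //; first by case: Tn => [|?]; [lra|right].
  by rewrite p1; module.
have p1' : 1 - p != 0 by rewrite subr_eq0 eq_sym.
have p2 : 0 < 1 - p by rewrite lt_neqAle eq_sym p1' /=; lra.
exists ((q / (1 - p)) *: a + (r / (1 - p)) *: b + (t / (1 - p)) *: c).
  apply: cvx3; rewrite ?divr_ge0 ?(ltW p2)//.
  by rewrite -!mulrDl (_ : q + r + t = 1 - p) ?divff//; lra.
by exists n, p; split=> //; [lra|module_field].
Qed.

(** The part of a combination lying between two different apexes is absorbed by
    a point of [A] on the segment joining them. *)
Lemma cones_cvx T : cvx (cones T).
Proof.
move=> _ _ t [a Aa [m [k [k0 k1 Tm ->]]]] [b Ab [n [l [l0 l1 Tn ->]]]] t0 t1.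
have t1' : 0 <= 1 - t by lra.
have k1' : 0 <= 1 - k by lra.
have l1' : 0 <= 1 - l by lra.
case: Tm => [k00|Tm].
  have -> : t *: (k *: s m + (1 - k) *: a) + (1 - t) *: (l *: s n + (1 - l) *: b) =
    ((1 - t) * l) *: s n + t *: a + ((1 - t) * (1 - l)) *: b + 0 *: a.
    by rewrite k00; module.
  apply: cone_pt => //; try exact: mulr_ge0; last ring.
  by case: Tn => [->|?]; [left; rewrite mulr0|right].
case: Tn => [l00|Tn].
  have -> : t *: (k *: s m + (1 - k) *: a) + (1 - t) *: (l *: s n + (1 - l) *: b) =
    (t * k) *: s m + (t * (1 - k)) *: a + (1 - t) *: b + 0 *: a.
    by rewrite l00; module.
  by apply: cone_pt => //; [right|exact: mulr_ge0|exact: mulr_ge0|ring].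
have [mn|/eqP mn] := eqVneq m n.
  have -> : t *: (k *: s m + (1 - k) *: a) + (1 - t) *: (l *: s n + (1 - l) *: b) =
    (t * k + (1 - t) * l) *: s n + (t * (1 - k)) *: a + ((1 - t) * (1 - l)) *: b + 0 *: a.
    by rewrite mn; module.
  apply: cone_pt => //; [by right| |exact: mulr_ge0|exact: mulr_ge0|ring].
  by rewrite addr_ge0// mulr_ge0.
have [g [g0 g1 Ac]] := hidden mn; set c := _ + _ in Ac.
have g1' : 0 < 1 - g by lra.
pose p := t * k; pose q := (1 - t) * l.
have p0 : 0 <= p by exact: mulr_ge0.
have q0 : 0 <= q by exact: mulr_ge0.
have gn : g != 0 by rewrite gt_eqF.
have gn' : 1 - g != 0 by rewrite gt_eqF.
have [pq|pq] := leP (q * g) (p * (1 - g)).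
  have -> : t *: (k *: s m + (1 - k) *: a) + (1 - t) *: (l *: s n + (1 - l) *: b) =
    (p - g * q / (1 - g)) *: s m + (t * (1 - k)) *: a + ((1 - t) * (1 - l)) *: b +
    (q / (1 - g)) *: c by rewrite /c /p /q; module_field.
  apply: cone_pt => //; try exact: mulr_ge0; [by right| | |].
  - by rewrite subr_ge0 ler_pdivrMr// mulrC.
  - by rewrite divr_ge0// ltW.
  - by rewrite /p /q; field.
have -> : t *: (k *: s m + (1 - k) *: a) + (1 - t) *: (l *: s n + (1 - l) *: b) =
  (q - (1 - g) * p / g) *: s n + (t * (1 - k)) *: a + ((1 - t) * (1 - l)) *: b +
  (p / g) *: c by rewrite /c /p /q; module_field.
apply: cone_pt => //; try exact: mulr_ge0; [by right| | |].
- by rewrite subr_ge0 ler_pdivrMr// mulrC ltW.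
- by rewrite divr_ge0// ltW.
- by rewrite /p /q; field.
Qed.

Lemma cones_near T : nearby (4 * e) (cones T) A.
Proof.
move=> _ [a Aa [n [l [l0 l1 _ ->]]]]; have [b Ab snb] := sb n.
exists (l *: b + (1 - l) *: a); first exact: cA.
have -> : l *: s n + (1 - l) *: a - (l *: b + (1 - l) *: a) = l *: (s n - b) by module.
by rewrite normrZ ger0_norm// (le_trans _ snb)// ler_piMl.
Qed.

(** If a cone with apex [s m] came close to [s n], then so would [A], because [A]
    meets the segment between the two apexes: [s n] would be almost a convex
    combination of that point and of a point of [A]. *)
Lemma cones_far T n y : ~ T n -> cones T y -> e <= `|s n - y|.
Proof.
move=> Tn [a Aa [m [l [l0 l1 Tm ->]]]]; case: Tm => [->|Tm].
  by rewrite scale0r add0r subr0 scale1r se.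
have nm : n <> m by move=> E; apply: Tn; rewrite E.
have [g [g0 g1 Ac]] := hidden nm; set c := _ + _ in Ac.
have g1' : 0 < 1 - g by lra.
have gn' : 1 - g != 0 by rewrite gt_eqF.
pose D := 1 - l + l / (1 - g).
have lg : l <= l / (1 - g) by rewrite ler_pdivlMr//; nra.
have D1 : 1 <= D by rewrite /D; lra.
have D0 : 0 < D by lra.
have Dn : D != 0 by rewrite gt_eqF.
have Dn' : (1 - l) * (1 - g) + l != 0.
  by rewrite gt_eqF//; have := mulr_ge0 l0 (ltW g0); lra.
have Ab : A ((l / (1 - g) / D) *: c + (1 - l / (1 - g) / D) *: a).
  apply: cA => //; first by rewrite !divr_ge0// ltW.
  by rewrite ler_pdivrMr// mul1r /D; lra.
have := se n Ab.
have -> : s n - ((l / (1 - g) / D) *: c + (1 - l / (1 - g) / D) *: a) =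
  D^-1 *: (s n - (l *: s m + (1 - l) *: a)).
  by rewrite /c /D; module_field; rewrite ?gn' ?Dn'.
rewrite normrZ gtr0_norm ?invr_gt0// => h; apply: (le_trans h).
by rewrite ler_piMl// invf_le1.
Qed.

End Family.

(** The points are indexed by the rationals, and a real [x] is sent to the hull
    of those indexed by the rationals smaller than [x]. Two of these hulls are
    apart by [cones_far], so choosing a point of a dense set near each of them
    embeds the reals into the dense set. *)
Lemma density_not_hiding C A : component C A -> positively_hiding A ->
  ~ density_lt (component_space C) [set: R].
Proof.
move=> [[A0 clA /convex_cvx cA] AC] hA [D [dD _] [_ nD]].
have [s [e [e0 se sb sh]]] := positively_hiding_bounded cA hA.
pose T (x : R) : set nat := [set k | exists2 q : rat, ratr q < x & k = pickle q].
pose F x := closure (cones A s (T x)).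
have FC x : F x \in component C.
  rewrite inE; split.
    split; [|exact: closed_closure|].
      by have [a Aa] := A0; exists a; apply: subset_closure; exact: cones_sub.
    exact/convex_cvx/closure_cvx/(cones_cvx cA e0 se sh).
  apply: le_lt_trans (hausdorff_dist_triangle _ _ A0) _.
  rewrite lte_add_pinfty//; apply: (@le_lt_trans _ _ (4 * e + 1)%:E); last by rewrite ltry.
  apply: hausdorff_le.
    move=> z /closure_near/(_ 1 ltr01)[y /(cones_near cA sb)[a Aa ya] zy].
    exists a => //; have -> : z - a = (z - y) + (y - a) by module.
    by rewrite (le_trans (ler_normD _ _))// addrC lerD// ltW.
  move=> a Aa; exists a; first by apply: subset_closure; exact: cones_sub.
  by rewrite subrr normr0 addr_ge0// mulr_ge0 ?(ltW e0).
pose F' x : component_space C := SigSub (FC x).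
have far x y : x < y -> (e%:E <= hausdorff_dist (F y) (F x))%E.
  move=> xy; rewrite leNgt; apply/negP => h.
  have [q] := rat_in_itvoo xy; rewrite in_itv/= => /andP[xq qy].
  have Ty : T y (pickle q) by exists q.
  have Tx : ~ T x (pickle q).
    move=> [q' q'x /(pcan_inj pickleK) E]; move: q'x; rewrite -E; lra.
  have sF : F y (s (pickle q)).
    apply: subset_closure; have [a Aa] := A0; exists a => //.
    by exists (pickle q), 1; split=> //; [right|rewrite scale1r subrr scale0r addr0].
  have := le_lt_trans (set_dist_le_hausdorff (F x) sF) h.
  move=> /set_dist_lt[b Fb sb']; have d0 : 0 < e - `|s (pickle q) - b| by lra.
  have [z Tz bz] := (closure_near _ _).1 Fb _ d0.
  have := cones_far cA e0 se sh Tx Tz.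
  have -> : s (pickle q) - z = (s (pickle q) - b) + (b - z) by module.
  have := ler_normD (s (pickle q) - b) (b - z); lra.
have e20 : 0 < e / 2 by rewrite divr_gt0.
have /choice[d dP] : forall x, exists d, D d /\ ball (F' x) (e / 2) d.
  move=> x; have [||y [xy Dy]] := dD (interior (ball (F' x) (e / 2))).
  - by exists (F' x); exact: nbhsx_ballx.
  - exact: open_interior.
  by exists y; split=> //; exact: interior_subset xy.
apply: nD; have dinj : injective d.
  move=> x y dxy; apply: contrapT => /eqP; rewrite neq_lt.
  have bxy : ball (F' x) e (F' y).
    have [_ h1] := dP x; have [_ h2] := dP y; rewrite dxy in h1.
    by have := ball_triangle h1 (ball_sym h2); rewrite -splitr.
  have h := (component_ball (F' x) (F' y) e0).2 bxy.
  case/orP => /far; rewrite leNgt ?h//.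
  by rewrite hausdorff_dist_sym h.
rewrite -(card_le_eql (inj_card_eq (f := d) (in2W dinj))).
by apply: subset_card_le => _ [x _ <-]; have [] := dP x.
Qed.

End HiddenSubsets.

(** * Finitely generated cones of functionals *)

Section FiniteGeneration.
Context {R : realType}.

Lemma finite_family (T : eqType) (F : set T) : finite_set F ->
  exists n (f : 'I_n -> T), F = range f.
Proof.
move=> /finite_seqP[s ->]; exists (size s), (tnth (in_tuple s)).
apply/seteqP; split=> [x /= xs|_ [i _ <-] /=]; last exact: mem_tnth.
by have /tnthP[i ->] : x \in in_tuple s by []; exists i.
Qed.

Lemma rV_coord_le n (v : 'rV[R]_n) i : `|v ord0 i| <= `|v|.
Proof.
have /mapP[j Hj ->] : `|v ord0 i| \in [seq `|v x.1 x.2| | x : 'I_1 * 'I_n].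
  by apply/mapP; exists (ord0, i) => //=; rewrite mem_enum.
by rewrite [leRHS]/Num.Def.normr /= mx_normrE; apply/bigmax_geP; right => /=; exists j.
Qed.

Lemma rV_sphere_compact n : compact [set v : 'rV[R]_n | `|v| = 1].
Proof.
apply: bounded_closed_compact.
  by exists 1; split; [exact: num_real|move=> M M1 v /= ->; exact: ltW].
rewrite (_ : [set v | _] = (fun v : 'rV[R]_n => `|v|) @^-1` [set 1])//.
apply: preimage_closed; last exact: closed_eq.
by move=> v _; exact: norm_continuous.
Qed.

Context {X : lmodType R}.
Implicit Types (B F : set (X -> R)) (p q z : X).

(** In terms of the cone [V] polar to [B]: for [p] in [V], the polar of the face
    [B] orthogonal to [p] is no larger than [V + R p]. It fails as soon as some
    two-dimensional image of the cone generated by [B] is not closed. *)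
Definition faces_exact B := forall p q, (forall b, B b -> b p <= 0) ->
  (forall b, B b -> b p = 0 -> b q <= 0) -> exists M : R, forall b, B b -> b q + M * b p <= 0.

(** A vector [p'] of the polar of the face differs by a multiple of [p] from a
    vector of the polar of [B]. Adding one more [p] makes the face of [B]
    orthogonal to the sum equal to the face of the face orthogonal to [p']. *)
Lemma faces_exact_face B p : (forall b, B b -> lin b) -> (forall b, B b -> b p <= 0) ->
  faces_exact B -> faces_exact [set b | B b /\ b p = 0].
Proof.
move=> lB Bp KB p' q Bp' Bq.
have [M MP] : exists M : R, forall b, B b -> b p' + M * b p <= 0.
  by apply: KB => // b Bb bp; exact: Bp'.
(* the absolute value makes the coefficient positive without changing the sign of any [b v] *)
pose v := p' + (`|M| + 1) *: p.
have vE b : B b -> b v = (b p' + M * b p) + (`|M| - M) * b p + b p.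
  by move=> Bb; rewrite /v (linD _ _ (lB b Bb)) (linZ _ _ (lB b Bb)); ring.
have hM : 0 <= `|M| - M by rewrite subr_ge0 ler_norm.
have [|b Bb bv0|N NP] := KB v q.
- move=> b Bb; rewrite vE//; have := MP b Bb; have := Bp b Bb.
  have := mulr_ge0_le0 hM (Bp b Bb); lra.
- have bp : b p = 0.
    move: bv0; rewrite vE//; have := MP b Bb; have := Bp b Bb.
    have := mulr_ge0_le0 hM (Bp b Bb); lra.
  apply: Bq => //; move: bv0; rewrite vE// bp; lra.
exists N => b [Bb bp]; have := NP b Bb; rewrite vE// bp !mulr0 !addr0.
by [].
Qed.

(** Only polars matter: [F] need not generate [B] as a cone. *)
Definition generating B F := [/\ finite_set F, F `<=` B &
  forall z, (forall f, F f -> f z <= 0) -> forall b, B b -> b z <= 0].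

Section Step.
Variables (m : nat) (a : 'I_m.+1 -> X -> R) (x : 'I_m.+1 -> X) (B : set (X -> R)).
Hypotheses (la : forall i, lin (a i)) (ax : dual_system a x)
  (lB : forall b, B b -> lin b) (Bspan : forall b, B b -> forall z, b z = \sum_i b (x i) * a i z).
Hypothesis KB : faces_exact B.
Hypothesis IH : forall (a : 'I_m -> X -> R) (x : 'I_m -> X) B,
  (forall i, lin (a i)) -> dual_system a x -> (forall b, B b -> lin b) ->
  (forall b, B b -> forall z, b z = \sum_i b (x i) * a i z) -> faces_exact B ->
  exists F, generating B F.

(** The functionals vanishing at [p] live on a space of smaller dimension. *)
Lemma face_generating p : (forall b, B b -> b p <= 0) -> (exists i, a i p != 0) ->
  exists F, generating [set b | B b /\ b p = 0] F.
Proof.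
move=> Bp [i aip].
pose a' (j : 'I_m) z := a (lift i j) z - a (lift i j) p / a i p * a i z.
apply: (@IH a' (fun j => x (lift i j))).
- by move=> j k u v; rewrite /a' !la; ring.
- move=> j l; rewrite /a' !ax (negbTE (neq_lift i l)) mulr0 subr0.
  have -> // : (lift i j == lift i l) = (j == l) by apply/eqP/eqP => [/lift_inj|->].
- by move=> b [Bb _]; exact: lB.
- move=> b [Bb bp] z.
  have := Bspan Bb p; rewrite bp (bigD1_ord i)//= => E.
  rewrite (Bspan Bb z) (bigD1_ord i)//=.
  have -> : b (x i) = - (\sum_(j < m) b (x (lift i j)) * a (lift i j) p) / a i p.
    apply: (mulIf aip); rewrite divfK//; apply/eqP; rewrite -addr_eq0.
    by apply/eqP/esym.
  rewrite mulNr mulNr !mulr_suml -sumrN -big_split/=; apply: eq_bigr => j _.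
  by rewrite /a'; ring.
- exact: faces_exact_face.
Qed.

(** Let [p] be the vector with coordinates [y]. If some [b] in [B] is positive at
    [p], it excludes a neighbourhood of [y]. Otherwise take generators of the
    face orthogonal to [p]; a vector [p + d] satisfying their inequalities is
    brought back into the polar of [B] by a multiple of [p] proportional to the
    size of [d], uniformly because [d] is a combination, with controlled
    coefficients, of finitely many vectors. *)
Lemma local_generating (y : 'rV[R]_m.+1) : `|y| = 1 -> exists (e : R) F,
  [/\ 0 < e, finite_set F, F `<=` B & forall z, (forall f, F f -> f z <= 0) ->
    (forall i, `|a i z - y ord0 i| < e) -> forall b, B b -> b z <= 0].
Proof.
move=> y1; pose p := \sum_i y ord0 i *: x i.
have ap i : a i p = y ord0 i.
  rewrite /p (lin_comb _ _ (la i)) (bigD1 i)//= ax eqxx mulr1 big1 ?addr0// => j ij.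
  by rewrite ax eq_sym (negbTE ij) mulr0.
have [[b [Bb bp]]|np] := pselect (exists b, B b /\ 0 < b p).
  pose L := \sum_i `|b (x i)|.
  have L0 : 0 <= L by exact: sumr_ge0.
  have L1 : 0 < L + 1 by rewrite ltr_wpDl.
  exists (b p / (L + 1)), [set b]; split.
  - by rewrite divr_gt0.
  - exact: finite_set1.
  - by move=> _ ->.
  - move=> z /(_ b erefl) bz az; exfalso.
    have : b p - b z <= L * (b p / (L + 1)).
      have -> : b p - b z = \sum_i b (x i) * (a i p - a i z).
        rewrite (Bspan Bb p) (Bspan Bb z) -sumrB.
        by apply: eq_bigr => i _; rewrite mulrBr.
      rewrite {1}/L mulr_suml; apply: ler_sum => i _.
      rewrite (le_trans (ler_norm _))// normrM ler_wpM2l//.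
      by rewrite ap distrC ltW// az.
    have -> : L * (b p / (L + 1)) = b p - b p / (L + 1) by field; rewrite gt_eqF.
    have : 0 < b p / (L + 1) by rewrite divr_gt0.
    lra.
have Bp b : B b -> b p <= 0.
  by move=> Bb; rewrite leNgt; apply/negP => h; apply: np; exists b.
have [i yi] : exists i, a i p != 0.
  apply: contrapT => h; have : y = 0.
    apply/rowP => i; rewrite mxE -ap; apply/eqP/negPn/negP => ai; apply: h.
    by exists i.
  by move=> y0; move: y1; rewrite y0 normr0 => /eqP; rewrite eq_sym oner_eq0.
have [F [finF FB FP]] := face_generating Bp (ex_intro _ i yi).
have [n [f fE]] := finite_family finF.
have fF k : F (f k) by rewrite fE; exists k.
have fB k : B (f k) by have [] := FB _ (fF k).
have fp k : f k p = 0 by have [] := FB _ (fF k).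
(* including the [a k] lets the size of [d] control all the coefficients *)
pose phi (k : 'I_n + 'I_m.+1) := match k with inl k => f k | inr k => a k end.
have lphi k : lin (phi k) by case: k => k /=; [exact/lB|exact: la].
have [g gP] := conformal_decomposition lphi.
have /choice[M MP] : forall j, exists M : R, 0 <= M /\
    ((forall k, f k (g j) <= 0) -> forall b, B b -> b (g j) + M * b p <= 0).
  move=> j; have [h|h] := pselect (forall k, f k (g j) <= 0); last by exists 0.
  have [M MP] : exists M : R, forall b, B b -> b (g j) + M * b p <= 0.
    apply: KB => // b Bb bp; apply: FP => // h' Fh'.
    by move: Fh'; rewrite fE => -[k _ <-]; exact: h.
  exists `|M|; split=> // _ b Bb; have := MP b Bb.
  have hM : 0 <= `|M| - M by rewrite subr_ge0 ler_norm.
  have := mulr_ge0_le0 hM (Bp b Bb); lra.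
pose kap j := \sum_i `|(a i (g j))^-1|.
pose L := \sum_j kap j * M j.
have kap0 j : 0 <= kap j by exact: sumr_ge0.
have L0 : 0 <= L by apply: sumr_ge0 => j _; rewrite mulr_ge0// (MP j).1.
have L1 : 0 < L + 1 by rewrite ltr_wpDl.
exists (L + 1)^-1, F; split=> //.
- by rewrite invr_gt0.
- by move=> h /FB[].
move=> z Fz az b Bb; pose d := z - p.
have fd k : f k d <= 0.
  by rewrite (linB _ _ (lB (fB k))) fp subr0; exact: Fz.
have ad k : `|a k d| < (L + 1)^-1 by rewrite (linB _ _ (la k)) ap.
have [lam lamP] := gP d; have [l0 lc dE] := lamP.
have bd : b d = \sum_j lam j * b (g j).
  have adE k : a k d = \sum_j lam j * a k (g j) := dE (inr k).
  rewrite (Bspan Bb d); under eq_bigr do rewrite adE mulr_sumr.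
  rewrite exchange_big/=; apply: eq_bigr => j _; rewrite (Bspan Bb (g j)) mulr_sumr.
  by apply: eq_bigr => k _; ring.
have lamj j : lam j * b (g j) <= - (lam j * M j) * b p.
  have [lj|lj] := ltP 0 (lam j); last first.
    have -> : lam j = 0 by apply/eqP; rewrite eq_le lj l0.
    by rewrite !mul0r oppr0 mul0r.
  rewrite mulNr -mulrA -mulrN ler_pM2l//.
  have [_ h] := MP j; have := h _ b Bb; suff hf : forall k, f k (g j) <= 0.
    by move=> /(_ hf); lra.
  move=> k; have [h0 h1] : (f k d = 0 -> f k (g j) = 0) /\ 0 <= f k (g j) * f k d.
    by have [cj _] := lc _ lj; exact: (cj (inl k)).
  have := fd k; rewrite le_eqVlt => /predU1P[/h0->//|vi].
  by move: h1; rewrite nmulr_lge0.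
have lamM j : lam j * M j <= kap j * M j * (L + 1)^-1.
  rewrite mulrAC; apply: ler_wpM2r; first exact: (MP j).1.
  have [lj|lj] := ltP 0 (lam j); last first.
    by rewrite (le_trans lj)// mulr_ge0// invr_ge0 ltW.
  have [k ak] : exists k, a k (g j) != 0.
    have [_ [[k|k] /= h]] := lc _ lj; last by exists k.
    apply: contrapT => nk; move: h; rewrite (Bspan (fB k)) big1 ?eqxx// => i' _.
    have [->|h] := eqVneq (a i' (g j)) 0; first by rewrite mulr0.
    by exfalso; apply: nk; exists i'.
  have h := le_trans (conformal_bound (inr k) j lamP) (ltW (ad k)).
  have nk : 0 < `|a k (g j)| by rewrite normr_gt0.
  have h2 : lam j <= `|(a k (g j))^-1| * (L + 1)^-1.
    by rewrite normfV mulrC ler_pdivlMr.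
  rewrite (le_trans h2)//; apply: ler_wpM2r; first by rewrite invr_ge0 ltW.
  by rewrite /kap (bigD1 k)//= lerDl sumr_ge0.
have sM : \sum_j lam j * M j <= 1.
  apply: (@le_trans _ _ (L * (L + 1)^-1)).
    by rewrite mulr_suml; apply: ler_sum => j _; exact: lamM.
  by rewrite ler_pdivrMr// mul1r lerDl.
have -> : z = p + d by rewrite /d; module.
rewrite (linD _ _ (lB Bb)).
have : b d <= - (\sum_j lam j * M j) * b p.
  by rewrite bd -sumrN mulr_suml; apply: ler_sum => j _; exact: lamj.
have : 0 <= 1 - \sum_j lam j * M j by rewrite subr_ge0.
by move=> /mulr_ge0_le0/(_ (Bp b Bb)); lra.
Qed.

(** Compactness of the sphere reduces the local statements to finitely many;
    homogeneity does the rest. *)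
Lemma sphere_generating : exists F, generating B F.
Proof.
have /choice[eF eFP] : forall y : 'rV[R]_m.+1, exists eF : R * set (X -> R), `|y| = 1 ->
    [/\ 0 < eF.1, finite_set eF.2, eF.2 `<=` B &
    forall z, (forall f, eF.2 f -> f z <= 0) ->
    (forall i, `|a i z - y ord0 i| < eF.1) -> forall b, B b -> b z <= 0].
  move=> y; have [y1|y1] := pselect (`|y| = 1); last by exists (1, set0).
  by have [e [F [h1 h2 h3 h4]]] := local_generating y1; exists (e, F).
have := @rV_sphere_compact m.+1; rewrite compact_cover.
move=> /(_ _ [set y : 'rV[R]_m.+1 | `|y| = 1] (fun y => ball y (eF y).1)) [].
- by move=> y /eFP[h _ _ _]; exact: ball_open.
- by move=> y y1; exists y => //; apply: ballxx; have [] := eFP y y1.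
move=> D DS Dcov.
have S1 (y : 'rV[R]_m.+1) : [set` D] y -> `|y| = 1 by move=> /= /DS/set_mem.
exists (\bigcup_(y in [set` D]) (eF y).2); split.
- apply: bigcup_finite; first exact: finite_fset.
  by move=> y /S1 /eFP[].
- by move=> f [y /S1 y1 yf]; have [_ _ h _] := eFP y y1; exact: h.
move=> z Fz b Bb; pose y0 : 'rV[R]_m.+1 := \row_i a i z.
have [y00|y00] := eqVneq y0 0.
  rewrite (Bspan Bb z) big1// => i _.
  by move/rowP: y00 => /(_ i); rewrite !mxE => ->; rewrite mulr0.
have n0 : 0 < `|y0| by rewrite normr_gt0.
have k0 : 0 < `|y0|^-1 by rewrite invr_gt0.
have y1 : `| `|y0|^-1 *: y0| = 1.
  by rewrite normrZ gtr0_norm// mulVf// gt_eqF.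
have [y yD] := Dcov _ y1; rewrite -ball_normE /= => yb.
have [_ _ FB h] := eFP y (S1 _ yD).
have := h (`|y0|^-1 *: z); rewrite -(pmulr_rle0 _ k0) -(linZ _ _ (lB Bb)); apply => //.
  move=> f yf; rewrite (linZ _ _ (lB (FB _ yf))) pmulr_rle0//; apply: Fz.
  by exists y.
move=> i; rewrite (linZ _ _ (la i)); apply: le_lt_trans yb.
rewrite distrC; have := rV_coord_le (y - `|y0|^-1 *: y0) i.
by rewrite !mxE.
Qed.

End Step.

Lemma generating_of_faces_exact m (a : 'I_m -> X -> R) (x : 'I_m -> X) B :
  (forall i, lin (a i)) -> dual_system a x -> (forall b, B b -> lin b) ->
  (forall b, B b -> forall z, b z = \sum_i b (x i) * a i z) -> faces_exact B ->
  exists F, generating B F.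
Proof.
elim: m a x B => [|m IH] a x B la ax lB Bspan KB.
  exists set0; split=> //.
  by move=> z _ b Bb; rewrite (Bspan b Bb) big_ord0.
exact: (sphere_generating la ax lB Bspan KB IH).
Qed.

End FiniteGeneration.

(** * Hidden sets in a plane *)

Section PlanarHiding.
Context {R : realType} {X : normedModType R}.
Implicit Types (A C S : set X).

Definition barrier C : set (X -> R) :=
  [set f | clin f /\ exists M, forall c, C c -> f c <= M].

(** The recession cone is the polar of the barrier cone. *)
Lemma barrier_char_cone C v : C !=set0 -> closed C -> cvx C ->
  (forall f, barrier C f -> f v <= 0) -> char_cone C v.
Proof.
move=> C0 clC cC fv c t Cc t0; apply: contrapT => nC.
have [f [b [cf fb bf]]] := separation C0 clC cC nC.
have := fv f; move=> /(_ (conj cf (ex_intro _ b fb))) fv0.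
move: bf; rewrite (linD _ _ cf.1) (linZ _ _ cf.1).
have := fb c Cc; have := mulr_ge0_le0 t0 fv0; lra.
Qed.

(** Otherwise the sum of [C] and the line spanned by [p] is a convex set with
    interior points that misses a multiple of [q]; a functional separating the
    two is a barrier functional that vanishes at [p] and is positive at [q]. *)
Lemma barrier_line C c0 r p q : cvx C -> 0 < r -> (forall z, `|z| <= r -> C (c0 + z)) ->
  (forall f, barrier C f -> f p = 0 -> f q <= 0) ->
  forall h, 0 < h -> exists T : R, C (c0 + h *: q + T *: p).
Proof.
move=> cC r0 rC fq h h0; apply: contrapT => nT.
pose K := [set x | exists T : R, C (c0 + x + T *: p)].
have [||t t1 [T CT]|f [lf fb fK fh]] := @support_ball R X K r (h *: q) _ r0.
- move=> x y t [T CT] [U CU] t0 t1; exists (t * T + (1 - t) * U).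
  have -> : c0 + (t *: x + (1 - t) *: y) + (t * T + (1 - t) * U) *: p =
    t *: (c0 + x + T *: p) + (1 - t) *: (c0 + y + U *: p) by module.
  exact: cC.
- by move=> z zr; exists 0; rewrite scale0r addr0; exact: rC.
- have t0 : 0 < t by lra.
  have tn : t != 0 by rewrite gt_eqF.
  apply: nT; exists (T / t).
  have -> : c0 + h *: q + (T / t) *: p =
    t^-1 *: (c0 + t *: (h *: q) + T *: p) + (1 - t^-1) *: (c0 + 0) by module_field.
  apply: cC => //; last by rewrite invf_le1// ltW.
    by apply: rC; rewrite normr0 ltW.
  by rewrite invr_ge0 ltW.
have C0 : C c0 by rewrite -[c0]addr0; apply: rC; rewrite normr0 ltW.
have fp : f p = 0.
  apply: contrapT => /eqP fp; have : f ((2 / f p) *: p) <= 1.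
    by apply: fK; exists (- (2 / f p)); rewrite scaleNr addrK.
  by rewrite (linZ _ _ lf) divfK//; lra.
have : f q <= 0.
  apply: fq => //; split; first by split=> //; exists r^-1; rewrite ?invr_ge0 ?(ltW r0).
  exists (f c0 + 1) => c Cc; have : f (c - c0) <= 1.
    by apply: fK; exists 0; rewrite scale0r addr0 addrC subrK.
  by rewrite (linB _ _ lf); lra.
move: fh; rewrite (linZ _ _ lf) => fh /(mulr_ge0_le0 (ltW h0)); lra.
Qed.

Lemma infinite_range (T : Type) (s : nat -> T) : (forall m n, (m < n)%N -> s m <> s n) ->
  infinite_set (range s).
Proof.
move=> sinj; apply/infiniteP; have inj : injective s.
  move=> m n; have [h|h|//] := ltngtP m n; first by move/(sinj _ _ h).
  by move=> /esym/(sinj _ _ h).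
by rewrite (card_le_eqr (inj_card_eq (in2W inj))) card_lexx.
Qed.

Lemma segmentC (a b : X) : segment a b `<=` segment b a.
Proof.
move=> z [t /=]; rewrite in_itv/= => /andP[t0 t1] <-; exists (1 - t) => /=.
  by rewrite in_itv/=; lra.
by module.
Qed.

Lemma hides_range C (s : nat -> X) :
  (forall m n, (m < n)%N -> segment (s m) (s n) `&` C !=set0) -> hides C (range s).
Proof.
move=> sC _ _ [m _ <-] [n _ <-] mn; have [h|h|h] := ltngtP m n; first exact: sC.
  by have [z [/segmentC sz Cz]] := sC _ _ h; exists z.
by case: mn; rewrite h.
Qed.

(** Some barrier functional of [C] is positive at [v]. *)
Lemma escape C c0 v (k : R) : C !=set0 -> closed C -> cvx C -> ~ char_cone C v ->
  exists N0 : R, forall N, N0 <= N -> forall c, C c -> k <= `|c0 + N *: v - c|.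
Proof.
move=> C0 clC cC vC.
have [f [[[lf [L L0 fL]] [M fM]] fv]] : exists f, barrier C f /\ 0 < f v.
  apply: contrapT => nf; apply: vC; apply: barrier_char_cone => // f bf.
  by rewrite leNgt; apply/negP => h; apply: nf; exists f.
have L1 : 0 < L + 1 by rewrite ltr_wpDl.
exists (((L + 1) * `|k| + M - f c0) / f v) => N; rewrite ler_pdivrMr// => hN c Cc.
have := fL (c0 + N *: v - c); rewrite (linB _ _ lf) (linD _ _ lf) (linZ _ _ lf) => h.
have h1 := ler_norm (f c0 + N * f v - f c).
have := fM c Cc; set d := `|c0 + _ - c| in h * => h2.
have d0 : 0 <= d by exact: normr_ge0.
rewrite (le_trans (ler_norm k))// -(ler_pM2l L1); nra.
Qed.

(** The points are [c0 + N (q + M p)]. For given [M] they escape from [C] when [N]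
    grows, because [q + M p] is not a recession direction. If [M] is chosen large
    with respect to the previous points, the segment to each of these rises fast
    enough in the direction [p] to enter [C]. *)
Lemma planar_hiding C c0 p q : closed C -> cvx C -> C c0 -> char_cone C p ->
  (forall M : R, ~ char_cone C (q + M *: p)) ->
  (forall h, 0 < h -> exists T : R, C (c0 + h *: q + T *: p)) -> infinitely_hiding C.
Proof.
move=> clC cC Cc0 pC qC hT; have C0 : C !=set0 by exists c0.
have /choice[T TP] : forall N : R, exists T : R, 0 < N -> C (c0 + (2 * N) *: q + T *: p).
  move=> N; have [N0|N0] := ltP 0 N; last by exists 0.
  by have [|T CT] := hT (2 * N); [rewrite mulr_gt0|exists T].
pose y (u : nat * (R * R)) := c0 + u.2.1 *: (q + u.2.2 *: p).
have [|u [uP uQ]] := @greedy _ (0%N, (0, 0))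
    (fun u => 0 < u.2.1 /\ forall c, C c -> u.1%:R + 1 <= `|y u - c|)
    (fun u w => (u.1 < w.1)%N /\ segment (y u) (y w) `&` C !=set0).
- move=> n u uP.
  pose k := (\max_(i < n) (u i).1).+1.
  pose M := \sum_(i < n) (`|T (u i).2.1| / (u i).2.1 + `|(u i).2.2|).
  have [N0 N0P] := @escape C c0 (q + M *: p) (k%:R + 1) C0 clC cC (qC M).
  pose N := \sum_(i < n) `|(u i).2.1| + `|N0| + 1.
  have sN : 0 <= \sum_(i < n) `|(u i).2.1| by exact: sumr_ge0.
  have NN0 : N0 <= N by have := ler_norm N0; rewrite /N; lra.
  exists (k, (N, M)); split.
    by split; [rewrite /N; have := normr_ge0 N0; move=> /=; lra|exact: N0P].
  move=> m mn; split=> /=.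
    by rewrite /k ltnS; exact: (leq_bigmax (Ordinal mn)).
  have [Nm0 _] := uP m mn; set Nm := (u m).2.1 in Nm0; set Mm := (u m).2.2.
  have NmN : Nm <= N.
    rewrite /N (bigD1 (Ordinal mn))//= -/Nm (gtr0_norm Nm0).
    have : 0 <= \sum_(i < n | i != Ordinal mn) `|(u i).2.1| by exact: sumr_ge0.
    have := normr_ge0 N0; lra.
  have N_gt0 : 0 < N by lra.
  have MmM : `|T Nm| / Nm + `|Mm| <= M.
    rewrite /M (bigD1 (Ordinal mn))//= -/Nm -/Mm lerDl; apply: sumr_ge0 => i _.
    by rewrite addr_ge0// divr_ge0//; have [/ltW] := uP i (ltn_ord i).
  have TN := TP Nm Nm0.
  have [Nn Nmn] : N != 0 /\ Nm != 0 by rewrite !gt_eqF.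
  (* the point of the segment whose [q]-coordinate lies in [Nm, 2 Nm] *)
  pose t := Nm / N.
  have t0 : 0 <= t by rewrite divr_ge0 ?(ltW Nm0) ?(ltW N_gt0).
  have t1 : t <= 1 by rewrite ler_pdivrMr// mul1r.
  pose s := 1 - t / 2.
  have sE : (1 - t) * Nm + t * N = s * (2 * Nm) by rewrite /s /t; field.
  pose Z := (1 - t) * Nm * Mm + Nm * M - s * T Nm.
  have Z0 : 0 <= Z.
    have h1 : Nm * (`|T Nm| / Nm + `|Mm|) <= Nm * M by rewrite ler_pM2l.
    have h2 : Nm * (`|T Nm| / Nm + `|Mm|) = `|T Nm| + Nm * `|Mm| by field.
    have h3 : s * T Nm <= `|T Nm|.
      apply: (@le_trans _ _ (s * `|T Nm|)); last by rewrite ler_piMl// /s; lra.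
      by rewrite ler_wpM2l ?ler_norm// /s; lra.
    have h4 : - (Nm * `|Mm|) <= (1 - t) * Nm * Mm.
      have h5 : (1 - t) * (Nm * `|Mm|) <= Nm * `|Mm|.
        by rewrite ler_piMl ?mulr_ge0 ?(ltW Nm0)//; lra.
      have h6 : - `|Mm| <= Mm by have := ler_norm (- Mm); rewrite normrN; lra.
      have h7 : 0 <= (1 - t) * Nm by rewrite mulr_ge0 ?(ltW Nm0)//; lra.
      have := ler_wpM2l h7 h6; lra.
    rewrite /Z; lra.
  exists ((s *: (c0 + (2 * Nm) *: q + T Nm *: p) + (1 - s) *: c0) + Z *: p).
  split; last by apply: pC => //; apply: cC => //; rewrite /s; lra.
  exists (1 - t) => /=; first by rewrite in_itv/=; lra.
  by rewrite /y /= -/Nm -/Mm /Z /s /t; module_field.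
have ynC n : ~ C (y (u n)).
  move=> Cy; have [_ /(_ _ Cy)] := uP n; rewrite subrr normr0.
  by have : (0 : R) <= (u n).1%:R by []; lra.
have ulen n : (n <= (u n).1)%N.
  elim: n => // n IH; apply: leq_ltn_trans IH _; exact: (uQ n n.+1 (ltnSn _)).1.
exists (range (y \o u)); split.
- apply: infinite_range => m n mn /= E; have [_ [z [[t _ zE] Cz]]] := uQ m n mn.
  apply: (ynC n); move: Cz; rewrite -zE E.
  by have -> : t *: y (u n) + (1 - t) *: y (u n) = y (u n) by module.
- by move=> _ [n _ <-]; exact: ynC.
- by apply: hides_range => m n mn; exact: (uQ m n mn).2.
- apply: eq_infty => k; pose n := Num.truncn `|k|.
  apply: (@le_trans _ _ (set_dist (y (u n)) C)); last first.
    by apply: ereal_sup_ubound; exists (y (u n)) => //; exists n.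
  apply: le_ereal_inf_tmp => _ [c Cc <-]; rewrite lee_fin.
  have [_ /(_ c Cc)] := uP n; apply: le_trans.
  have h1 : k < n.+1%:R by apply: le_lt_trans (ler_norm k) _; exact: truncnS_gt.
  have h2 : (n%:R : R) <= (u n).1%:R by rewrite ler_nat.
  by move: h1; rewrite -natr1; lra.
Qed.

(** Keep the hidden points at distance at least 1: if they were finitely many,
    the distances would be bounded. *)
Lemma infinitely_positively_hiding C : C !=set0 -> infinitely_hiding C -> positively_hiding C.
Proof.
move=> [c0 Cc0] [S [Sinf SC Shid Ssup]].
pose S' := [set s | S s /\ (1 <= set_dist s C)%E].
exists S'; split.
- move=> finS'.
  have [s sE] := (finite_seqP _).1 finS'.
  have fin x : (set_dist x C <= (`|x - c0|)%:E)%E by exact: set_dist_le.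
  have : (ereal_sup [set set_dist a C | a in S] <= (1 + \sum_(x <- s) `|x - c0|)%:E)%E.
    apply: ge_ereal_sup => _ [x Sx <-].
    have s0 : 0 <= \sum_(y <- s) `|y - c0| by exact: sumr_ge0.
    have [h|h] := leP 1%E (set_dist x C).
      have xs : x \in s by have : S' x by []; rewrite sE.
      apply: (le_trans (fin x)); rewrite lee_fin (big_rem x)//=.
      have : 0 <= \sum_(y <- rem x s) `|y - c0| by exact: sumr_ge0.
      lra.
    by apply: (le_trans (ltW h)); rewrite lee_fin; lra.
  by rewrite Ssup leye_eq.
- by move=> x [/SC].
- by move=> a b [Sa _] [Sb _]; exact: Shid.
- apply: (@lt_le_trans _ _ 1%E); first by rewrite lte_fin.
  by apply: le_ereal_inf_tmp => _ [x [_ h] <-].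
Qed.

End PlanarHiding.

(** * Convex sets whose recession cone has a lineality space of infinite codimension *)

Section UltraLimits.
Context {R : realType} (U : set_system nat).
Hypothesis UU : UltraFilter U.
Implicit Types (v : nat -> R).

Let PU : ProperFilter U. Proof. exact: ultra_proper. Qed.

Lemma ultra_limit v : (forall n, `|v n| <= 1) -> exists l, forall e, 0 < e ->
  U [set n | `|v n - l| < e].
Proof.
move=> v1; pose E := [set t : R | U [set n | t <= v n]].
have E1 : E (-1).
  by apply: filterS filterT => n _ /=; have := v1 n; rewrite ler_norml => /andP[].
have Eub : ubound E 1.
  move=> t Et; have [n /= tn] := filter_ex Et.
  by have := v1 n; rewrite ler_norml => /andP[_]; exact: le_trans.
have supE : has_sup E by split; [exists (-1)|exists 1].
exists (sup E) => e e0.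
have [t Et te] := sup_adherent e0 supE.
have nE : ~ E (sup E + e).
  by move=> h; have := ub_le_sup supE.2 h; lra.
have [//|h] := in_ultra_setVsetC [set n | sup E + e <= v n] UU.
apply: filterS (filterI Et h) => n /= [tn] /negP; rewrite -ltNge => nt.
by rewrite ltr_norml; apply/andP; split; lra.
Qed.

(** Ultrafilters replace repeated extractions of subsequences: finitely many
    largeness conditions can be met simultaneously. *)
Lemma ultra_forall (S : nat -> set nat) n : (forall m, U (S m)) ->
  U [set i | forall m, (m < n)%N -> S m i].
Proof.
move=> US; elim: n => [|n IH]; first by apply: filterS filterT.
apply: filterS (filterI IH (US n)) => i /= [h1 h2] m.
by rewrite ltnS leq_eqVlt => /predU1P[->|/h1].
Qed.

End UltraLimits.

Section InfiniteCodimension.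
Context {R : realType} {X : normedModType R}.
Implicit Types (A C D K : set X).

Lemma star_shaped D (z : X) s t : cvx D -> D 0 -> 0 < s -> s <= t -> D (t *: z) -> D (s *: z).
Proof.
move=> cD D0 s0 st Dt; have t0 : 0 < t by lra.
have -> : s *: z = (s / t) *: (t *: z) + (1 - s / t) *: 0.
  have tn : t != 0 by rewrite gt_eqF.
  by module_field.
apply: cD => //; first by rewrite divr_ge0// ltW.
by rewrite ler_pdivrMr// mul1r.
Qed.

(** The last point of a closed convex set on a ray that leaves it. *)
Lemma boundary_point D r (z : X) t0 : closed D -> cvx D -> 0 < r ->
  (forall x, `|x| <= r -> D x) -> 0 < t0 -> ~ D (t0 *: z) ->
  exists t, [/\ 0 < t, D (t *: z) & forall s, 1 < s -> ~ D (s *: (t *: z))].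
Proof.
move=> clD cD r0 rD t00 nD.
have D0 : D 0 by apply: rD; rewrite normr0 ltW.
have z1 : 0 < `|z| + 1 by rewrite ltr_wpDl.
pose E := [set t : R | 0 < t /\ D (t *: z)].
have Er : E (r / (`|z| + 1)).
  split; first by rewrite divr_gt0.
  apply: rD; rewrite normrZ gtr0_norm ?divr_gt0// -mulrA ler_piMr ?(ltW r0)//.
  by rewrite mulrC ler_pdivrMr// mul1r lerDl.
have Eub : ubound E t0.
  move=> t [tp Dt]; rewrite leNgt; apply/negP => tt; apply: nD.
  exact: star_shaped (ltW tt) Dt.
have supE : has_sup E by split; [exists (r / (`|z| + 1))|exists t0].
have Ele x : E x -> x <= sup E by apply: ub_le_sup; case: supE.
have rsup := Ele _ Er.
have s0 : 0 < sup E by apply: lt_le_trans rsup; rewrite divr_gt0.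
exists (sup E); split=> //.
- apply: contrapT => nDs; have [e e0 eD] := closed_far clD nDs.
  have e1 : 0 < e / (`|z| + 1) by rewrite divr_gt0.
  have [t [tp Dt] te] := sup_adherent e1 supE.
  have tsup := Ele _ (conj tp Dt).
  have := eD _ Dt; rewrite -scalerBl normrZ ger0_norm ?subr_ge0// => h.
  have h2 : (sup E - t) * `|z| <= e / (`|z| + 1) * `|z|.
    by rewrite ler_wpM2r//; lra.
  have h3 : e / (`|z| + 1) * `|z| < e.
    by rewrite mulrAC ltr_pdivrMr// ltr_pM2l// ltrDl.
  lra.
- move=> s s1 Ds; have Es : E (s * sup E).
    by split; [rewrite mulr_gt0//; lra|rewrite -scalerA].
  have := Ele _ Es.
  by rewrite -ler_pdivlMr// divff ?gt_eqF//; lra.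
Qed.

Section Localization.
Variables (K : set X) (r : R).
Hypotheses (clK : closed K) (cK : cvx K) (r0 : 0 < r) (rK : forall z, `|z| <= r -> K z).

Let K0 : K 0. Proof. by apply: rK; rewrite normr0 ltW. Qed.

(** The norm bound follows from the inclusion of the ball of radius [r] in [K]. *)
Definition polar (f : X -> R) :=
  [/\ lin f, forall z, `|f z| <= r^-1 * `|z| & forall k, K k -> f k <= 1].

Lemma polar_clin f : polar f -> clin f.
Proof. by move=> [lf fb _]; split=> //; exists r^-1; rewrite ?invr_ge0 ?(ltW r0). Qed.

(** Both [c] and [- c] are in [K], which bounds every functional of the polar at
    [c] on both sides; the sign of [c] is chosen so that [c] is on the boundary
    of [K]. *)
Lemma symmetric_boundary z : ~ (char_cone K z /\ char_cone K (- z)) ->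
  exists c t f, [/\ c = t *: z, K c, K (- c), polar f & f c = 1].
Proof.
move=> nz; pose D := [set x | K x /\ K (- x)].
have cD : cvx D.
  move=> x y t [Kx Kx'] [Ky Ky'] t0 t1; split; first exact: cK.
  have -> : - (t *: x + (1 - t) *: y) = t *: (- x) + (1 - t) *: (- y) by module.
  exact: cK.
have clD : closed D.
  apply: closedI => //; apply: preimage_closed => //.
  by move=> x _; exact: opp_continuous.
have rD x : `|x| <= r -> D x by move=> xr; split; apply: rK; rewrite ?normrN.
have [t0 [t00 nD]] : exists t0, 0 < t0 /\ ~ D (t0 *: z).
  apply: contrapT => h.
  have hD t : 0 <= t -> D (t *: z).
    rewrite le_eqVlt => /predU1P[<-|tp]; first by apply: rD; rewrite scale0r normr0 ltW.
    by apply: contrapT => nDt; apply: h; exists t.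
  apply: nz; split; apply: (@bounded_ray_cone _ _ K 0 _ 0) => // s s0.
    by exists (s *: z); [have [] := hD s s0|rewrite add0r subrr normr0].
  exists (- (s *: z)); [by have [] := hD s s0|].
  by rewrite add0r scalerN subrr normr0.
have [t [tp [Kt Kt'] Dt]] := boundary_point clD cD r0 rD t00 nD.
set c := t *: z in Kt Kt' Dt.
have supp x : K x -> K (- x) -> (forall s, 1 < s -> ~ K (s *: x)) ->
    (exists k, x = k *: z) ->
    exists c t f, [/\ c = t *: z, K c, K (- c), polar f & f c = 1].
  move=> Kx KNx xs [k xE].
  have [f [lf fb fK f1]] := support_ball cK r0 rK xs.
  exists x, k, f; split=> //; apply/eqP; rewrite eq_le f1 andbT; exact: fK.
have [h|h] := pselect (forall s, 1 < s -> ~ K (s *: c)).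
  by apply: (supp c) => //; exists t.
apply: (supp (- c)) => //; rewrite ?opprK//; last by exists (- t); rewrite /c scaleNr.
move=> s s1 Ks; apply: h => s' s'1 Ks'.
apply: (Dt (Num.min s s')); first by rewrite lt_min s1.
have m0 : 0 < Num.min s s' by rewrite lt_min; apply/andP; split; lra.
split; first by apply: star_shaped Ks' => //; rewrite ge_min lexx orbT.
by rewrite -scalerN; apply: star_shaped Ks => //; rewrite ge_min lexx.
Qed.

Hypothesis infinite_codim : forall n (g : 'I_n -> X -> R), (forall i, clin (g i)) ->
  exists z, (forall i, g i z = 0) /\ ~ (char_cone K z /\ char_cone K (- z)).

Lemma triangular_system : exists (c : nat -> X) (f : nat -> X -> R),
  [/\ forall n, K (c n), forall n, K (- c n), forall n, polar (f n),
      forall n, f n (c n) = 1 & forall m n, (m < n)%N -> f m (c n) = 0].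
Proof.
have [|u [uP uQ]] := @greedy (X * (X -> R)) (0, fun=> 0)
    (fun u => [/\ K u.1, K (- u.1), polar u.2 & u.2 u.1 = 1])
    (fun u w => u.2 w.1 = 0).
  move=> n u uP.
  have [|z [gz nz]] := @infinite_codim n (fun i => (u i).2).
    by move=> i; have [_ _ h _] := uP i (ltn_ord i); exact: polar_clin.
  have [c [t [f [cE Kc Kc' pf fc]]]] := symmetric_boundary nz.
  exists (c, f); split=> // m mn /=.
  have [_ _ [lf _ _] _] := uP m mn.
  by rewrite cE (linZ _ _ lf) (gz (Ordinal mn)) mulr0.
exists (fun n => (u n).1), (fun n => (u n).2); split=> // n; by have [] := uP n.
Qed.

(** The functionals of [triangular_system] are uncontrolled at the points with
    smaller indices. One uses instead the functional [b i j] supporting [K] in the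
    direction [c i - c j]. Along a fast increasing sequence of pairs, an
    ultrafilter makes [b i j] almost constant on the points with smaller indices,
    with a value independent of the point, and almost constant on the points with
    larger indices; so it is small on the other differences. *)
Lemma localized_system : exists (a : nat -> X -> R) (w : nat -> X),
  [/\ forall n, polar (a n), forall n, K (w n), forall n, a n (w n) = 1 &
      forall m n, m <> n -> a m (w n) <= 2^-1].
Proof.
have [c [f [Kc KNc pf fc fc0]]] := triangular_system.
have /choice[bt btP] : forall ij : nat * nat, exists bt : (X -> R) * R, polar bt.1 /\
    ((ij.1 < ij.2)%N -> [/\ 0 < bt.2, bt.2 <= 1, K (bt.2 *: (c ij.1 - c ij.2)) &
      bt.1 (bt.2 *: (c ij.1 - c ij.2)) = 1]).
  move=> [i j] /=; have [ij|ij] := ltnP i j; last first.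
    exists ((fun=> 0), 0); split=> //; split=> //.
    - by move=> k x y; rewrite mulr0 addr0.
    - by move=> z; rewrite normr0 mulr_ge0// invr_ge0 ltW.
  have [lf _ fK] := pf i.
  have fd : f i (c i - c j) = 1 by rewrite (linB _ _ lf) fc fc0// subr0.
  have n2 : ~ K (2 *: (c i - c j)).
    by move=> /fK; rewrite (linZ _ _ lf) fd; lra.
  have [t [t0 Kt tb]] := boundary_point clK cK r0 rK (ltr0n R 2) n2.
  have [b [lb bb bK b1]] := support_ball cK r0 rK tb.
  exists (b, t); split=> // _; split=> //.
    by have := fK _ Kt; rewrite (linZ _ _ lf) fd mulr1.
  by apply/eqP; rewrite eq_le b1 andbT; exact: bK.
pose b i j := (bt (i, j)).1; pose t i j := (bt (i, j)).2.
have pb i j : polar (b i j) by have [] := btP (i, j).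
have bc i j l : `|b i j (c l)| <= 1.
  have [lb _ bK] := pb i j; rewrite ler_norml (bK _ (Kc l)) andbT lerNl.
  by rewrite -(linN _ lb); exact: bK.
have [U [UU Uoo]] := ultraFilterLemma eventually_filter.
have PU : ProperFilter U by exact: ultra_proper.
have lim1 v : (forall n, `|v n| <= 1) -> exists l : R, `|l| <= 1 /\
    forall e, 0 < e -> U [set n | `|v n - l| < e].
  move=> v1; have [l lP] := ultra_limit UU v1; exists l; split=> //.
  rewrite leNgt; apply/negP => l1.
  have l10 : 0 < `|l| - 1 by rewrite subr_gt0.
  have [n /= h] := filter_ex (lP _ l10).
  have := ler_normD (v n) (l - v n); rewrite addrC subrK distrC; have := v1 n; lra.
have /choice[Z ZP] : forall ij : nat * nat, exists l : R, `|l| <= 1 /\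
    forall e, 0 < e -> U [set n | `|b ij.1 ij.2 (c n) - l| < e].
  by move=> ij; apply: lim1.
have /choice[L2 L2P] : forall il : nat * nat, exists l : R, `|l| <= 1 /\
    forall e, 0 < e -> U [set j | `|b il.1 j (c il.2) - l| < e].
  by move=> il; apply: (lim1 (fun j => b il.1 j (c il.2))).
have /choice[L1 L1P] : forall l : nat, exists x : R, `|x| <= 1 /\
    forall e, 0 < e -> U [set i | `|L2 (i, l) - x| < e].
  by move=> l; apply: (lim1 (fun i => L2 (i, l))) => i; exact: (L2P (i, l)).1.
have [L0 [_ L0P]] := lim1 L1 (fun l => (L1P l).1).
(* 12: the difference of two values is within [6 d] of 0, to be at most one half *)
pose d : R := 12^-1.
have d0 : 0 < d by rewrite invr_gt0.
have [|u [uP uQ]] := @greedy (nat * nat) (0, 0)%N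
    (fun u => [/\ (u.1 < u.2)%N, `|L1 u.1 - L0| < d & `|L1 u.2 - L0| < d])
    (fun u v => [/\ `|b v.1 v.2 (c u.1) - L1 u.1| < 2 * d,
      `|b v.1 v.2 (c u.2) - L1 u.2| < 2 * d,
      `|b u.1 u.2 (c v.1) - Z u| < d & `|b u.1 u.2 (c v.2) - Z u| < d]).
  move=> n u _.
  have [i [[[/= i1 i2] i3] i4]] := filter_ex (filterI (filterI (filterI (L0P d d0)
    (ultra_forall UU n (fun m => (L1P (u m).1).2 d d0)))
    (ultra_forall UU n (fun m => (L1P (u m).2).2 d d0)))
    (ultra_forall UU n (fun m => (ZP (u m)).2 d d0))).
  have Ui : U [set j | (i < j)%N] by apply: Uoo; exact: nbhs_infty_gt.
  have [j [[[[/= ij j1] j2] j3] j4]] := filter_ex (filterI (filterI (filterI (filterI Ui (L0P d d0))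
    (ultra_forall UU n (fun m => (L2P (i, (u m).1)).2 d d0)))
    (ultra_forall UU n (fun m => (L2P (i, (u m).2)).2 d d0)))
    (ultra_forall UU n (fun m => (ZP (u m)).2 d d0))).
  exists (i, j); split=> //= m mn; split; [| |exact: (i4 m mn)|exact: (j4 m mn)].
    have := j2 m mn; have := i2 m mn; rewrite /= => h1 h2.
    by have := ler_distD (L2 (i, (u m).1)) (b i j (c (u m).1)) (L1 (u m).1); lra.
  have := j3 m mn; have := i3 m mn; rewrite /= => h1 h2.
  by have := ler_distD (L2 (i, (u m).2)) (b i j (c (u m).2)) (L1 (u m).2); lra.
pose I n := (u n).1; pose J n := (u n).2.
have IJ n : (I n < J n)%N by have [] := uP n.
exists (fun n => b (I n) (J n)), (fun n => t (I n) (J n) *: (c (I n) - c (J n))); split=> //.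
- by move=> n; have [_ /(_ (IJ n))[]] := btP (I n, J n).
- by move=> n; have [_ /(_ (IJ n))[]] := btP (I n, J n).
move=> m n mn; have [lb _ _] := pb (I m) (J m).
have [_ /(_ (IJ n))[/= t0 t1 _ _]] := btP (I n, J n).
rewrite -/(t (I n) (J n)) in t0 t1.
rewrite (linZ _ _ lb) (linB _ _ lb).
suff : b (I m) (J m) (c (I n)) - b (I m) (J m) (c (J n)) <= 2^-1.
  set x := _ - _ => h.
  have : t (I n) (J n) * x <= t (I n) (J n) * 2^-1 by rewrite ler_pM2l.
  have : t (I n) (J n) * 2^-1 <= (2^-1 : R) by rewrite ler_piMl// invr_ge0.
  lra.
have d6 : 6 * d = 2^-1 by rewrite /d; field.
have [h|h|//] := ltngtP m n.
  have [_ _] := uQ m n h; rewrite -/(I m) -/(J m) -/(I n) -/(J n) !ltr_norml.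
  by move=> /andP[? ?] /andP[? ?]; lra.
have [+ + _ _] := uQ n m h; have [_] := uP n.
rewrite -/(I m) -/(J m) -/(I n) -/(J n) !ltr_norml.
by move=> /andP[? ?] /andP[? ?] /andP[? ?] /andP[? ?]; lra.
Qed.

End Localization.

(** [N] is the operator norm, and [x] attains at least half of it. *)
Lemma norming f : clin f -> (exists z, f z != 0) -> exists (N : R) (x : X),
  [/\ 0 < N, `|x| <= 1, N / 2 <= f x & forall z, `|f z| <= N * `|z|].
Proof.
move=> [lf [M M0 fM]] [z fz]; pose E := [set `|f x| | x in [set x : X | `|x| <= 1]].
have z0 : 0 < `|z|.
  by rewrite normr_gt0; apply: contraNneq fz => ->; rewrite (lin0 lf).
have unit (y : X) : y != 0 -> `| `|y|^-1 *: y| <= 1.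
  move=> y0; by rewrite normrZ gtr0_norm ?invr_gt0 ?normr_gt0// mulVf ?normr_eq0.
have Ez : E (`|f z| / `|z|).
  exists (`|z|^-1 *: z); first by apply: unit; rewrite -normr_gt0.
  by rewrite (linZ _ _ lf) normrM ger0_norm ?invr_ge0// mulrC.
have supE : has_sup E.
  split; first by exists (`|f z| / `|z|).
  exists M => _ [x /= x1 <-]; apply: le_trans (fM x) _.
  by rewrite ler_piMr.
have Ele y : E y -> y <= sup E by apply: ub_le_sup; case: supE.
have N0 : 0 < sup E.
  by apply: lt_le_trans (Ele _ Ez); rewrite divr_gt0// normr_gt0.
have N20 : 0 < sup E / 2 by rewrite divr_gt0.
have [_ [x /= x1 <-] h] := sup_adherent N20 supE.
have fb y : `|f y| <= sup E * `|y|.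
  have [->|y0] := eqVneq y 0; first by rewrite (lin0 lf) !normr0 mulr0.
  rewrite -ler_pdivrMr ?normr_gt0//; apply: Ele.
  exists (`|y|^-1 *: y); first exact: unit.
  by rewrite (linZ _ _ lf) normrM ger0_norm ?invr_ge0// mulrC.
have [fx|fx] := leP 0 (f x).
  by exists (sup E), x; split=> //; move: h; rewrite ger0_norm//; lra.
exists (sup E), (- x); split=> //; rewrite ?normrN// (linN _ lf).
by move: h; rewrite ltr0_norm//; lra.
Qed.

Lemma closed_near A : (forall x, (forall d : R, 0 < d -> exists2 y, A y & `|x - y| < d) -> A x) ->
  closed A.
Proof. by move=> h x /closure_near; exact: h. Qed.

(** The set [A] consists of the points close to [C] at which all the functionals
    are at most 1. The point [w n], pushed out by a vector at which [a n] is
    nearly maximal, leaves [A] by a fixed distance. The midpoints of pushed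
    points stay in [A], because each functional is at most one half at all the
    [w m] but one. *)
Lemma localized_hiding C c0 r (a : nat -> X -> R) (w : nat -> X) :
  closed C -> cvx C -> 0 < r -> (forall n, polar [set x | C (c0 + x)] r (a n)) ->
  (forall n, C (c0 + w n)) -> (forall n, a n (w n) = 1) ->
  (forall m n, m <> n -> a m (w n) <= 2^-1) -> C !=set0 ->
  exists A, [/\ conv_H A, nearby (r + 1) A C, C `<=` A & positively_hiding A].
Proof.
move=> clC cC r0 pa Cw aw amn [c Cc]; pose rr := r / 4.
have rr0 : 0 < rr by rewrite divr_gt0.
have /choice[Nx NxP] : forall n, exists Nx : R * X,
    [/\ 0 < Nx.1, `|Nx.2| <= 1, Nx.1 / 2 <= a n Nx.2 & forall z, `|a n z| <= Nx.1 * `|z|].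
  move=> n; have [lf fb _] := pa n.
  have [||N [x h]] := @norming (a n); last by exists (N, x).
    by split=> //; exists r^-1; rewrite ?invr_ge0 ?(ltW r0).
  by exists (w n); rewrite aw oner_neq0.
pose u n := rr *: (Nx n).2.
have u1 n : `|u n| <= rr.
  have [_ h _ _] := NxP n; rewrite normrZ gtr0_norm//.
  by have := ler_wpM2l (ltW rr0) h; rewrite mulr1.
have au m n : a m (u n) <= 4^-1.
  have [_ fb _] := pa m; rewrite (le_trans (ler_norm _))// (le_trans (fb _))//.
  rewrite mulrC ler_pdivrMr// (le_trans (u1 n))// /rr; lra.
have aun n : rr * ((Nx n).1 / 2) <= a n (u n).
  have [lf _ _] := pa n; have [_ _ h _] := NxP n.
  by rewrite /u (linZ _ _ lf) ler_pM2l.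
pose A := [set x | thickening rr C x /\ forall n, a n (x - c0) <= 1].
pose s n := c0 + w n + u n.
have CA : C `<=` A.
  move=> x Cx; split; first exact: thickening_sub (ltW rr0) _ Cx.
  by move=> n; have [_ _] := pa n; apply; rewrite /= addrC subrK.
have clA : closed A.
  apply: closed_near => x xA; split.
    by apply: thickening_near => d d0; have [y [yA _] xy] := xA d d0; exists y.
  move=> n; have [lf fb _] := pa n; apply/ler_addgt0Pr => e e0.
  have er : 0 < e * r by rewrite mulr_gt0.
  have [y [_ /(_ n) yA] xy] := xA _ er.
  have -> : x - c0 = (y - c0) + (x - y) by module.
  rewrite (linD _ _ lf) lerD// (le_trans (ler_norm _))// (le_trans (fb _))//.
  by rewrite mulrC ler_pdivrMr// ltW.
have cA : cvx A.
  move=> x y t [xA xa] [yA ya] t0 t1; have t1' : 0 <= 1 - t by lra.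
  split=> [|n]; first exact: thickening_cvx.
  have [lf _ _] := pa n.
  have -> : t *: x + (1 - t) *: y - c0 = t *: (x - c0) + (1 - t) *: (y - c0) by module.
  rewrite (linD _ _ lf) !(linZ _ _ lf).
  have := ler_wpM2l t0 (xa n); have := ler_wpM2l t1' (ya n); lra.
have sA n x : A x -> rr / 2 <= `|s n - x|.
  move=> [_ /(_ n)]; have [lf _ _] := pa n; have [N0 _ _ fb] := NxP n.
  have -> : x - c0 = (w n + u n) - (s n - x) by rewrite /s; module.
  rewrite (linB _ _ lf) (linD _ _ lf) aw => h.
  rewrite -(ler_pM2l N0); have := fb (s n - x); have := ler_norm (a n (s n - x)).
  have := aun n; lra.
have mid m n : m <> n -> A (2^-1 *: s m + (1 - 2^-1) *: s n).
  move=> mn; split=> [e e0|k].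
    exists (2^-1 *: (c0 + w m) + (1 - 2^-1) *: (c0 + w n)).
      by apply: cC => //; lra.
    have -> : 2^-1 *: s m + (1 - 2^-1) *: s n -
        (2^-1 *: (c0 + w m) + (1 - 2^-1) *: (c0 + w n)) =
        2^-1 *: u m + (1 - 2^-1) *: u n by rewrite /s; module.
    have h0 : 0 <= 1 - 2^-1 :> R by lra.
    have h1 : `|2^-1 *: u m| = 2^-1 * `|u m| by rewrite normrZ ger0_norm.
    have h2 : `|(1 - 2^-1) *: u n| = (1 - 2^-1) * `|u n| by rewrite normrZ ger0_norm.
    rewrite (le_lt_trans (ler_normD _ _))// h1 h2.
    have := u1 m; have := u1 n; lra.
  have [lf _ _] := pa k.
  have -> : 2^-1 *: s m + (1 - 2^-1) *: s n - c0 =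
    2^-1 *: (w m + u m) + (1 - 2^-1) *: (w n + u n) by rewrite /s; module.
  rewrite (linD _ _ lf) !(linZ _ _ lf) !(linD _ _ lf).
  have := au k m; have := au k n.
  have [km|km] := eqVneq k m; have [kn|kn] := eqVneq k n.
  - by case: mn; rewrite -km -kn.
  - by rewrite -km aw; have := amn _ _ (elimN eqP kn); lra.
  - by rewrite -kn aw; have := amn _ _ (elimN eqP km); lra.
  - by have := amn _ _ (elimN eqP kn); have := amn _ _ (elimN eqP km); lra.
have smid m n : segment (s m) (s n) (2^-1 *: s m + (1 - 2^-1) *: s n).
  by exists 2^-1 => //=; rewrite in_itv/=; lra.
exists A; split=> //.
- by split; [exists c; exact: CA|by []|exact/convex_cvx].
- move=> x [/(_ 1 ltr01)[c' Cc' xc] _]; exists c' => //.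
  by apply: (le_trans (ltW xc)); rewrite /rr; lra.
- exists (range s); split.
  + apply: infinite_range => m n mn E.
    have /mid : m <> n by move=> h; rewrite h ltnn in mn.
    rewrite E => /(sA n).
    have -> : s n - (2^-1 *: s n + (1 - 2^-1) *: s n) = 0 by module.
    by rewrite normr0; lra.
  + by move=> _ [n _ <-] /(sA n); rewrite subrr normr0; lra.
  + apply: hides_range => m n mn; exists (2^-1 *: s m + (1 - 2^-1) *: s n).
    by split; [exact: smid|apply: mid => h; rewrite h ltnn in mn].
  + apply: (@lt_le_trans _ _ (rr / 2)%:E); first by rewrite lte_fin divr_gt0.
    apply: le_ereal_inf_tmp => _ [_ [n _ <-] <-].
    by apply: le_ereal_inf_tmp => _ [x Ax <-]; rewrite lee_fin; exact: sA.
Qed.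

End InfiniteCodimension.

(** * The dichotomy between polyhedral components and hidden sets *)

Section Dichotomy.
Context {R : realType} {X : normedModType R}.
Implicit Types (A C P : set X).

(** The barrier functionals vanish on the lineality space of the recession cone,
    hence are combinations of finitely many functionals, and
    [generating_of_faces_exact] applies. *)
Lemma faces_exact_recession_system C n (g : 'I_n -> X -> R) : C !=set0 -> closed C -> cvx C ->
  (forall i, lin (g i)) ->
  (forall z, (forall i, g i z = 0) -> char_cone C z /\ char_cone C (- z)) ->
  faces_exact (barrier C) -> exists k (f : 'I_k -> X -> R), recession_system C f.
Proof.
move=> C0 clC cC lg gC KC; have [m [a [x [aP ax res]]]] := span_dual_system lg.
have la j : lin (a j).
  have [y aE] := aP j; move=> k u v; rewrite !aE mulr_sumr -big_split/=.
  by apply: eq_bigr => i _; rewrite lg; ring.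
have bspan b : barrier C b -> forall z, b z = \sum_i b (x i) * a i z.
  move=> [[lb _] bM] z; have [h1 h2] := gC _ (res ^~ z).
  have := bounded_above_cone C0 lb bM h1; have := bounded_above_cone C0 lb bM h2.
  rewrite (linN _ lb) (linB _ _ lb) (lin_comb _ _ lb) => h3 h4.
  have -> : b z = \sum_j a j z * b (x j) by lra.
  by apply: eq_bigr => i _; rewrite mulrC.
have [|F [finF FB FP]] := generating_of_faces_exact la ax _ bspan KC.
  by move=> b [[]].
have [k [f fE]] := finite_family finF.
have fB i : barrier C (f i) by apply: FB; rewrite fE; exists i.
exists k, f; split.
- by move=> i; have [] := fB i.
- by move=> i; have [] := fB i.
- move=> v fv; apply: barrier_char_cone => // b Bb; apply: FP => // h.
  by rewrite fE => -[i _ <-].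
Qed.

Lemma not_faces_exact C : C !=set0 -> closed C -> cvx C -> ~ faces_exact (barrier C) ->
  exists p q, [/\ char_cone C p, forall M : R, ~ char_cone C (q + M *: p) &
    forall b, barrier C b -> b p = 0 -> b q <= 0].
Proof.
move=> C0 clC cC nK; apply: contrapT => h; apply: nK => p q Bp Bq.
apply: contrapT => nM; apply: h; exists p, q; split=> //.
  exact: barrier_char_cone.
move=> M qC; apply: nM; exists M => b [[lb cb] bM].
by have := bounded_above_cone C0 lb bM qC; rewrite (linD _ _ lb) (linZ _ _ lb).
Qed.

Lemma interior_faces_exact C c0 r : closed C -> cvx C -> 0 < r ->
  (forall z, `|z| <= r -> C (c0 + z)) -> ~ faces_exact (barrier C) -> infinitely_hiding C.
Proof.
move=> clC cC r0 rC nK.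
have Cc0 : C c0 by rewrite -[c0]addr0; apply: rC; rewrite normr0 ltW.
have [p [q [pC qC Bq]]] := not_faces_exact (ex_intro _ c0 Cc0) clC cC nK.
exact: (planar_hiding clC cC Cc0 pC qC (barrier_line cC r0 rC Bq)).
Qed.

Lemma component_nearby C A : component C A -> exists K, nearby K A C /\ nearby K C A.
Proof. by move=> [_ /hausdorff_fin[K [_ h1 h2]]]; exists K. Qed.

Lemma recession_system_component C A n (f : 'I_n -> X -> R) : C !=set0 ->
  recession_system C f -> component C A -> recession_system A f.
Proof.
move=> C0 rC CA; have [[_ clA /convex_cvx cA] _] := CA.
by have [K [h1 h2]] := component_nearby CA; exact: recession_system_within h1 h2 rC.
Qed.

Lemma polyhedral_recession_system_component C P : conv_H C -> component C P -> polyhedral P ->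
  exists n (f : 'I_n -> X -> R), recession_system C f.
Proof.
move=> [C0 clC /convex_cvx cC] CP pP; have [[P0 _ _] _] := CP.
have [n [f fP]] := polyhedral_recession_system P0 pP; exists n, f.
by have [K [h1 h2]] := component_nearby CP; exact: recession_system_within h2 h1 fP.
Qed.

Lemma nearby_component C A (K : R) : conv_H A -> nearby K A C -> C `<=` A -> component C A.
Proof.
move=> cA AC CA; split=> //; apply: (@le_lt_trans _ _ (`|K|)%:E); last by rewrite ltry.
apply: hausdorff_le; last by move=> c /CA Ac; exists c => //; rewrite subrr normr0.
by move=> a /AC[c Cc ac]; exists c => //; rewrite (le_trans ac)// ler_norm.
Qed.

(** Since [C] may have no interior points, the argument is applied to its closed
    unit neighbourhood [C1], which belongs to the same component. *)
Lemma not_hiding_recession_system C : conv_H C ->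
  ~ (exists2 A, component C A & positively_hiding A) ->
  exists n (f : 'I_n -> X -> R), recession_system C f.
Proof.
move=> [C0 clC /convex_cvx cC] nh; have [c0 Cc0] := C0.
pose C1 := thickening 1 C.
have cl1 : closed C1 by apply: closed_near; exact: thickening_near.
have cv1 : cvx C1 := thickening_cvx cC.
have CC1 : C `<=` C1 := thickening_sub (A := C) ler01.
have C10 : C1 !=set0 by exists c0; exact: CC1.
have conv1 : conv_H C1 by split=> //; exact/convex_cvx.
have near1 : nearby 2 C1 C.
  by move=> x /(_ 1 ltr01)[c Cc xc]; exists c => //; rewrite ltW//; lra.
have comp1 : component C C1 := nearby_component conv1 near1 CC1.
have ball1 z : `|z| <= 1 -> C1 (c0 + z).
  move=> z1 e e0; exists c0 => //.
  have -> : c0 + z - c0 = z by module.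
  by rewrite (le_lt_trans z1)// ltrDl.
pose K := [set x | C1 (c0 + x)].
have KV v : char_cone K v <-> char_cone C1 v.
  split=> vC c t Cc t0.
    have -> : c + t *: v = c0 + (c - c0 + t *: v) by module.
    apply: vC => //; rewrite /K /=.
    by have -> : c0 + (c - c0) = c by module.
  by rewrite /K /= addrA; exact: vC.
have clK : closed K.
  apply: closed_near => x xK; rewrite /K /=; apply: cl1; apply/closure_near => e e0.
  have [y Ky xy] := xK e e0; exists (c0 + y) => //.
  by have -> : c0 + x - (c0 + y) = x - y by module.
have cvK : cvx K.
  move=> x y t Kx Ky t0 t1; rewrite /K /=.
  have -> : c0 + (t *: x + (1 - t) *: y) = t *: (c0 + x) + (1 - t) *: (c0 + y) by module.
  exact: cv1.
have [inf|/existsNP[n /existsNP[g /not_implyP[cg gK]]]] :=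
    pselect (forall n (g : 'I_n -> X -> R), (forall i, clin (g i)) ->
    exists z, (forall i, g i z = 0) /\ ~ (char_cone K z /\ char_cone K (- z))).
  have [a [w [pa Kw aw amn]]] := localized_system clK cvK ltr01 ball1 inf.
  have [A [cA AC CA hA]] := localized_hiding cl1 cv1 ltr01 pa Kw aw amn C10.
  case: nh; exists A => //; apply: (@nearby_component _ _ (1 + 1 + 2)) => //.
    move=> x /AC[y /near1[c Cc yc] xy]; exists c => //.
    have -> : x - c = (x - y) + (y - c) by module.
    by rewrite (le_trans (ler_normD _ _))// lerD.
  exact: subset_trans CC1 CA.
have [n' [f rf]] : exists k (f : 'I_k -> X -> R), recession_system C1 f.
  apply: (faces_exact_recession_system (g := g) C10 cl1 cv1).
  - by move=> i; have [] := cg i.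
  - move=> z gz; apply: contrapT => nz; apply: gK; exists z; split=> //.
    by rewrite !KV.
  - apply: contrapT => nK; apply: nh; exists C1 => //.
    apply: infinitely_positively_hiding => //.
    exact: (interior_faces_exact cl1 cv1 ltr01 ball1 nK).
exists n', f; have [K' [h1 h2]] := component_nearby comp1.
exact: recession_system_within h2 h1 rf.
Qed.

End Dichotomy.

(** * Finite-dimensional spaces *)

Section FiniteDimension.
Context {R : realType} {X : normedModType R}.
Implicit Types (C : set X).

Lemma clin_separates (z : X) : (forall f, clin f -> f z = 0) -> z = 0.
Proof.
move=> fz; apply: contrapT => z0.
have c1 : cvx [set 0 : X].
  by move=> _ _ t -> -> _ _ /=; rewrite !scaler0 addr0.
have [||f [b [cf /(_ 0 erefl) f0 bf]]] := @separation R X [set 0] z _ _ c1 z0.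
- by exists 0.
- by apply: accessible_closed_set1; exact/hausdorff_accessible/norm_hausdorff.
- by move: bf f0; rewrite (fz f cf) (lin0 cf.1); lra.
Qed.

(** The size of a dual system is bounded by the dimension, and the continuous
    functionals separate the points. *)
Lemma finite_dim_dual_system (G : set X) : finite_dim X ->
  exists m (a : 'I_m -> X -> R) (x : 'I_m -> X),
    [/\ forall i, clin (a i), forall i, G (x i), dual_system a x &
        forall z, G z -> z = \sum_i a i z *: x i].
Proof.
move=> [n [e eX]].
have [||||m [a [x [[ca Gx ax] res]]]] := @maximal_dual_system R X clin G _ _ _ n.
- by move=> a [].
- by move=> b m c a cb ca; have := clinB 1 cb (clin_comb c ca); under eq_fun do rewrite mul1r.
- by move=> b k; exact: clinZ.
- move=> m a x [ca _ ax]; have /choice[c xE] : forall j, exists c, x j = \sum_(k < n) c k *: e k.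
    by move=> j; exact: eX.
  apply: (dual_system_rank ax (A := fun i k => a i (e k)) (B := fun k j => c j k)).
  move=> i j; rewrite xE (lin_comb _ _ (ca i).1).
  by apply: eq_bigr => k _; rewrite mulrC.
exists m, a, x; split=> // z Gz; apply/eqP; rewrite -subr_eq0; apply/eqP.
by apply: clin_separates => f cf; exact: res.
Qed.

Lemma cvx_sum C c0 m (d : 'I_m -> X) (y : 'I_m -> R) : cvx C -> C c0 ->
  (forall i, C (c0 + d i)) -> (forall i, 0 <= y i) -> \sum_i y i <= 1 ->
  C (c0 + \sum_i y i *: d i).
Proof.
move=> cC Cc0; elim: m d y => [|m IH] d y Cd y0; first by rewrite !big_ord0 addr0.
rewrite !big_ord_recr /=; set l := y ord_max => y1.
have s0 : 0 <= \sum_(i < m) y (widen_ord (leqnSn m) i) by exact: sumr_ge0.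
have l0 : 0 <= l by exact: y0.
have [l1|l1] := eqVneq l 1.
  rewrite l1 scale1r big1 ?add0r// => i _.
  have : \sum_(i < m) y (widen_ord (leqnSn m) i) <= 0 by lra.
  rewrite (bigD1 i)//= => h.
  have h2 : 0 <= \sum_(j < m | j != i) y (widen_ord (leqnSn m) j) by exact: sumr_ge0.
  have -> : y (widen_ord (leqnSn m) i) = 0.
    by have := y0 (widen_ord (leqnSn m) i); lra.
  by rewrite scale0r.
have l2 : 0 < 1 - l by rewrite lt_neqAle eq_sym subr_eq0 eq_sym l1/=; lra.
have ln : 1 - l != 0 by rewrite gt_eqF.
have Cw : C (c0 + \sum_(i < m) (y (widen_ord (leqnSn m) i) / (1 - l)) *:
    d (widen_ord (leqnSn m) i)).
  apply: IH => // [i|]; first by rewrite divr_ge0// ltW.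
  by rewrite -mulr_suml ler_pdivrMr// mul1r; lra.
have -> : c0 + (\sum_(i < m) y (widen_ord (leqnSn m) i) *: d (widen_ord (leqnSn m) i) +
    l *: d ord_max) = (1 - l) *: (c0 + \sum_(i < m) (y (widen_ord (leqnSn m) i) / (1 - l)) *:
    d (widen_ord (leqnSn m) i)) + (1 - (1 - l)) *: (c0 + d ord_max).
  have -> : \sum_(i < m) (y (widen_ord (leqnSn m) i) / (1 - l)) *:
      d (widen_ord (leqnSn m) i) = (1 - l)^-1 *:
      \sum_(i < m) y (widen_ord (leqnSn m) i) *: d (widen_ord (leqnSn m) i).
    by rewrite scaler_sumr; apply: eq_bigr => i _; rewrite scalerA mulrC.
  by module_field.
apply: cC => //; lra.
Qed.

(** The interior points needed for [barrier_line] exist only relatively to the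
    affine hull of [C]. The cylinder over [C], with respect to a projection [pi]
    onto the direction of the affine hull, has interior points and fewer barrier
    functionals. Both [p] and [q] are fixed by [pi], so the points that
    [barrier_line] finds in the cylinder are points of [C]. *)
Lemma finite_dim_recession_system C : finite_dim X -> conv_H C -> ~ infinitely_hiding C ->
  exists n (f : 'I_n -> X -> R), recession_system C f.
Proof.
move=> fdX [C0 clC /convex_cvx cC] nh; have [c0 Cc0] := C0.
have [k [g [e [cg _ _ gE]]]] := finite_dim_dual_system setT fdX.
apply: (faces_exact_recession_system (g := g) C0 clC cC).
- by move=> i; have [] := cg i.
- move=> z gz; have -> : z = 0 by rewrite (gE z I) big1// => i _; rewrite gz scale0r.
  by rewrite oppr0; split=> c t Cc _; rewrite scaler0 addr0.
apply: contrapT => nK; apply: nh.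
have [p [q [pC qC Bq]]] := not_faces_exact C0 clC cC nK.
have [m [a [d [ca dG ad dE]]]] := finite_dim_dual_system [set z | C (c0 + z)] fdX.
pose pi z := \sum_i a i z *: d i.
have la i : lin (a i) := (ca i).1.
have piD z w : pi (z + w) = pi z + pi w.
  by rewrite /pi -big_split; apply: eq_bigr => i _; rewrite (linD _ _ (la i)) scalerDl.
have piZ t z : pi (t *: z) = t *: pi z.
  by rewrite /pi scaler_sumr; apply: eq_bigr => i _; rewrite (linZ _ _ (la i)) scalerA.
have pid i : pi (d i) = d i by rewrite /pi -dE//; exact: dG.
have piC c : C c -> pi (c - c0) = c - c0.
  by move=> Cc; rewrite /pi -dE//= addrC subrK.
(* [b0] below is the barycentre, relative to [c0], of the simplex with vertices [c0] and the [c0 + d i] *)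
pose y0 : R := (m.+1%:R)^-1.
have y00 : 0 < y0 by rewrite invr_gt0.
pose b0 := \sum_(i < m) y0 *: d i.
have pib : pi b0 = b0.
  rewrite /b0; apply: (big_ind (fun z => pi z = z)).
  - by rewrite /pi big1// => i _; rewrite (lin0 (la i)) scale0r.
  - by move=> z w hz hw; rewrite piD hz hw.
  - by move=> i _; rewrite piZ pid.
have pip : pi p = p.
  have := piC (c0 + p) (char_cone_translate Cc0 pC).
  by have -> : c0 + p - c0 = p by module.
have piq : pi q = q.
  apply/eqP; rewrite eq_sym -subr_eq0; apply/eqP; apply: clin_separates => f cf.
  pose b z := f z - \sum_i f (d i) * a i z.
  have cb : clin b.
    by have := clinB 1 cf (clin_comb (fun i => f (d i)) ca); under eq_fun do rewrite mul1r.
  have bE z : b z = f (z - pi z).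
    rewrite /b (linB _ _ cf.1) /pi (lin_comb _ _ cf.1); congr (_ - _).
    by apply: eq_bigr => i _; rewrite mulrC.
  have b1 c : C c -> b c = b c0.
    move=> Cc; apply/eqP; rewrite -subr_eq0 -(linB _ _ cb.1) bE piC// subrr.
    by rewrite (lin0 cf.1).
  have bp : b p = 0 by rewrite bE pip subrr (lin0 cf.1).
  have h1 : b q <= 0.
    by apply: Bq => //; split=> //; exists (b c0) => c /b1 ->.
  have cNb : clin (fun z => -1 * b z) by exact: clinZ.
  have h2 : -1 * b q <= 0.
    apply: (Bq (fun z => -1 * b z)); last by rewrite bp mulr0.
    by split=> //; exists (-1 * b c0) => c /b1 ->.
  by rewrite -bE; lra.
pose cyl := [set x | C (c0 + pi (x - c0))].
have /choice[L LP] : forall i, exists L : R, 0 <= L /\ forall x, `|a i x| <= L * `|x|.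
  by move=> i; have [_ [L L0 h]] := ca i; exists L.
pose LL := \sum_i L i.
have LL0 : 0 <= LL by apply: sumr_ge0 => i _; exact: (LP i).1.
have aL i x : `|a i x| <= LL * `|x|.
  rewrite (le_trans ((LP i).2 x))// ler_wpM2r// /LL (bigD1 i)//= lerDl.
  by apply: sumr_ge0 => j _; exact: (LP j).1.
pose r := y0 ^+ 2 / (LL + 1).
have L1 : 0 < LL + 1 by rewrite ltr_wpDl.
have r0 : 0 < r by rewrite divr_gt0// exprn_gt0.
have y01 : y0 <= 1 by rewrite invf_le1// ler1n.
have my0 : m%:R * y0 = 1 - y0.
  have : m.+1%:R * y0 = 1 by rewrite divff// pnatr_eq0.
  by rewrite -natr1; lra.
have rcyl z : `|z| <= r -> cyl (c0 + b0 + z).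
  move=> zr; rewrite /cyl /=.
  have -> : c0 + b0 + z - c0 = b0 + z by module.
  rewrite piD pib.
  have -> : b0 + pi z = \sum_i (y0 + a i z) *: d i.
    by rewrite /b0 /pi -big_split; apply: eq_bigr => i _; rewrite scalerDl.
  have az i : `|a i z| <= y0 ^+ 2.
    have h1 : LL * `|z| <= LL * r by rewrite ler_wpM2l.
    have h2 : LL * r <= y0 ^+ 2.
      rewrite /r mulrCA ler_piMr ?exprn_ge0 ?(ltW y00)//.
      by rewrite ler_pdivrMr// mul1r lerDl.
    exact: le_trans (aL i z) (le_trans h1 h2).
  apply: cvx_sum => // [i|].
    have := az i; rewrite ler_norml => /andP[h _].
    have : y0 ^+ 2 <= y0 by rewrite expr2 ler_piMr// ltW.
    lra.
  apply: (@le_trans _ _ (\sum_(i < m) (y0 + y0 ^+ 2))).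
    apply: ler_sum => i _; rewrite lerD2l.
    by have := az i; rewrite ler_norml => /andP[].
  rewrite sumr_const card_ord -mulr_natl mulrDr my0 expr2 mulrA my0.
  by have := sqr_ge0 y0; rewrite expr2; lra.
have ccyl : cvx cyl.
  move=> x z t Cx Cz t0 t1; rewrite /cyl /=.
  have -> : t *: x + (1 - t) *: z - c0 = t *: (x - c0) + (1 - t) *: (z - c0) by module.
  rewrite piD !piZ.
  have -> : c0 + (t *: pi (x - c0) + (1 - t) *: pi (z - c0)) =
    t *: (c0 + pi (x - c0)) + (1 - t) *: (c0 + pi (z - c0)) by module.
  exact: cC.
have Bcyl b : barrier cyl b -> barrier C b.
  move=> [cb [M bM]]; split=> //; exists M => c Cc; apply: bM; rewrite /cyl /= piC//.
  by have -> : c0 + (c - c0) = c by module.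
have Cb0 : C (c0 + b0).
  have := rcyl 0; rewrite normr0 addr0 /cyl /= => /(_ (ltW r0)).
  have -> : c0 + b0 - c0 = b0 by module.
  by rewrite pib.
apply: (planar_hiding clC cC Cb0 pC qC) => h h0.
have [T] := barrier_line ccyl r0 rcyl (fun b Bb => Bq b (Bcyl b Bb)) h0.
rewrite /cyl /=.
have -> : c0 + b0 + h *: q + T *: p - c0 = b0 + h *: q + T *: p by module.
rewrite !piD !piZ pib pip piq !addrA => CT; by exists T.
Qed.

End FiniteDimension.

Theorem theorem1p1 (R : realType) (X : completeNormedModType R) (C : set X)
    (C_neq0 : C !=set0) (C_closed : closed C)
    (C_convex : convex_set (C : set (convex_lmodType X))) :
  [<-> approx_polyhedral C;
       polyhedral (char_cone C) /\ (hausdorff_dist C (char_cone C) < +oo)%E;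
       exists2 P : set X, component C P & polyhedral P;
       ~ (exists2 A : set X, component C A & positively_hiding A);
       separable_space (component_space C);
       density_lt (component_space C) [set: R]]
  /\
  (finite_dim X ->
    [<-> approx_polyhedral C;
         ~ positively_hiding C;
         ~ infinitely_hiding C]).
Proof.
have convC : conv_H C by [].
have cC : cvx C by exact/convex_cvx.
have approx n (f : 'I_n -> X -> R) : recession_system C f -> approx_polyhedral C.
  exact: recession_system_approx.
have approx_system : approx_polyhedral C -> exists n (f : 'I_n -> X -> R), recession_system C f.
  move=> /(_ 1 ltr01)[P [P0 pP CP]].
  apply: (polyhedral_recession_system_component (P := P)) => //.
  split; first exact: polyhedral_conv.
  by rewrite hausdorff_dist_sym (lt_trans CP)// ltry.
split.
  tfae.
  - by move=> /approx_system[n [f fC]]; exact: recession_system_within_cone fC.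
  - move=> [pV CV]; exists (char_cone C) => //; split; last by rewrite hausdorff_dist_sym.
    by apply: polyhedral_conv => //; exists 0 => c t Cc _; rewrite scaler0 addr0.
  - move=> [P CP pP] [A CA]; have [n [f fC]] := polyhedral_recession_system_component convC CP pP.
    exact: recession_system_not_hiding (recession_system_component C_neq0 fC CA).
  - move=> /(not_hiding_recession_system convC)[n [f fC]].
    exact: recession_system_separable fC.
  - exact: separable_density_lt.
  - move=> dC; have [|n [f fC]] := not_hiding_recession_system convC; last exact: approx fC.
    by move=> [A CA hA]; exact: density_not_hiding CA hA dC.
move=> fdX; tfae.
- by move=> /approx_system[n [f fC]]; exact: recession_system_not_hiding fC.
- by move=> nh /(infinitely_positively_hiding C_neq0).
- by move=> /(finite_dim_recession_system fdX convC)[n [f fC]]; exact: approx fC.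
Qed.
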